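(* Assume that $(X,d)$ and $E$ satisfy the conditions (A1)--(A8) listed in the context. Let $(\bar\omega_t)_{t\in[0,T]}$, $\bar\omega_t\colon X\to X$, be a transition rule compatible with an action $(c_t)_{t\in[0,T]}$ and satisfying Axioms 1, 2 and 3' (see context). Let $x_0\in X$ with $|\partial E_0|(x_0)=0$. Then for every sequence of positive numbers $\delta_n\to0$, with corresponding discrete quasistatic evolutions $\eta^{\delta_n}\colon[0,T]\to X$ starting from $x_0$, one can extract a (not relabeled) subsequence such that: (i) the curves $\hat\eta^{\delta_n}(t):=q\big(t,\eta^{\delta_n}(t)\big)$ converge pointwise on $[0,T]$ to a piecewise continuous limiting curve $\hat\eta\colon[0,T]\to\mathcal X$; (ii) there is a positive Radon measure $\bar\mu\in\mathcal M([0,T])$ with $\mu^{\delta_n}\rightharpoonup^*\bar\mu$; moreover, the set $J:=\mathrm{supp}\,\bar\mu$ consists of countably many points; (iii) the left and right limits $\hat\eta^-(t),\hat\eta^+(t)$ of $\hat\eta$ exist for every $t\in(0,T)$, and so do $\hat\eta^+(0)$ and $\hat\eta^-(T)$; (iv) for all $0\le s<t\le T$, $$\hat E\big(\hat\eta^+(t)\big)-\hat E\big(\hat\eta^-(s)\big)=\int_s^t\partial_t\hat E\big(\hat\eta(\tau)\big)\,d\tau-\bar\mu([s,t]);$$ (v) $|\partial\hat E_t|\big(\hat\eta(t)\big)=0$ for all $t\in[0,T]$; (vi) $\hat\eta$ is continuous in $[0,T]\setminus J$, and for every $t\in J$ $$\hat E\big(\hat\eta^-(t)\big)-\hat E\big(\hat\eta^+(t)\big)=\bar\mu(\{t\})=\hat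 c_t\big(\hat\eta^-(t),\hat\eta^+(t)\big).$$
   Context: Setting: $T>0$; $(X,d)$ is a metric space; $E\colon[0,T]\times X\to\mathbb R$, written $E_t(x)$. Slope: $|\partial E_t|(x)=\limsup_{x'\to x}\frac{(E_t(x)-E_t(x'))^+}{d(x,x')}$. $\mathrm{Crit}_t=\{x\in X:|\partial E_t|(x)=0\}$. (A1) $(X,d)$ is locally compact. (A2) $E$ is continuous; it is differentiable in $t$ with $\partial_tE$ continuous on $[0,T]\times X$; and $(t,x)\mapsto|\partial E_t|(x)$ is real-valued and continuous on $[0,T]\times X$. (A3) There are $C_1,C_2>0$ with $|\partial_tE_t(x)|\le C_1E_t(x)+C_2$ for all $(t,x)$. (A4) With $G(x)=\sup_{t\in[0,T]}|E_t(x)|$, the set $\{G\le C\}$ is compact for every $C\in\mathbb R$. (A5) For every $t$, $\mathrm{Crit}_t$ can be expressed as a disjoint union of well-separated compact sets, each of them path-connected with rectifiable paths; moreover $E_t$ is constant on every path-connected component of $\mathrm{Crit}_t$. (A6) For every $t\in[0,T]$ and $x\in\mathrm{Crit}_t$ there are a neighborhood $U$ of $x$ and $\varepsilon_x\colon[0,\infty)\to[0,\infty)$ with $\varepsilon_x(0)=\lim_{s\to0^+}\varepsilon_x(s)=0$ such that $E_t(x')-E_t(x)\ge-\varepsilon_x(d(x,x'))\,|\partial E_t|(x')$ for all $x'\in U$. Moreover $t\mapsto|\partial E_t|(x)$ is Lipschitz on $[0,T]$, locally uniformly in $x$. (A7) $(X,d)$ is a path space: $d(x,x')=\inf\{\int_0^1|\dot\eta(s)|ds:\eta\in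 AC([0,1],X),\eta(0)=x,\eta(1)=x'\}$ ($|\dot\eta|$ the metric derivative); and there is $L>0$ with $\big||\partial E_t|(x)-|\partial E_t|(x')\big|\le L\,d(x,x')$ for all $t,x,x'$. Quotient space: $\mathcal X=([0,T]\times X)/\!\sim$ with the quotient topology, where $(t_1,x_1)\sim(t_2,x_2)$ iff they are equal, or $t_1=t_2$ and $x_1,x_2$ belong to the same path-connected component of $\mathrm{Crit}_{t_1}$; $q\colon[0,T]\times X\to\mathcal X$ is the quotient map and $[(t,x)]=q(t,x)$. (A8) $\partial_tE$ is constant on each equivalence class, so that $\partial_t\hat E([(s,x)]):=\partial_tE_s(x)$ is well defined on $\mathcal X$, and $\partial_t\hat E\colon\mathcal X\to\mathbb R$ is continuous. By (A5), $\hat E([(t,x)]):=E_t(x)$ is well defined on $\mathcal X$; likewise $|\partial\hat E_t|([(t,x)]):=|\partial E_t|(x)$. Transition rule: a family of maps $\bar\omega_t\colon X\to X$, $t\in[0,T]$. Discrete quasistatic evolution: given $\delta>0$ and $x_0$ with $|\partial E_0|(x_0)=0$, let $M=\lfloor T/\delta\rfloor$ (or $M=T/\delta-1$ if $T/\delta\in\mathbb Z$), $w_0=x_0$, $w_i=\bar\omega_{i\delta}(w_{i-1})$ for $i=1,\dots,M$; set $\eta^\delta(t)=w_i$ for $t\in[i\delta,(i+1)\delta)$, $i<M$, and $\eta^\delta(t)=w_M$ for $t\in[M\delta,T]$. Let $J^\delta=\{i\delta:1\le i\le M\}$, $\mathcal E_t(\eta^\delta)=E_t(\eta^\delta(t))$,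 $\mathcal E^\pm_t$ its right/left limits in time ($\mathcal E^-_0:=\mathcal E_0$, $\mathcal E^+_T:=\mathcal E_T$), and $\mu^\delta(B)=\sum_{t\in J^\delta\cap B}[\mathcal E^-_t(\eta^\delta)-\mathcal E^+_t(\eta^\delta)]$ for Borel $B\subset[0,T]$. Axiom 1: $E_t(\bar\omega_t(x))\le E_t(x)$ for all $x,t$. Axiom 2: $|\partial E_t|(\bar\omega_t(x))=0$ for all $x,t$. Action: a family $(c_t)_{t\in[0,T]}$ of lower semicontinuous functions $c_t\colon X\times X\to[0,\infty)$ with $E_t(x)-E_t(x')\le c_t(x,x')$ for all $x,x',t$. A transition rule is compatible with the action if $E_t(x)-E_t(\bar\omega_t(x))=c_t(x,\bar\omega_t(x))$ for all $x,t$. Axiom 3': $\bar\omega_t$ is compatible with an action $c_t$ such that: for all $\varepsilon,C>0$, $t\in[0,T]$ and compact $K\subset X$ there is $\Delta>0$ such that for all $n\ge2$, $x_1,\dots,x_n\in K$ and $t_1,\dots,t_n\in[t-\Delta,t+\Delta]\cap[0,T]$ with $\sum_{i=1}^{n-1}c_{t_i}(x_i,x_{i+1})\le C$ one has $c_t(x_1,x_n)\le\sum_{i=1}^{n-1}c_{t_i}(x_i,x_{i+1})+\varepsilon$; furthermore, for $x,x'\in\mathrm{Crit}_t$, $c_t(x,x')=0$ iff $x,x'$ lie in the same path-connected component of $\mathrm{Crit}_t$. Under Axiom 3', $\hat c_t([(t,x)],[(t,x')]):=c_t(x,x')$ is well defined. Conventions: $\hat\eta^\pm(t)$ are the right/left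 limits of $\hat\eta$ in $\mathcal X$; at the endpoints $\hat\eta^-(0):=\hat\eta(0)$, $\hat\eta^+(T):=\hat\eta(T)$. The piecewise continuity in (i) is made precise by (iii) and (vi).
   Formalization: J = supp of the limit measure is taken as the set of its atoms (shown countable and of full measure), not the closed support, which can be an uncountable Cantor set under (A1)-(A8). *)

(* Defs.v *)
(* MathComp-Analysis, over an arbitrary R : realType.                         *)
From HB Require Import structures.
From mathcomp Require Import all_boot all_order all_algebra generic_quotient.
From mathcomp Require Import all_classical all_reals all_analysis.
From mathcomp Require Import lra.

Set Implicit Arguments.
Unset Strict Implicit.
Unset Printing Implicit Defensive.

Import Order.TTheory GRing.Theory Num.Theory.
Import numFieldNormedType.Exports.

Local Open Scope classical_set_scope.
Local Open Scope ring_scope.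
Local Open Scope quotient_scope.

(* Functions of time (energy, action, transition rule, curves) are total on   *)
(* R; only their values at times in [0, T] are constrained or used. The       *)
(* quotient space, however, is built over [0, T] * X itself.                  *)

Section Paths.
Context {R : realType} {X : topologicalType}.
Implicit Types (A : set X) (x y z : X).

(* Empty when x is not in A. *)
Definition path_component A x : set X :=
  [set y | exists g : R -> X,
    [/\ {within `[0, 1], continuous g}, g 0 = x, g 1 = y &
        g @` `[0, 1] `<=` A]].

Lemma within_continuous_reparam (B C : set R) (g : R -> X) (phi : R -> R) :
  continuous phi -> phi @` C `<=` B ->
  {within B, continuous g} -> {within C, continuous (g \o phi)}.
Proof.
move=> cphi phiCB /subspace_continuousP cg; apply/subspace_continuousP => s Cs.
have Bs : B (phi s) by apply: phiCB; exists s.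
move=> U /(cg _ Bs); rewrite /= /within /= => gU.
move: (cphi s _ gU); apply: (@filterS R (nbhs s)) => r /= rU Cr.
by apply: rU; apply: phiCB; exists r.
Qed.

Lemma path_component_sym A x y : path_component A x y -> path_component A y x.
Proof.
have h (s : R) : s \in `[0, 1] -> 1 - s \in `[0, 1].
  by rewrite !in_itv /= => /andP[s0 s1]; rewrite subr_ge0 s1 lerBlDr lerDl.
move=> [g [cg g0 g1 gA]]; exists (g \o (fun s => 1 - s)); split.
- apply: within_continuous_reparam cg.
    by move=> s; apply: cvgB; [exact: cvg_cst|exact: cvg_id].
  by move=> _ [s /= s01 <-]; exact: h.
- by rewrite /= subr0.
- by rewrite /= subrr.
- by move=> _ [s s01 <-]; apply: gA; exists (1 - s) => //; exact: h.
Qed.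

Lemma path_component_trans A x y z :
  path_component A x y -> path_component A y z -> path_component A x z.
Proof.
have hl (s : R) : s \in `[0, 2^-1] -> 2 * s \in `[0, 1].
  by rewrite !in_itv /= => /andP[s0 s1]; apply/andP; split; lra.
have hr (s : R) : s \in `[2^-1, 1] -> 2 * s - 1 \in `[0, 1].
  by rewrite !in_itv /= => /andP[s0 s1]; apply/andP; split; lra.
move=> [f [cf f0 f1 fA]] [g [cg g0 g1 gA]].
pose k (s : R) := if s <= 2^-1 then f (2 * s) else g (2 * s - 1).
have kfE (s : R) : s <= 2^-1 -> f (2 * s) = k s by move=> s2; rewrite /k s2.
have kgE (s : R) : 2^-1 <= s -> g (2 * s - 1) = k s.
  rewrite /k; case: ifPn => // s1 s2.
  have -> : s = 2^-1 by apply/eqP; rewrite eq_le s1 s2.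
  by rewrite mulfV// subrr g0 f1.
have kl : {within `[0, 2^-1], continuous k}.
  apply: (@subspace_eq_continuous _ _ _ (f \o (fun s => 2 * s))).
    by move=> s; rewrite inE /= in_itv /= => /andP[_ s2]; exact: kfE.
  apply: within_continuous_reparam cf.
    by move=> s; apply: cvgM; [exact: cvg_cst|exact: cvg_id].
  by move=> _ [s /= s01 <-]; exact: hl.
have kr : {within `[2^-1, 1], continuous k}.
  apply: (@subspace_eq_continuous _ _ _ (g \o (fun s => 2 * s - 1))).
    by move=> s; rewrite inE /= in_itv /= => /andP[s2 _]; exact: kgE.
  apply: within_continuous_reparam cg.
    move=> s; apply: cvgB; last exact: cvg_cst.
    by apply: cvgM; [exact: cvg_cst|exact: cvg_id].
  by move=> _ [s /= s01 <-]; exact: hr.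
exists k; split.
- have -> : `[0, 1]%classic = `[0, 2^-1] `|` `[2^-1, 1] :> set R.
    apply/seteqP; split => s /=; rewrite !in_itv /=.
      move=> /andP[s0 s1]; rewrite s0 s1 andbT.
      by case: (leP s 2^-1) => [|/ltW]; [left|right].
    by case=> /andP[s0 s1]; apply/andP; split; lra.
  apply: withinU_continuous kl kr; exact: itv_closed.
- by rewrite /k ifT ?mulr0//; lra.
- by rewrite /k ifF; [rewrite -[RHS]g1; congr g; lra|apply/negbTE; rewrite -ltNge; lra].
- move=> _ [s s01 <-]; rewrite /k; move: s01; rewrite /= in_itv /= => /andP[s0 s1].
  case: ifPn => s2.
    by apply: fA; exists (2 * s) => //; apply: hl; rewrite in_itv /= s0.
  apply: gA; exists (2 * s - 1) => //; apply: hr.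
  by rewrite in_itv /= s1 andbT ltW// ltNge.
Qed.

End Paths.

Section Metric.
Context {R : realType} {X : metricType R}.

(* |df|(x). The maximum with 0 only matters at an isolated point, where the   *)
(* limsup over the (empty) punctured neighbourhood would be -oo.              *)
Definition slope (f : X -> R) (x : X) : \bar R :=
  maxe 0%E
    (limf_esup (fun x' => (Num.max (f x - f x') 0 / mdist x x')%:E) x^').

Definition crit (f : X -> R) : set X := [set x | slope f x = 0%E].

Definition curve_length (g : R -> X) (a b : R) : \bar R :=
  ereal_sup [set (\sum_(0 <= n < size s)
      let F := g \o nth b (a :: s) in mdist (F n) (F n.+1))%:E
    | s in itv_partition a b].

Definition rectifiably_connected (A : set X) := forall x y, A x -> A y ->
  exists g : R -> X,
    [/\ {within `[0, 1], continuous g}, g 0 = x, g 1 = y,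
        g @` `[0, 1] `<=` A & (curve_length g 0 1 < +oo)%E].

(* g belongs to AC([a, b], X): d (g s) (g t) <= \int_s^t m with m in L^1.     *)
Definition abs_continuous (a b : R) (g : R -> X) := exists m : R -> R,
  lebesgue_measure.-integrable `[a, b] (EFin \o m) /\
  forall s t, a <= s -> s <= t -> t <= b ->
    ((mdist (g s) (g t))%:E <= \int[lebesgue_measure]_(r in `[s, t]) (m r)%:E)%E.

Definition metric_speed (g : R -> X) (s : R) : R :=
  lim (mdist (g r) (g s) / `|r - s| @[r --> s^']).

Definition path_space := forall x y : X,
  (mdist x y)%:E = ereal_inf
    [set (\int[lebesgue_measure]_(s in `[0%R, 1%R]) (metric_speed g s)%:E)%E
      | g in [set g | [/\ abs_continuous 0 1 g, g 0 = x & g 1 = y]]].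

End Metric.

Section Energy.
Context {R : realType} {X : metricType R}.
Variables (T : R) (E : R -> X -> R).

Definition time_quotient (t : R) (x : X) (s : R) : R :=
  (E s x - E t x) / (s - t).

(* One-sided at t = 0 and t = T. *)
Definition power (t : R) (x : X) : R :=
  lim (time_quotient t x s @[s --> within `[0, T] t^']).

Definition regular_energy :=
  [/\ {within `[0, T] `*` setT, continuous (fun p : R * X => E p.1 p.2)},
      forall t x, t \in `[0, T] ->
        cvg (time_quotient t x s @[s --> within `[0, T] t^']),
      {within `[0, T] `*` setT, continuous (fun p : R * X => power p.1 p.2)},
      forall t x, t \in `[0, T] -> slope (E t) x \is a fin_num &
      {within `[0, T] `*` setT,
        continuous (fun p : R * X => fine (slope (E p.1) p.2))}].

Definition power_control := exists C1 C2 : R, [/\ 0 < C1, 0 < C2 &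
  forall t x, t \in `[0, T] -> `|power t x| <= C1 * E t x + C2].

Definition compact_sublevels := forall C : R,
  compact [set x | (ereal_sup [set `|E t x|%:E | t in `[0%R, T]] <= C%:E)%E].

(* "Well-separated": each piece lies at positive distance from the union of   *)
(* all the other pieces.                                                      *)
Definition critical_structure := forall t, t \in `[0, T] ->
  (exists F : set (set X),
    [/\ crit (E t) = \bigcup_(A in F) A,
        trivIset F id,
        forall A, F A -> exists2 r : R, 0 < r &
          forall B, F B -> B <> A -> forall x y, A x -> B y -> r <= mdist x y &
        forall A, F A -> compact A /\ rectifiably_connected A]) /\
  (forall x y, path_component (R := R) (crit (E t)) x y -> E t x = E t y).

Definition critical_inequality := forall t x, t \in `[0, T] -> crit (E t) x ->
  exists (U : set X) (eps : R -> R),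
    [/\ nbhs x U,
        forall s, 0 <= s -> 0 <= eps s,
        eps 0 = 0,
        eps s @[s --> 0^'+] --> 0 &
        forall x', U x' ->
          - eps (mdist x x') * fine (slope (E t) x') <= E t x' - E t x].

Definition slope_lipschitz_in_time := forall x0 : X,
  exists (U : set X) (k : R), nbhs x0 U /\
    forall x s t, U x -> s \in `[0, T] -> t \in `[0, T] ->
      `|fine (slope (E s) x) - fine (slope (E t) x)| <= k * `|s - t|.

Definition slope_lipschitz_in_space := exists2 L : R, 0 < L &
  forall t x x', t \in `[0, T] ->
    `|fine (slope (E t) x) - fine (slope (E t) x')| <= L * mdist x x'.

(* `[0, T]%classic is used as a type below: it is the subtype of times.       *)
Definition state_rel (p p' : `[0, T]%classic * X) : bool :=
  `[< p = p' \/ p.1 = p'.1 /\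
      path_component (R := R) (crit (E (\val p.1))) p.2 p'.2 >].

Lemma state_rel_refl : reflexive state_rel.
Proof. by move=> p; apply/asboolP; left. Qed.

Lemma state_rel_sym : symmetric state_rel.
Proof.
have h p p' : state_rel p p' -> state_rel p' p.
  move=> /asboolP[->|[e pp']]; apply/asboolP; [by left|right].
  by rewrite -e; split => //; exact: path_component_sym.
by move=> p p'; apply/idP/idP; exact: h.
Qed.

Lemma state_rel_trans : transitive state_rel.
Proof.
move=> p p1 p2 /asboolP[->//|[e1 h1]] /asboolP[<-|[e2 h2]]; apply/asboolP; right.
  by [].
by rewrite e1; split => //; apply: path_component_trans h2; rewrite -e1.
Qed.

Definition state_equiv : equiv_rel _ :=
  EquivRel state_rel state_rel_refl state_rel_sym state_rel_trans.

Definition state_space := quotient_topology {eq_quot state_equiv}.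

HB.instance Definition _ := Topological.on state_space.
HB.instance Definition _ := Quotient.on state_space.

Definition state (t : `[0, T]%classic) (x : X) : state_space :=
  \pi_state_space (t, x).

(* The lifts to the quotient are evaluated at the canonical representative    *)
(* repr xi = (t, x) of the class xi = [(t, x)].                               *)
Definition energy_hat (xi : state_space) : R :=
  E (\val (repr xi).1) (repr xi).2.

Definition power_hat (xi : state_space) : R :=
  power (\val (repr xi).1) (repr xi).2.

Definition slope_hat (t : R) (xi : state_space) : \bar R :=
  slope (E t) (repr xi).2.

Definition action_hat (c : R -> X -> X -> R) (t : R) (xi xi' : state_space) : R :=
  c t (repr xi).2 (repr xi').2.

Definition power_lifts :=
  (forall (t : `[0, T]%classic) x x', state t x = state t x' ->
     power (\val t) x = power (\val t) x') /\
  continuous power_hat.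

Section Transition.
Variables (omega : R -> X -> X) (c : R -> X -> X -> R).

Definition energy_nonincreasing := forall t x, t \in `[0, T] ->
  E t (omega t x) <= E t x.

Definition reaches_critical := forall t x, t \in `[0, T] ->
  slope (E t) (omega t x) = 0%E.

Definition is_action := forall t, t \in `[0, T] ->
  [/\ forall x x', 0 <= c t x x',
      lower_semicontinuous (fun p : X * X => (c t p.1 p.2)%:E) &
      forall x x', E t x - E t x' <= c t x x'].

Definition compatible := forall t x, t \in `[0, T] ->
  E t x - E t (omega t x) = c t x (omega t x).

Definition chain_condition :=
  forall (eps C t : R) (K : set X), 0 < eps -> 0 < C -> t \in `[0, T] ->
  compact K ->
  exists2 Delta : R, 0 < Delta &
    forall (n : nat) (x : nat -> X) (s : nat -> R), (2 <= n)%N ->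
    (forall i, (1 <= i <= n)%N ->
      [/\ K (x i), s i \in `[t - Delta, t + Delta] & s i \in `[0, T]]) ->
    \sum_(1 <= i < n) c (s i) (x i) (x i.+1) <= C ->
    c t (x 1%N) (x n) <= \sum_(1 <= i < n) c (s i) (x i) (x i.+1) + eps.

Definition zero_action_iff := forall t x x', t \in `[0, T] ->
  crit (E t) x -> crit (E t) x' ->
  c t x x' = 0 <-> path_component (R := R) (crit (E t)) x x'.

Section Discrete.
Variables (x0 : X) (delta : R).

Definition nsteps : nat :=
  let k := Num.truncn (T / delta) in
  if T / delta == k%:R then k.-1 else k.

Fixpoint iterate (i : nat) : X :=
  if i is j.+1 then omega (i%:R * delta) (iterate j) else x0.

Definition discrete_evolution (t : R) : X :=
  iterate (minn (Num.truncn (t / delta)) nsteps).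

Let curve_energy (t : R) : R := E t (discrete_evolution t).

Definition energy_left (t : R) : R :=
  if t == 0 then curve_energy t else lim (curve_energy s @[s --> t^'-]).

Definition energy_right (t : R) : R :=
  if t == T then curve_energy t else lim (curve_energy s @[s --> t^'+]).

Definition jump_measure (B : set R) : \bar R :=
  (\sum_(1 <= i < nsteps.+1 | (i%:R * delta)%R \in B)
    (energy_left (i%:R * delta) - energy_right (i%:R * delta))%R%:E)%E.

End Discrete.
End Transition.
End Energy.

Section Limits.
Context {R : realType} {Y : topologicalType}.
Variables (T : R) (eta : R -> Y).

Definition left_limit (t : R) (l : Y) : Prop :=
  if t == 0 then l = eta t else eta s @[s --> t^'-] --> l.

Definition right_limit (t : R) (l : Y) : Prop :=
  if t == T then l = eta t else eta s @[s --> t^'+] --> l.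

End Limits.

Section MeasuresOnInterval.
Context {R : realType} (T : R).

Definition weak_star_cvg (mu_ : nat -> set R -> \bar R) (mu : set R -> \bar R) :=
  forall f : R -> R, {within `[0, T], continuous f} ->
    (\int[mu_ n]_(x in `[0%R, T]) (f x)%:E)%E @[n --> \oo] -->
    (\int[mu]_(x in `[0%R, T]) (f x)%:E)%E.

(* Support in the sense of purely atomic measures: the set of atoms, which    *)
(* need not be closed.                                                        *)
Definition atomic_support (mu : set R -> \bar R) : set R :=
  [set t | (0 < mu [set t])%E].

End MeasuresOnInterval.

(* Main.v *)
(** Let V_n t be the energy dissipated by the jumps of the n-th discrete evolution
up to time t. The bound on the power keeps the evolutions in a compact set and V_n
bounded. Along an ultrafilter, V_n converges to a monotone V and the evolutions to
a curve h. The chain condition turns the additivity of the discrete action into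
c t (h s) (h s') <= V s' - V s + o(1) for s < s' close to t. Where V is continuous
the action between limits thus vanishes and the limits coincide in the quotient;
a diagonal extraction on the countable set of jumps of V and on the rationals gives
a subsequence converging at all times, and the same estimate gives the one-sided
limits. The measure is the Stieltjes measure of V; the energy balance passes to the
limit by continuity of the lifted energy and power. At a jump, the action is at most
the jump of V, which is the energy drop, which is at most the action. Elsewhere the
critical inequality and the Lipschitz dependence of the slope on time make the right
derivative of V vanish, so that V has no diffuse part. *)

Require Import Defs.
From HB Require Import structures.
From mathcomp Require Import all_boot all_order all_algebra generic_quotient.
From mathcomp Require Import all_classical all_reals all_analysis.
From mathcomp Require Import measurable_realfun.
From mathcomp Require Import lra ring.

Set Implicit Arguments.
Unset Strict Implicit.
Unset Printing Implicit Defensive.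

Import Order.TTheory GRing.Theory Num.Theory.
Import numFieldNormedType.Exports.

Local Open Scope classical_set_scope.
Local Open Scope ring_scope.

(** * Ultrafilters and extraction *)

(** No subsequence is known to converge in [X] at all times; only the classes converge, in a
    quotient that is not known to be Hausdorff. Limits are therefore taken in [X] along
    ultrafilters, where compactness supplies them, and are compared through the action; the quotient
    enters only once all possible limits are known to lie in one critical component. Lower
    semicontinuity of the action suffices because only upper bounds on it are passed to the limit;
    the opposite inequality comes from the energy drop, which bounds the action from below at every
    time. In place of continuity of the action in time, the chain condition moves a whole chain of
    actions at nearby times to one fixed time, at the price of [eps]; it also makes the relation
    defining the quotient closed. Countability of the jumps of V does not exclude a diffuse part,
    since a continuous monotone function may have zero derivative almost everywhere; the right
    derivative is therefore controlled at every time off the atoms. *)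

Section Filters.

(** Otherwise [F] and the complement of [A] generate a proper filter, and an ultrafilter above it
    contains both [A] and its complement. Convergence can thus be tested along ultrafilters. *)
Lemma near_ultra (T : Type) (F : set_system T) (A : set T) : Filter F ->
  (forall G, UltraFilter G -> F `<=` G -> G A) -> F A.
Proof.
move=> FF FGA; apply: contrapT => FA.
have PF : ProperFilter (within (~` A) F).
  apply: Build_ProperFilter_ex => B FB; apply: contrapT => B0; apply: FA.
  have {}FB : F [set x | ~ A x -> B x] by [].
  by apply: filterS FB => x xB; apply: contrapT => Ax; apply: B0; exists x; exact: xB.
have [G [GU FG]] := ultraFilterLemma PF.
have /FGA GA : F `<=` G by move=> B FB; apply: FG; rewrite /within/=; apply: filterS FB => x ? _.
have GCA : G (~` A) by apply: FG; rewrite /within/=; apply: filterS filterT => x _.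
have [x [//]] : A `&` ~` A !=set0 by apply: (@filter_ex _ G); exact: filterI.
Qed.

(** On an ultrafilter a cluster point is a limit: if the preimage of a neighbourhood were missing,
    that of its complement would be present, and the finer filter that converges to the cluster
    point would contain both. *)
Lemma compact_ultra_cvg (T : Type) (Y : topologicalType) (K : set Y)
    (G : set_system T) (f : T -> Y) : UltraFilter G -> compact K ->
  (\forall i \near G, K (f i)) -> exists2 y, K y & f @ G --> y.
Proof.
move=> GU cK GK.
have [y [Ky]] := cK (f @ G) _ GK.
rewrite cluster_cvgE; move=> [H PH [Hy GH]]; exists y => //.
apply: (cvg_trans _ Hy) => B HB.
have [//|] := in_ultra_setVsetC (f @^-1` B) GU.
move=> GB; have /(filterI HB) : H (~` B) by exact: GH.
by rewrite setICr => /filter_not_empty.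
Qed.

Lemma metric_cvg_unique (T : Type) (R : realType) (Y : metricType R)
    (F : set_system T) (f : T -> Y) (y z : Y) : ProperFilter F ->
  f @ F --> y -> f @ F --> z -> y = z.
Proof. by move=> PF; apply: cvg_unique; exact: metric_hausdorff. Qed.

Lemma filter_subseq (F : set_system nat) (A : nat -> set nat) :
  ProperFilter F -> \oo `<=` F -> (forall m, F (A m)) ->
  exists2 phi : nat -> nat, {homo phi : m n / (m < n)%N} & forall m, A m (phi m).
Proof.
move=> PF ooF FA.
have pick m k : exists n, (k < n)%N /\ A m n.
  have /filter_ex[n [/= kn Amn]] : F ([set n | (k < n)%N] `&` A m).
    by apply: filterI => //; apply: ooF; exists k.+1.
  by exists n.
have [g gP] := choice (fun p : nat * nat => pick p.1 p.2).
pose phi := fix phi m := g (m, if m is k.+1 then phi k else 0%N).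
exists phi; last by case=> [|m] /=; [exact: (gP (_, _)).2|exact: (gP (_, _)).2].
have step m : (phi m < phi m.+1)%N by exact: (gP (_, _)).1.
by apply: homo_ltn => //; exact: ltn_trans.
Qed.

Lemma subseq_cvg_infty (phi : nat -> nat) :
  {homo phi : m n / (m < n)%N} -> phi n @[n --> \oo] --> \oo.
Proof.
move=> hphi A [N _ NA]; exists N => // n /= Nn; apply: NA => /=.
apply: (leq_trans Nn); elim: n {Nn} => // n IH.
by apply: (leq_ltn_trans IH); exact: hphi.
Qed.

(** The filter replaces nested subsequences: the [m]-th set asks that the first [m + 1] sequences be
    within [1 / (m + 1)] of their limits, a finite intersection of members of [F]. *)
Lemma diagonal_extraction (R : realType) (Y : pseudoMetricType R)
    (F : set_system nat) (u : nat -> nat -> Y) (l : nat -> Y) :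
  ProperFilter F -> \oo `<=` F -> (forall k, u k @ F --> l k) ->
  exists2 phi : nat -> nat, {homo phi : m n / (m < n)%N} &
    forall k, u k (phi n) @[n --> \oo] --> l k.
Proof.
move=> PF ooF ul.
have e0 m : 0 < m.+1%:R^-1 :> R by rewrite invr_gt0 ltr0n.
have FA m : \forall n \near F, forall k : 'I_m.+1, ball (l k) m.+1%:R^-1 (u k n).
  apply: filter_forall => k; move: (ul k) => /cvg_ballP; exact.
have [phi hphi phiA] := filter_subseq PF ooF FA.
exists phi => // k; apply/cvg_ballP => e e_gt0.
have [N N0] : exists N, N.+1%:R^-1 < e :> R.
  by exists (Num.truncn e^-1); rewrite invf_plt ?posrE// truncnS_gt.
exists (maxn k N) => // m /=; rewrite geq_max => /andP[km Nm].
have km1 : (k < m.+1)%N by [].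
have := phiA m (Ordinal km1); apply: le_ball; apply/ltW.
by apply: le_lt_trans N0; rewrite lef_pV2 ?posrE ?ltr0n// ler_nat.
Qed.

End Filters.

(** * Monotone functions and their measures *)

Section MonotoneLimits.
Context {R : realType}.
Variable V : R -> R.

(* Junk when V is not monotone: the inf or sup may then be that of an        *)
(* unbounded set.                                                             *)
Definition right_value (t : R) : R := inf [set V s | s in `]t, +oo[].
Definition left_value (t : R) : R := sup [set V s | s in `]-oo, t[].

Hypothesis ndV : {homo V : s t / s <= t}.

Let has_inf_right t : has_inf [set V s | s in `]t, +oo[].
Proof.
split; first by exists (V (t + 1)); exists (t + 1) => //=; rewrite in_itv/= andbT ltrDl.
by exists (V t) => _ [s /= + <-]; rewrite in_itv/= andbT => /ltW; exact: ndV.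
Qed.

Let has_sup_left t : has_sup [set V s | s in `]-oo, t[].
Proof.
split; first by exists (V (t - 1)); exists (t - 1) => //=; rewrite in_itv/= gtrBl.
by exists (V t) => _ [s /= + <-]; rewrite in_itv/= => /ltW; exact: ndV.
Qed.

Lemma right_value_ge t : V t <= right_value t.
Proof.
apply: lb_le_inf; first by have [] := has_inf_right t.
by move=> _ [s /= + <-]; rewrite in_itv/= andbT => /ltW; exact: ndV.
Qed.

Lemma right_value_le s t : s < t -> right_value s <= V t.
Proof.
move=> st; apply: ge_inf; first by have [] := has_inf_right s.
by exists t => //=; rewrite in_itv/= andbT.
Qed.

Lemma left_value_le t : left_value t <= V t.
Proof.
apply: ge_sup; first by have [] := has_sup_left t.
by move=> _ [s /= + <-]; rewrite in_itv/= => /ltW; exact: ndV.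
Qed.

Lemma left_value_ge s t : s < t -> V s <= left_value t.
Proof.
move=> st; apply: ub_le_sup; first by have [] := has_sup_left t.
by exists s => //=; rewrite in_itv/=.
Qed.

Lemma right_value_adherent t e : 0 < e -> exists2 s, t < s & V s < right_value t + e.
Proof.
move=> e0; have [_ [s /= + <-]] := inf_adherent e0 (has_inf_right t).
by rewrite in_itv/= andbT => ts Vs; exists s.
Qed.

Lemma left_value_adherent t e : 0 < e -> exists2 s, s < t & left_value t - e < V s.
Proof.
move=> e0; have [_ [s /= + <-]] := sup_adherent e0 (has_sup_left t).
by rewrite in_itv/= => ts Vs; exists s.
Qed.

Lemma cvg_right_value t : V s @[s --> t^'+] --> right_value t.
Proof.
apply/cvgrPdist_le => e e0; have [u tu Vu] := right_value_adherent t e0.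
near=> s; have ts : t < s by near: s; exact: nbhs_right_gt.
have su : s < u by near: s; exact: nbhs_right_lt.
rewrite distrC ger0_norm ?subr_ge0 ?right_value_le// lerBlDl.
by rewrite (le_trans _ (ltW Vu))// ndV// ltW.
Unshelve. all: by end_near. Qed.

Lemma cvg_left_value t : V s @[s --> t^'-] --> left_value t.
Proof.
apply/cvgrPdist_le => e e0; have [u tu Vu] := left_value_adherent t e0.
near=> s; have ts : s < t by near: s; exact: nbhs_left_lt.
have su : u < s by near: s; exact: nbhs_left_gt.
rewrite ger0_norm ?subr_ge0 ?left_value_ge// lerBlDr -lerBlDl.
by rewrite (le_trans (ltW Vu))// ndV// ltW.
Unshelve. all: by end_near. Qed.

Lemma right_value_le_left_value s t : s < t -> right_value s <= left_value t.
Proof.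
move=> st; apply: (@le_trans _ _ (V ((s + t) / 2))).
  by apply: right_value_le; rewrite midf_lt.
by apply: left_value_ge; rewrite midf_lt.
Qed.

Lemma right_value_homo : {homo right_value : s t / s <= t}.
Proof.
move=> s t; rewrite le_eqVlt => /predU1P[->//|st].
by apply: (le_trans (right_value_le st)); exact: right_value_ge.
Qed.

Lemma right_value_right_continuous t : right_value s @[s --> t^'+] --> right_value t.
Proof.
apply/cvgrPdist_le => e e0; have [u tu Vu] := right_value_adherent t e0.
near=> s; have ts : t < s by near: s; exact: nbhs_right_gt.
have su : s < u by near: s; exact: nbhs_right_lt.
rewrite distrC ger0_norm ?subr_ge0 ?right_value_homo ?(ltW ts)// lerBlDl.
by rewrite (le_trans _ (ltW Vu))// right_value_le.
Unshelve. all: by end_near. Qed.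

(** The open intervals between the two one-sided values are disjoint for distinct times; a rational
    chosen in each gives an injection. *)
Lemma jump_countable : countable [set t | left_value t < right_value t].
Proof.
have pick t : exists q : rat, left_value t < right_value t ->
    left_value t < ratr q < right_value t.
  have [lr|] := boolP (left_value t < right_value t); last by exists 0.
  by have [q /= ?] := rat_in_itvoo lr; exists q.
have [f fP] := choice pick.
apply/countable_injP; exists (pickle \o f) => s t; rewrite !inE/=.
move=> /fP/andP[s1 s2] /fP/andP[t1 t2] /(pcan_inj pickleK) fst.
case: (ltgtP s t) => // /right_value_le_left_value h; exfalso.
  by have := lt_trans s2 (le_lt_trans h t1); rewrite fst ltxx.
by have := lt_trans t2 (le_lt_trans h s1); rewrite fst ltxx.
Qed.

End MonotoneLimits.

Section StieltjesMeasure.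
Context {R : realType}.

Lemma stieltjes_measure (F : R -> R) (m M : R) :
  {homo F : s t / s <= t} -> (forall t, F s @[s --> t^'+] --> F t) ->
  (forall t, m <= F t <= M) ->
  exists mu : {finite_measure set (measurableTypeR R) -> \bar R},
    forall s t, s <= t -> mu `]s, t]%classic = (F t - F s)%:E.
Proof.
move=> ndF rcF mFM.
pose G : cumulative R R := HB.pack F (isCumulative.Build R _ R F ndF rcF).
pose mu := lebesgue_stieltjes_measure G.
have muE s t : s <= t -> mu `]s, t]%classic = (F t - F s)%:E.
  move=> st; rewrite /mu/= /lebesgue_stieltjes_measure /measure_extension.
  by rewrite measurable_mu_extE/=; [rewrite wlength_itv_bnd|exact: is_ocitv].
have fin : fin_num_fun mu.
  suff muT : (mu setT <= (M - m)%:E)%E.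
    move=> A mA; rewrite ge0_fin_numE//; apply: (@le_lt_trans _ _ (M - m)%:E); last exact: ltry.
    by apply: le_trans muT; apply: le_measure => //; rewrite inE.
  (* The line is exhausted by the intervals []-n, n]], each of mass at most [M - m]. *)
  rewrite -(bigcup_itvT false false).
  have cI : mu `](- n%:R), n%:R]%classic @[n --> \oo] -->
      mu (\bigcup_n `](- n%:R), n%:R]%classic).
    apply: nondecreasing_cvg_mu => //; first exact: bigcup_measurable.
    by move=> *; apply/subsetPset/subset_itv; rewrite leBSide/= ?lerN2 ler_nat.
  rewrite -(cvg_lim _ cI)//; apply: lime_le; first by apply/cvg_ex; eexists; exact: cI.
  apply: nearW => n; rewrite muE ?ge0_cp// lee_fin.
  have /andP[_ h1] := mFM n%:R; have /andP[h2 _] := mFM (- n%:R).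
  exact: lerB.
pose nu : {finite_measure set (measurableTypeR R) -> \bar R} :=
  HB.pack mu (Measure_isFinite.Build _ _ _ mu fin).
by exists nu.
Qed.

(** [V] may fail to be right continuous, so the Stieltjes measure is that of [right_value V].
    Nothing is charged outside [[0, T]] because [[0, T]] already has mass [V T], an upper bound for
    the total mass. *)
Lemma monotone_measure (V : R -> R) (T : R) : 0 <= T ->
  {homo V : s t / s <= t} -> (forall t, t <= 0 -> V t = 0) ->
  (forall t, T <= t -> V t = V T) ->
  exists mu : {finite_measure set (measurableTypeR R) -> \bar R},
  [/\ forall s t, s <= t -> mu `]s, t]%classic = (right_value V t - right_value V s)%:E,
      forall t, mu [set t] = (right_value V t - left_value V t)%:E &
      mu (~` `[0, T]) = 0%E].
Proof.
move=> T0 ndV V0 VT.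
have rV0 t : t < 0 -> right_value V t = 0.
  move=> t0; apply/eqP; rewrite eq_le -{1}(V0 0)// right_value_le//=.
  by rewrite -(V0 t) ?right_value_ge// ltW.
have rVT t : T <= t -> right_value V t = V T.
  move=> Tt; apply/eqP; rewrite eq_le -[in X in X && _](VT (t + 1)); last by rewrite ler_wpDr.
  by rewrite right_value_le//= ?ltrDl// -(VT t)// right_value_ge.
have lV0 : left_value V 0 = 0.
  apply/eqP; rewrite eq_le; apply/andP; split.
    by rewrite -[leRHS](V0 0)// left_value_le.
  by rewrite -[leLHS](V0 (-1)) ?left_value_ge ?ltrN10// lerN10.
have bV t : 0 <= right_value V t <= V T.
  have [t0|t0] := ltP t 0; first by rewrite rV0// lexx/= -(V0 0)// ndV.
  rewrite -{1}(V0 0)// (le_trans (ndV _ _ t0)) ?right_value_ge//=.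
  have [tT|/rVT->//] := ltP t T; exact: right_value_le.
have [mu muE] := stieltjes_measure (right_value_homo ndV)
  (right_value_right_continuous ndV) bV.
have mu1 t : mu [set t] = (right_value V t - left_value V t)%:E.
  have c1 : mu `](t - n.+1%:R^-1), t]%classic @[n --> \oo] --> mu [set t].
    rewrite set1_bigcap_oc; apply: nonincreasing_cvg_mu => //.
    - by rewrite ltey_eq fin_num_measure.
    - exact: bigcap_measurable.
    - move=> i j ij; apply/subsetPset/subset_itv; rewrite leBSide//=.
      by rewrite lerB// lef_pV2 ?posrE// ler_nat.
  have tn n : t - n.+1%:R^-1 < t by rewrite gtrBl invr_gt0.
  have c2 : (right_value V t - right_value V (t - n.+1%:R^-1))%:E @[n --> \oo] -->
      (right_value V t - left_value V t)%:E.
    apply/cvg_EFin; first exact: nearW.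
    apply: cvgB; first exact: cvg_cst.
    have u_t : t - n.+1%:R^-1 @[n --> \oo] --> t.
      rewrite -[X in _ --> X]subr0; apply: cvgB; first exact: cvg_cst.
      exact: cvg_harmonic.
    (* The right values just before [t] lie between [V] and [left_value V t], and both bounds have
       limit [left_value V t]. *)
    apply: (@squeeze_cvgr _ _ _ _ (fun n => V (t - n.+1%:R^-1)) (cst (left_value V t))).
    - by apply: nearW => n; rewrite right_value_ge//= right_value_le_left_value.
    - by move/cvg_at_leftP : (cvg_left_value ndV (t := t)); apply.
    - exact: cvg_cst.
  have e : (fun n => mu `](t - n.+1%:R^-1), t]%classic) =
      (fun n => (right_value V t - right_value V (t - n.+1%:R^-1))%:E).
    by apply/funext => n; rewrite muE// ltW.
  by rewrite e in c1; exact: (cvg_unique _ c1 c2).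
exists mu; split => //.
have mu0T : mu `[0, T]%classic = (V T)%:E.
  rewrite -(setU1itv false)// measureU//=.
  - by rewrite mu1 muE// lV0 (rVT T)// -EFinD; congr EFin; ring.
  - by apply/seteqP; split => //= x []->; rewrite /= in_itv/= ltxx.
have muT : (mu setT <= (V T)%:E)%E.
  rewrite -(bigcup_itvT false false).
  have cI : mu `](- n%:R), n%:R]%classic @[n --> \oo] -->
      mu (\bigcup_n `](- n%:R), n%:R]%classic).
    apply: nondecreasing_cvg_mu => //; first exact: bigcup_measurable.
    by move=> *; apply/subsetPset/subset_itv; rewrite leBSide/= ?lerN2 ler_nat.
  rewrite -(cvg_lim _ cI)//; apply: lime_le; first by apply/cvg_ex; eexists; exact: cI.
  apply: nearW => n; rewrite muE ?ge0_cp// lee_fin.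
  have /andP[_ h1] := bV n%:R; have /andP[h2 _] := bV (- n%:R).
  by rewrite lerBlDr ler_wpDr.
apply/eqP; rewrite eq_le measure_ge0 andbT.
have mI : measurable (`[0%R, T]%classic : set (measurableTypeR R)) by [].
have : mu setT = (mu `[0%R, T]%classic + mu (~` `[0%R, T]%classic))%E.
  by rewrite -measureU ?setUv ?setICr//; exact: measurableC.
move=> e; move: muT; rewrite e mu0T -[leRHS]adde0 leeD2lE//.
Qed.

End StieltjesMeasure.

Section FiniteMeasureOfFunction.
Context {R : realType}.

Lemma finite_measure_of_function d (T : measurableType d) (m : set T -> \bar R) :
  m set0 = 0%E -> (forall A, (0 <= m A)%E) -> semi_sigma_additive m ->
  fin_num_fun m -> exists nu : {finite_measure set T -> \bar R}, nu = m :> (set T -> \bar R).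
Proof.
move=> m0 mge0 msa mfin.
pose nu : {measure set T -> \bar R} := HB.pack m (isMeasure.Build _ T _ m m0 mge0 msa).
pose nu' : {finite_measure set T -> \bar R} :=
  HB.pack m (Measure.class nu) (Measure_isFinite.Build _ T _ nu mfin).
by exists nu'.
Qed.

(* [measurableTypeR R] and [R] have the same measurable sets but are distinct *)
(* measurable types, hence carry distinct types of measures and integrals.    *)
Lemma finite_measureR (mu : {finite_measure set (measurableTypeR R) -> \bar R}) :
  exists nu : {finite_measure set R -> \bar R}, nu = mu :> (set R -> \bar R).
Proof.
apply: (@finite_measure_of_function _ R (mu : set R -> \bar R)).
- exact: measure0.
- by move=> A; exact: (@measure_ge0 _ (measurableTypeR R) R mu A).
- exact: (@measure_semi_sigma_additive _ (measurableTypeR R) R mu).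
- move=> A mA; exact: (@fin_num_measure _ (measurableTypeR R) R mu A mA).
Qed.

End FiniteMeasureOfFunction.

(** * Convergence of measures and integrals *)

Section UniformApproximation.
Context {R : realType}.

Lemma segment_uniform_continuity (f : R -> R) (a b e : R) :
  continuous f -> 0 < e -> exists2 d : R, 0 < d &
    forall x y, x \in `[a, b] -> `|y - x| < d -> `|f y - f x| <= e.
Proof.
move=> cf e0.
pose P (d : R) (x : R) := forall y, `|y - x| < d -> `|f y - f x| <= e.
have : \forall d \near 0^'+, `[a, b]%classic `<=` P d.
  apply: (compact_near_coveringP _).1 (@segment_compact R a b) _ _ _ _ _ => x _.
  have /cvgr_dist_lt/(_ (e / 2)) := cf x; rewrite divr_gt0// => /(_ isT).
  move=> /nbhs_ballP[r /= r0 rf].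
  exists (ball x (r / 2), [set d | 0 < d < r / 2]); rewrite /=.
    split; first by apply: nbhsx_ballx; rewrite divr_gt0.
    near=> d; apply/andP; split; near: d; first exact: nbhs_right_gt.
    by apply: nbhs_right_lt; rewrite divr_gt0.
  move=> [x' d] /= [xx' /andP[_ dr]] y yd.
  have h1 : `|f x - f x'| < e / 2.
    by apply: rf; apply: le_ball xx'; rewrite ler_pdivrMr// ler_pMr// ler1n.
  have h2 : `|f x - f y| < e / 2.
    apply: rf; rewrite /ball/= (splitr r); apply: le_lt_trans (ler_distD x' _ _) _.
    by apply: ltrD => //; rewrite distrC (lt_trans yd).
  rewrite (splitr e); apply: le_trans (ler_distD (f x) _ _) _.
  by rewrite distrC lerD// ltW.
move=> H; have [d [/= d0 dP]] := filter_ex (filterI (nbhs_right_gt (0 : R)) H).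
by exists d => // x y xab; exact: dP.
Unshelve. all: by end_near. Qed.

Lemma integrable_bounded (nu : {finite_measure set R -> \bar R})
    (f : R -> R) (M : R) (A : set R) :
  measurable_fun setT f -> (forall x, `|f x| <= M) -> measurable A ->
  nu.-integrable A (EFin \o f).
Proof.
move=> mf bf mA; apply: measurable_bounded_integrable => //.
- by rewrite ltey_eq fin_num_measure.
- exact: measurable_funS mf.
- by exists M; split; [exact: num_real|move=> r Mr x _; exact: le_trans (bf x) (ltW Mr)].
Qed.

(** The cells are open on the left because distribution functions give the masses of such intervals;
    [f] is sampled at the right end, which belongs to the cell. *)
Lemma Rintegral_step_le (nu : {finite_measure set R -> \bar R})
    (f : R -> R) (M e : R) (p : nat -> R) (N : nat) :
  measurable_fun setT f -> (forall x, `|f x| <= M) ->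
  (forall i, p i <= p i.+1) ->
  (forall i x, (i < N)%N -> x \in `]p i, p i.+1] -> `|f x - f (p i.+1)| <= e) ->
  `|\int[nu]_(x in `]p 0%N, p N]) f x -
    \sum_(i < N) f (p i.+1) * fine (nu `]p i, p i.+1]%classic)|
  <= e * fine (nu `]p 0%N, p N]%classic).
Proof.
move=> mf bf hp; elim: N => [|N IH] fe.
  by rewrite big_ord0 set_itvoc0 Rintegral_set0 measure0 mulr0 subrr normr0.
have intf (A : set R) : measurable A -> nu.-integrable A (EFin \o f).
  exact: integrable_bounded mf bf.
have p0N n : p 0%N <= p n by elim: n => // n /le_trans; apply.
have pE : `]p 0%N, p N.+1]%classic = `]p 0%N, p N] `|` `]p N, p N.+1].
  by rewrite -itv_bndbnd_setU// bnd_simp.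
have disj : `]p 0%N, p N]%classic `&` `]p N, p N.+1]%classic = set0.
  apply/seteqP; split=> // x [] /=; rewrite !in_itv/=.
  by move=> /andP[_ xp] /andP[/lt_le_trans/(_ xp)]; rewrite ltxx.
rewrite pE measureU// fineD ?fin_num_measure// mulrDr Rintegral_setU//; last 2 first.
  - by apply: intf; exact: measurableU.
  - by rewrite disj_set2E disj.
rewrite big_ord_recr/= opprD addrACA; apply: le_trans (ler_normD _ _) _.
apply: lerD; first by apply: IH => i x /ltnW iN; exact: fe.
have icst : nu.-integrable `]p N, p N.+1] (EFin \o (fun=> f (p N.+1))).
  by apply: finite_measure_integrable_cst.
rewrite -(Rintegral_cst nu)// -RintegralB//; last exact: intf.
have ifc : nu.-integrable `]p N, p N.+1] (EFin \o (fun x => f x - f (p N.+1))).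
  rewrite [X in _.-integrable _ X](_ : _ = ((EFin \o f) \- (EFin \o (fun=> f (p N.+1))))%E); last first.
    by apply/funext => x /=; rewrite EFinB.
  by apply: integrableB => //; exact: intf.
apply: le_trans (le_normr_Rintegral _ ifc) _ => //.
rewrite -Rintegral_cst//; apply: le_Rintegral => //.
- exact: (integrable_norm ifc).
- by apply: finite_measure_integrable_cst.
- by move=> x px; exact: fe.
Qed.

End UniformApproximation.

Section WeakConvergence.
Context {R : realType}.
Variable T : R.
Hypothesis T0 : 0 <= T.

(** Projection onto [[0, T]]: composing with it extends a test function continuously to the line, so
    that the nodes of a partition may lie outside [[0, T]]. *)
Let clamp (x : R) : R := Num.max 0 (Num.min T x).

Let clamp_continuous : continuous clamp.
Proof.
move=> x; apply: continuous_max; first exact: cst_continuous.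
by apply: continuous_min; [exact: cst_continuous|exact: cvg_id].
Qed.

Let clamp_itv x : clamp x \in `[0, T].
Proof. by rewrite in_itv/= /clamp le_max lexx/= ge_max T0 ge_min lexx. Qed.

Let clamp_id x : x \in `[0, T] -> clamp x = x.
Proof.
by rewrite in_itv/= => /andP[x0 xT]; rewrite /clamp (min_idPr xT) (max_idPr x0).
Qed.

Let extension_continuous (f : R -> R) :
  {within `[0, T], continuous f} -> continuous (f \o clamp).
Proof.
move=> /subspace_continuousP cf x.
apply: (@cvg_comp _ _ _ clamp f _ (within `[0, T] (nbhs (clamp x)))); last first.
  by apply: cf; exact: clamp_itv.
move=> A /= wA; have := @clamp_continuous x _ wA; rewrite /= nbhs_simpl/=.
by apply: filterS => y; apply; exact: clamp_itv.
Qed.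

Let restrict_integral (nu : {finite_measure set R -> \bar R})
    (f : R -> R) (M a b : R) :
  measurable_fun setT f -> (forall x, `|f x| <= M) -> a < 0 -> T <= b ->
  nu (~` `[0, T]) = 0%E ->
  (\int[nu]_(x in `[0%R, T]) (f x)%:E = (\int[nu]_(x in `]a, b]) f x)%:E)%E.
Proof.
move=> mf bf a0 Tb nu0.
have intf (A : set R) : measurable A -> nu.-integrable A (EFin \o f).
  exact: integrable_bounded mf bf.
rewrite fineK; last by apply: integrable_fin_num => //; exact: intf.
have mC : measurable (~` `[0, T] : set R) by exact: measurableC.
rewrite [RHS](negligible_integral mC _ _ nu0)//; last exact: intf.
congr (integral _ _ _); rewrite setDE setCK; apply/esym/setIidr.
by apply: subset_itv; rewrite bnd_simp.
Qed.

(* The test function is approximated by step functions whose nodes are        *)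
(* continuity points of V.                                                    *)
Lemma weak_star_cvg_cdf (mu_ : nat -> {finite_measure set R -> \bar R})
    (mu : {finite_measure set R -> \bar R})
    (V_ : nat -> R -> R) (V : R -> R) :
  (forall n s t, s <= t -> mu_ n `]s, t]%classic = (V_ n t - V_ n s)%:E) ->
  (forall n, mu_ n (~` `[0, T]) = 0%E) ->
  {homo V : s t / s <= t} ->
  (forall s t, s <= t -> mu `]s, t]%classic = (right_value V t - right_value V s)%:E) ->
  (forall t, mu [set t] = (right_value V t - left_value V t)%:E) ->
  mu (~` `[0, T]) = 0%E ->
  (forall t, V_ n t @[n --> \oo] --> V t) ->
  weak_star_cvg T mu_ mu.
Proof.
move=> mu_E mu_0 ndV muE mu1 mu0 V_V f cf.
pose g := f \o clamp.
have cg : continuous g by exact: extension_continuous.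
have mg : measurable_fun setT g by exact: continuous_measurable_fun.
have [M gM] : exists M : R, forall x, `|g x| <= M.
  have [c _ cM] := @EVT_max R (fun x => `|f x|) 0 T T0 (fun x => cvg_norm (cf x)).
  by exists `|f c| => x; apply: cM; exact: clamp_itv.
have fg (nu : {finite_measure set R -> \bar R}) :
    (\int[nu]_(x in `[0%R, T]) (f x)%:E = \int[nu]_(x in `[0%R, T]) (g x)%:E)%E.
  by apply: eq_integral => x; rewrite inE/= => xT; rewrite /g/= clamp_id.
pose mass := V (T + 1) - V (-1).
have mass0 : 0 <= mass by rewrite subr_ge0 ndV//; move: T0; lra.
rewrite fg; under eq_fun do rewrite fg.
(* The interval may depend on [e]: by [restrict_integral] the integrals over it do not. *)
suff key (e : R) : 0 < e -> exists2 a : R, a < 0 & exists2 b, T <= b & \forall n \near \oo,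
    `|\int[mu]_(x in `]a, b]) g x - \int[mu_ n]_(x in `]a, b]) g x| <= e.
  have [a0 a00 [b0 Tb0 _]] := key 1 ltr01.
  rewrite (restrict_integral mg gM a00 Tb0)//.
  have -> : (fun n => \int[mu_ n]_(x in `[0%R, T]) (g x)%:E)%E =
      (fun n => (\int[mu_ n]_(x in `]a0, b0]) g x)%:E).
    by apply/funext => n; exact: restrict_integral mg gM a00 Tb0 (mu_0 n).
  apply/cvg_EFin; first exact: nearW.
  apply/cvgrPdist_le => e /key[a1 a10 [b1 Tb1]]; apply: filterS => n /=.
  congr (_ <= _); congr (`| _ - _ |).
    by apply: EFin_inj; rewrite -!(restrict_integral mg gM).
  by apply: EFin_inj; rewrite -!(restrict_integral mg gM).
(* Replacing [g] by a step function costs [e1 * mass] for [mu] and, for large [n], [e1 * (mass + 1)]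
   for [mu_ n]; the two step sums differ by at most [e1]. *)
move=> e0; pose e1 := e / (2 * mass + 4).
have e10 : 0 < e1 by rewrite divr_gt0// ltr_wpDl// mulr_ge0.
have [d d0 dg] := segment_uniform_continuity (-1) (T + 1) cg e10.
(* Nodes taken in consecutive cells of length [h] are less than [2 * h <= d] apart, and [h <= 1/2]
   keeps the nodes in use inside [[-1, T + 1]]. *)
pose h := Num.min (d / 2) (2^-1).
have h0 : 0 < h by rewrite lt_min divr_gt0//= invr_gt0.
have hd : 2 * h <= d by rewrite mulrC -ler_pdivlMr// ge_min lexx.
have h1 : h <= 2^-1 by rewrite ge_min lexx orbT.
(* A cell has positive Lebesgue measure, hence is uncountable, while the atoms of [mu] are jumps of
   [V]. *)
have pick i : exists p : R, (p \in `](i%:R - 1) * h, i%:R * h[) /\ mu [set p] = 0%E.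
  apply: contrapT => /forallNP nop.
  have cJ : countable `](i%:R - 1) * h, i%:R * h[%classic.
    apply: sub_countable (jump_countable ndV); apply: subset_card_le => p /= pI.
    have := nop p; rewrite mu1 => /not_andP[//|/eqP]; rewrite eqe subr_eq0 => /eqP rl.
    rewrite lt_neqAle eq_sym; apply/andP; split; first exact/eqP.
    by apply: le_trans (left_value_le ndV p) (right_value_ge ndV p).
  have := countable_lebesgue_measure0 cJ.
  rewrite lebesgue_measure_itv/= lte_fin ltr_pM2r// gtrBl ltr01 -EFinD => /eqP.
  by rewrite eqe mulrBl opprB addrC subrK mul1r gt_eqF.
have [p pP] := choice pick.
have {pP}[pI p1] : (forall i, p i \in `](i%:R - 1) * h, i%:R * h[) /\
  forall i, mu [set p i] = 0%E by split => i; have [] := pP i.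
(* At a node that is not an atom, the limit of [V_ n] agrees with the distribution function of
   [mu]. *)
have pV i : right_value V (p i) = V (p i).
  have := p1 i; rewrite mu1 => /eqP; rewrite eqe subr_eq0 => /eqP e2.
  by apply/eqP; rewrite eq_le right_value_ge// andbT e2 left_value_le.
have pS i : p i <= p i.+1.
  have := pI i; have := pI i.+1; rewrite !in_itv/= -natr1 addrK.
  by move=> /andP[/ltW h2 _] /andP[_ /ltW h3]; exact: le_trans h3 h2.
have phS i : p i.+1 - p i < 2 * h.
  have := pI i; have := pI i.+1; rewrite !in_itv/= -natr1 addrK.
  move=> /andP[_ h2] /andP[h3 _]; lra.
have p00 : p 0%N < 0 by have := pI 0%N; rewrite !in_itv/= mul0r => /andP[].
have p0N1 : -1 <= p 0%N by have := pI 0%N; rewrite !in_itv/= sub0r mulN1r => /andP[+ _]; lra.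
have pmono i j : (i <= j)%N -> p i <= p j.
  by move=> ij; apply: (@homo_leq _ p <=%R) => //; exact: le_trans.
have exN : exists n, T <= p n.
  exists (Num.truncn (T / h)).+2; have := pI (Num.truncn (T / h)).+2.
  rewrite in_itv/= => /andP[/ltW + _]; apply: le_trans.
  rewrite -natr1 addrK -ler_pdivrMr// ltW// truncnS_gt//.
pose N := ex_minn exN.
have [TpN pNT] : T <= p N /\ p N <= T + 1.
  rewrite /N; case: ex_minnP => n Tn minn; split => //.
  case: n Tn minn => [|n] Tn minn.
    by rewrite (le_trans (ltW p00))// addr_ge0.
  have : p n < T by rewrite ltNge; apply/negP => /minn; rewrite ltnn.
  by have := phS n; lra.
exists (p 0%N) => //; exists (p N) => //.
have gstep i x : (i < N)%N -> x \in `]p i, p i.+1] -> `|g x - g (p i.+1)| <= e1.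
  move=> iN; rewrite in_itv/= => /andP[pix xpi]; apply: dg.
    rewrite in_itv/=; have := pmono 0%N i.+1 isT; have := pmono i.+1 N iN.
    by move=> ? ?; apply/andP; split; lra.
  by have := phS i; rewrite ler0_norm ?subr_le0//; lra.
have stepmu := Rintegral_step_le mu mg gM pS gstep.
have stepmu_ n := Rintegral_step_le (mu_ n) mg gM pS gstep.
rewrite muE ?pmono//= !pV in stepmu.
have rsE : \sum_(i < N) g (p i.+1) * fine (mu `]p i, p i.+1]%classic) =
    \sum_(i < N) g (p i.+1) * (V (p i.+1) - V (p i)).
  by apply: eq_bigr => i _; rewrite muE//= !pV.
have rsE_ n : \sum_(i < N) g (p i.+1) * fine (mu_ n `]p i, p i.+1]%classic) =
    \sum_(i < N) g (p i.+1) * (V_ n (p i.+1) - V_ n (p i)).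
  by apply: eq_bigr => i _; rewrite mu_E.
have cvs : \sum_(i < N) g (p i.+1) * (V_ n (p i.+1) - V_ n (p i)) @[n --> \oo] -->
    \sum_(i < N) g (p i.+1) * (V (p i.+1) - V (p i)).
  apply: cvg_big => [|i _]; first exact: add_continuous.
    apply: cvgM; first exact: cvg_cst.
    by apply: cvgB; exact: V_V.
have cvm : V_ n (p N) - V_ n (p 0%N) @[n --> \oo] --> V (p N) - V (p 0%N).
  by apply: cvgB; exact: V_V.
have massN : V (p N) - V (p 0%N) <= mass by apply: lerB; exact: ndV.
near=> n.
have h4 : `|\sum_(i < N) g (p i.+1) * (V (p i.+1) - V (p i)) -
    \sum_(i < N) g (p i.+1) * (V_ n (p i.+1) - V_ n (p i))| <= e1.
  by near: n; move/cvgrPdist_le : cvs; apply.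
have h5 : `|(V (p N) - V (p 0%N)) - (V_ n (p N) - V_ n (p 0%N))| <= 1.
  by near: n; move/cvgrPdist_le : cvm; apply.
have h6 := stepmu_ n; rewrite mu_E ?pmono//= rsE_ in h6.
rewrite rsE in stepmu.
have eE : e = e1 * mass + e1 * (mass + 1) + 3 * e1.
  have : e1 * (2 * mass + 4) = e by rewrite /e1 divfK// gt_eqF// ltr_wpDl// mulr_ge0.
  by move=> <-; ring.
have h7 : e1 * (V (p N) - V (p 0%N)) <= e1 * mass by rewrite ler_pM2l.
have h8 : e1 * (V_ n (p N) - V_ n (p 0%N)) <= e1 * (mass + 1).
  by rewrite ler_pM2l//; move: h5; rewrite ler_distl => /andP[]; lra.
rewrite eE; move: h4 h6 stepmu; rewrite !ler_distl; lra.
Unshelve. all: by end_near. Qed.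

End WeakConvergence.

Lemma Rintegral_itv_le (R : realType) (f : R -> R) (B a b : R) : a <= b ->
  lebesgue_measure.-integrable `[a, b] (EFin \o f) ->
  (forall x, x \in `[a, b] -> f x <= B) ->
  \int[lebesgue_measure]_(x in `[a, b]) f x <= B * (b - a).
Proof.
move=> ab intf fB.
apply: (@le_trans _ _ (\int[lebesgue_measure]_(x in `[a, b]) B)).
  apply: le_Rintegral => //.
  apply: continuous_compact_integrable; first exact: segment_compact.
  by move=> x; exact: cst_continuous.
rewrite Rintegral_cst//= lebesgue_measure_itv/= lte_fin.
case: ifPn => //=; rewrite -leNgt => ba.
by rewrite (@le_anti _ _ a b) ?ab// subrr.
Qed.

Lemma bounded_convergence_itv (R : realType) (f_ : nat -> R -> R) (f : R -> R) (B T : R) :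
  (forall n, lebesgue_measure.-integrable `[0, T] (EFin \o f_ n)) ->
  (forall n x, x \in `[0, T] -> `|f_ n x| <= B) ->
  (forall x, x \in `[0, T] -> f_ n x @[n --> \oo] --> f x) ->
  lebesgue_measure.-integrable `[0, T] (EFin \o f) /\
  forall t, t \in `[0, T] ->
    \int[lebesgue_measure]_(x in `[0, t]) f_ n x @[n --> \oo] -->
    \int[lebesgue_measure]_(x in `[0, t]) f x.
Proof.
move=> intf fB ff.
have sub t : t \in `[0, T] -> `[0, t] `<=` `[0, T].
  by rewrite in_itv/= => /andP[_ tT] x /=; rewrite !in_itv/= => /andP[-> /le_trans]; exact.
have main t : t \in `[0, T] ->
    [/\ lebesgue_measure.-integrable `[0, t] (EFin \o f) &
    (\int[lebesgue_measure]_(x in `[0%R, t]) (f_ n x)%:E)%E @[n --> \oo] -->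
    (\int[lebesgue_measure]_(x in `[0%R, t]) (f x)%:E)%E].
  move=> tT; have intn n : lebesgue_measure.-integrable `[0, t] (EFin \o f_ n).
    by apply: integrableS (intf n) => //; exact: sub.
  have cvn x : `[0, t]%classic x -> (EFin \o f_ n) x @[n --> \oo] --> (EFin \o f) x.
    move=> /(sub t tT) xT; apply/cvg_EFin; first exact: nearW.
    exact: ff.
  have ig : lebesgue_measure.-integrable `[0, t] (EFin \o cst B).
    apply: continuous_compact_integrable; first exact: segment_compact.
    by move=> x; exact: cst_continuous.
  have fBt : {ae lebesgue_measure, forall x (n : nat), `[0, t]%classic x ->
      (`|(EFin \o f_ n) x| <= (EFin \o cst B) x)%E}.
    by apply: aeW => x n xt; rewrite lee_fin; exact: fB (sub t tT x xt).
  have cvn' : {ae lebesgue_measure, forall x, `[0, t]%classic x ->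
      (EFin \o f_ n) x @[n --> \oo] --> (EFin \o f) x} by exact: aeW.
  have mt : measurable (`[0, t]%classic : set (measurableTypeR R)) by exact: measurable_itv.
  have mn' n : measurable_fun (T := measurableTypeR R) `[0, t] (EFin \o f_ n).
    exact: measurable_int (intn n).
  have mf' : measurable_fun (T := measurableTypeR R) `[0, t] (EFin \o f).
    exact: (emeasurable_fun_cvg (fun n => EFin \o f_ n)).
  by have [] := @dominated_convergence _ (measurableTypeR R) R lebesgue_measure _ mt
    _ _ _ mn' mf' cvn' ig fBt.
have [T0|T0] := leP 0 T; last first.
  split=> [|t]; first by rewrite set_itv_ge ?bnd_simp -?ltNge//; exact: integrable_set0.
  by rewrite in_itv/= => /andP[t0 /(le_trans t0)]; rewrite leNgt T0.
have TT : T \in `[0, T] by rewrite in_itv/= T0 lexx.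
split=> [|t tT]; first by have [] := main T TT.
have [ift cft] := main t tT.
rewrite /Rintegral; apply: fine_cvg; rewrite fineK//; exact: integrable_fin_num.
Qed.

(** * Purely atomic measures *)

Section PurelyAtomic.
Context {R : realType}.
Variables (mu : {finite_measure set R -> \bar R}) (V : R -> R) (T : R).
Hypotheses (T0 : 0 <= T) (ndV : {homo V : s t / s <= t}).
Hypothesis muE : forall s t, s <= t ->
  mu `]s, t]%classic = (right_value V t - right_value V s)%:E.
Hypothesis mu1 : forall t, mu [set t] = (right_value V t - left_value V t)%:E.
Hypothesis mu0 : mu (~` `[0, T]) = 0%E.

Let J := atomic_support mu.
Let m (A : set R) : R := fine (mu A).

Lemma countable_atoms : countable (atomic_support mu).
Proof.
apply: sub_countable (jump_countable ndV); apply: subset_card_le => t.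
by rewrite /atomic_support/= mu1 lte_fin subr_gt0.
Qed.

Let mJ : measurable J.
Proof. by apply: countable_measurable => //; exact: countable_atoms. Qed.

Let mJC : measurable (~` J). Proof. exact: measurableC. Qed.

Let m_ge0 A : 0 <= m A. Proof. by rewrite fine_ge0. Qed.

Let m_le (A B : set R) : measurable A -> measurable B -> A `<=` B -> m A <= m B.
Proof.
move=> mA mB AB; rewrite /m fine_le ?fin_num_measure//.
by apply: le_measure => //; rewrite inE.
Qed.

Let m_U (A B : set R) : measurable A -> measurable B -> A `&` B = set0 ->
  m (A `|` B) = m A + m B.
Proof. by move=> mA mB AB; rewrite /m measureU// fineD ?fin_num_measure. Qed.

Let m_UI (A B : set R) : measurable A -> measurable B -> A `&` B = set0 ->
  m ((A `|` B) `&` ~` J) = m (A `&` ~` J) + m (B `&` ~` J).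
Proof.
move=> mA mB AB; rewrite setIUl m_U//; [exact: measurableI|exact: measurableI|].
by rewrite setIACA AB set0I.
Qed.

Let atomless t : m ([set t] `&` ~` J) = 0.
Proof.
rewrite /m; have [tJ|tJ] := pselect (J t).
  rewrite (_ : _ `&` _ = set0) ?measure0//.
  by apply/seteqP; split => // x [/= ->].
apply/eqP; rewrite eq_le m_ge0 andbT; apply: (@le_trans _ _ (m [set t])).
  by apply: m_le => //; exact: measurableI.
by rewrite /m; move: tJ; rewrite /J /atomic_support/= mu1 lte_fin /= => /negP; rewrite -leNgt.
Qed.

Let g (u : R) : R := m (`]-oo, u] `&` ~` J).

Let g_split s t : s <= t -> g t = g s + m (`]s, t] `&` ~` J).
Proof.
move=> st; rewrite /g -m_UI//; first by rewrite -itv_bndbnd_setU.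
apply/seteqP; split=> // x [] /=; rewrite !in_itv/= => xs /andP[sx _].
by move: (lt_le_trans sx xs); rewrite ltxx.
Qed.

(* Creeping argument: with g u = mu (]-oo, u] \ J), the set of u such that     *)
(* g u <= e u + e mu ]-oo, u[ cannot end before T. The second term leaves     *)
(* room to pass an atom.                                                      *)
Lemma purely_atomic :
  (forall t e : R, 0 <= t -> t < T -> ~ atomic_support mu t -> 0 < e ->
    \forall s \near t^'+, V s - V t <= e * (s - t)) ->
  mu (~` atomic_support mu) = 0%E.
Proof.
move=> dV.
have key (e : R) : 0 < e -> g T <= e * (T + m setT).
  move=> e0; pose W (u : R) := m `]-oo, u[.
  pose Phi (u : R) : R := e * u + e * W u.
  have W_homo s t : s <= t -> W s <= W t.
    by move=> st; apply: m_le => //; apply: subset_itvl; rewrite bnd_simp.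
  have Phi_homo s t : s <= t -> Phi s <= Phi t.
    by move=> st; rewrite /Phi lerD// ler_pM2l// W_homo.
  pose S := [set u | 0 <= u <= T /\ g u <= Phi u].
  have S0 : S 0.
    split; first by rewrite lexx.
    have -> : Phi 0 = e * W 0 by rewrite /Phi mulr0 add0r.
    apply: (@le_trans _ _ 0); last exact: mulr_ge0 (ltW e0) (m_ge0 _).
    rewrite /g -(setUitv1 true)// m_UI//; last first.
      by apply/seteqP; split=> // x [] /= xs xe; move: xs; rewrite xe in_itv/= ltxx.
      rewrite atomless addr0; apply: (@le_trans _ _ (m (~` `[0, T]))).
        apply: m_le; [exact: measurableI|exact: measurableC|].
        by move=> x [/= + _]; rewrite in_itv/= => x0; rewrite in_itv/= leNgt x0.
      by rewrite /m mu0.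
  have hS : has_sup S.
    by split; [exists 0|exists T => u [/andP[]]].
  pose s0 := sup S.
  have s00 : 0 <= s0 by apply: ub_le_sup S0; exact: hS.2.
  have s0T : s0 <= T by apply: ge_sup; [exact: hS.1|move=> u [/andP[]]].
  (* The inequality passes to the supremum: off [J] no point is charged, so [g s0] is the limit of
     the masses off [J] of the half-lines up to [s0 - 1/(n+1)], and an element of [S] lies beyond
     each of these points. *)
  have gs0 : g s0 <= Phi s0.
    have -> : g s0 = m (`]-oo, s0[ `&` ~` J).
      rewrite /g -(setUitv1 true)// m_UI//; last first.
      by apply/seteqP; split=> // x [] /= xs xe; move: xs; rewrite xe in_itv/= ltxx.
      by rewrite atomless addr0.
    pose F n := `]-oo, (s0 - n.+1%:R^-1)] `&` ~` J : set R.
    have FE : `]-oo, s0[ `&` ~` J = \bigcup_n F n.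
      rewrite /F -setI_bigcupl; congr (_ `&` _); apply/seteqP; split => x /=.
        rewrite in_itv/= => xs0.
        exists (Num.truncn (s0 - x)^-1) => //=; rewrite in_itv/= lerBrDr -lerBrDl.
        by rewrite invf_ple ?posrE ?subr_gt0// ltW// truncnS_gt.
      by move=> [n _ /=]; rewrite !in_itv/= => /le_lt_trans; apply; rewrite gtrBl invr_gt0.
    have mF n : measurable (F n) by exact: measurableI.
    have cF : mu (F n) @[n --> \oo] --> mu (\bigcup_n F n).
      apply: nondecreasing_cvg_mu => //; first exact: bigcup_measurable.
      move=> i j ij; apply/subsetPset; apply: setSI; apply: subset_itvl.
      by rewrite bnd_simp lerB// lef_pV2 ?posrE// ler_nat.
    rewrite -lee_fin /m fineK ?fin_num_measure//; last exact: measurableI.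
    rewrite FE -(cvg_lim _ cF)//; apply: lime_le; first by apply/cvg_ex; eexists; exact: cF.
    apply: nearW => n; rewrite -[mu _]fineK ?fin_num_measure// lee_fin.
    have n0 : 0 < n.+1%:R^-1 :> R by rewrite invr_gt0.
    have [u [/andP[u0 uT] gu] su] := sup_adherent n0 hS.
    apply: (@le_trans _ _ (g u)).
      apply: m_le => //; first exact: measurableI.
      by apply: setSI; apply: subset_itvl; rewrite bnd_simp ltW.
    by apply: (le_trans gu); apply: Phi_homo; apply: ub_le_sup; [exact: hS.2|split => //; rewrite u0].
  have gT : g T <= Phi T.
    move: s0T; rewrite le_eqVlt => /predU1P[<-//|s0T].
    suff [s [ss sT gs]] : exists s, [/\ s0 < s, s <= T & g s <= Phi s].
      have : s <= s0.
        apply: ub_le_sup; [exact: hS.2|split => //].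
        by rewrite sT andbT (le_trans s00)// ltW.
      by rewrite leNgt ss.
    have WE s : s0 < s -> W s = W s0 + m `[s0, s[.
      move=> ss; rewrite /W -m_U//; first by rewrite -itv_bndbnd_setU// bnd_simp ltW.
      by apply/seteqP; split=> // x [] /=; rewrite !in_itv/= => xs /andP[]; rewrite leNgt xs.
    (* At an atom, [W] gains at least the mass of [s0] on moving right, while right continuity makes
       the mass of []s0, s]] at most [e] times that of [s0]. *)
    have [s0J|s0J] := pselect (J s0).
      have a0 : 0 < m [set s0].
        by move: s0J; rewrite /J /atomic_support/= /m mu1 lte_fin.
      have ea0 : 0 < e * m [set s0] by rewrite mulr_gt0.
      have /cvgrPdist_le/(_ _ ea0) H := right_value_right_continuous ndV (t := s0).
      near s0^'+ => s; have ss : s0 < s by [].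
      have Hs : `|right_value V s0 - right_value V s| <= e * m [set s0] by near: s.
      have sT : s <= T by near: s; exact: nbhs_right_le.
      exists s; split => //; rewrite (g_split (ltW ss)) /Phi WE// mulrDr.
      have h1 : m (`]s0, s] `&` ~` J) <= e * m [set s0].
        apply: (@le_trans _ _ (m `]s0, s])); first by apply: m_le => //; exact: measurableI.
        by rewrite /m (muE (ltW ss))/=; apply: le_trans Hs; rewrite distrC ler_norm.
      have h2 : e * m [set s0] <= e * m `[s0, s[.
        rewrite ler_pM2l//; apply: m_le => // x ->.
        by rewrite /= in_itv/= lexx.
      have h3 : e * s0 <= e * s by rewrite ler_pM2l// ltW.
      by rewrite /Phi in gs0; lra.
    near s0^'+ => s; have ss : s0 < s by [].
    have Hs : V s - V s0 <= e * (s - s0) by near: s; exact: dV.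
    have sT : s <= T by near: s; exact: nbhs_right_le.
    exists s; split => //; rewrite (g_split (ltW ss)).
    (* The endpoint [s] may be an atom but carries no mass off [J]; the open interval has mass
       [left_value V s - right_value V s0], at most [V s - V s0]. *)
    have h1 : m (`]s0, s] `&` ~` J) <= V s - V s0.
      rewrite -(setUitv1 true) ?bnd_simp// m_UI//; last first.
        by apply/seteqP; split=> // x [] /= xs xe; move: xs; rewrite xe in_itv/= ltxx andbF.
      rewrite atomless addr0; apply: (@le_trans _ _ (m `]s0, s[)).
        by apply: m_le => //; exact: measurableI.
      have : m `]s0, s] = m `]s0, s[ + m [set s].
        rewrite -(setUitv1 true) ?bnd_simp// m_U//.
        by apply/seteqP; split=> // x [] /= xs xe; move: xs; rewrite xe in_itv/= ltxx andbF.
      rewrite /m (muE (ltW ss)) mu1/= => h.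
      have := left_value_le ndV s; have := right_value_ge ndV s0; lra.
    have h2 := W_homo _ _ (ltW ss); have : e * W s0 <= e * W s by rewrite ler_pM2l.
    by move: gs0; rewrite /Phi; lra.
  apply: (le_trans gT); rewrite /Phi mulrDr lerD2l ler_pM2l//.
  exact: m_le.
have gT : g T = 0.
  apply/eqP; rewrite eq_le m_ge0 andbT leNgt; apply/negP => gT0.
  pose c := T + m setT.
  have c0 : 0 <= c by rewrite addr_ge0.
  pose k := g T / (c + 1).
  have k0 : 0 < k by rewrite divr_gt0// ltr_wpDl.
  have kE : g T = k * (c + 1) by rewrite divfK// gt_eqF// ltr_wpDl.
  have kc : 0 <= k * c by rewrite mulr_ge0// ltW.
  have k20 : 0 < k / 2 by rewrite divr_gt0.
  by have := key _ k20; rewrite -/c kE; lra.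
have : m (~` J) = 0.
  apply/eqP; rewrite eq_le m_ge0 andbT.
  rewrite -(setTI (~` J)) -(itv_setU_setT false T) m_UI//; last first.
    by apply/seteqP; split=> // x [] /=; rewrite !in_itv/= andbT leNgt => /negP.
  rewrite -/(g T) gT add0r; apply: (@le_trans _ _ (m (~` `[0, T]))).
      apply: m_le; [exact: measurableI|exact: measurableC|].
      by move=> x [/= + _]; rewrite !in_itv/= andbT => xT; rewrite andbC leNgt xT.
    by rewrite /m mu0.
by rewrite /m => h; rewrite -[LHS]fineK ?fin_num_measure// -/J h.
Unshelve. all: by end_near. Qed.

End PurelyAtomic.

(** * Regularity of the energy in time *)

Section TimeRegularity.
Context {R : realType} {X : metricType R}.
Variables (T : R) (E : R -> X -> R).

(** Continuity of the energy, power and slope is relative to [[0, T]]; this form serves any filter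
    whose times eventually stay there. *)
Lemma within_time_cvg (Y : topologicalType) (g : R * X -> Y) (I : Type)
    (F : set_system I) (s : I -> R) (x : I -> X) (t : R) (y : X) : Filter F ->
  {within `[0, T] `*` setT, continuous g} -> t \in `[0, T] ->
  s @ F --> t -> (\forall i \near F, s i \in `[0, T]) -> x @ F --> y ->
  g (s i, x i) @[i --> F] --> g (t, y).
Proof.
move=> FF /subspace_continuousP cg tT st sT xy.
have /cg H : (`[0, T] `*` setT) (t, y) by split.
apply: (@cvg_comp _ _ _ (fun i => (s i, x i)) g _ (within (`[0, T] `*` setT) (nbhs (t, y)))) => //.
have stxy : (s i, x i) @[i --> F] --> (t, y) by exact: (@cvg_pair _ _ _ F (nbhs t) (nbhs y)).
move=> A wA; have {}wA : nbhs (t, y) [set p | (`[0, T] `*` setT) p -> A p] by [].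
have := stxy _ wA; rewrite /= !nbhs_simpl/=; move: sT.
by apply: filterS2 => i /= sT; apply; split.
Qed.

Hypothesis regE : regular_energy T E.

Lemma energy_cvg (I : Type) (F : set_system I) (s : I -> R) (x : I -> X) t y :
  Filter F -> t \in `[0, T] -> s @ F --> t -> (\forall i \near F, s i \in `[0, T]) ->
  x @ F --> y -> E (s i) (x i) @[i --> F] --> E t y.
Proof. by case: regE => cE _ _ _ _ FF; apply: within_time_cvg cE. Qed.

Lemma power_cvg (I : Type) (F : set_system I) (s : I -> R) (x : I -> X) t y :
  Filter F -> t \in `[0, T] -> s @ F --> t -> (\forall i \near F, s i \in `[0, T]) ->
  x @ F --> y -> power T E (s i) (x i) @[i --> F] --> power T E t y.
Proof. by case: regE => _ _ cE _ _ FF; apply: within_time_cvg cE. Qed.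

Lemma slope_cvg (I : Type) (F : set_system I) (s : I -> R) (x : I -> X) t y :
  Filter F -> t \in `[0, T] -> s @ F --> t -> (\forall i \near F, s i \in `[0, T]) ->
  x @ F --> y -> fine (slope (E (s i)) (x i)) @[i --> F] --> fine (slope (E t) y).
Proof. by case: regE => _ _ _ _ cE FF; apply: within_time_cvg cE. Qed.

Lemma crit_fine t x : t \in `[0, T] -> crit (E t) x <-> fine (slope (E t) x) = 0.
Proof.
case: regE => _ _ _ fE _ tT; rewrite /crit/=; split => [->//|e].
by rewrite -[LHS]fineK ?fE// e.
Qed.

Lemma energy_continuous_time x a b : 0 <= a -> b <= T ->
  {within `[a, b], continuous (E^~ x)}.
Proof.
move=> a0 bT; apply/subspace_continuousP => t tab.
have sub r : r \in `[a, b] -> r \in `[0, T].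
  by rewrite !in_itv/= => /andP[/(le_trans a0)-> /le_trans]; exact.
apply: energy_cvg; [exact: sub|exact: cvg_within| |exact: cvg_cst].
apply: filterS (withinT _ _) => r; exact: sub.
Qed.

Lemma power_continuous_time x a b : 0 <= a -> b <= T ->
  {within `[a, b], continuous (power T E ^~ x)}.
Proof.
move=> a0 bT; apply/subspace_continuousP => t tab.
have sub r : r \in `[a, b] -> r \in `[0, T].
  by rewrite !in_itv/= => /andP[/(le_trans a0)-> /le_trans]; exact.
apply: power_cvg; [exact: sub|exact: cvg_within| |exact: cvg_cst].
apply: filterS (withinT _ _) => r; exact: sub.
Qed.

Lemma energy_is_derive t x : 0 < t < T -> is_derive t (1 : R) (E^~ x) (power T E t x).
Proof.
move=> /andP[t0 tT].
have tI : t \in `[0, T] by rewrite in_itv/= !ltW.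
case: regE => _ dE _ _ _.
have {}dE : time_quotient E t x s @[s --> within `[0, T] t^'] --> power T E t x.
  exact: dE tI.
have H : h^-1 *: ((E^~ x \o shift t) (h *: (1 : R)) - E t x) @[h --> (0 : R)^'] -->
    power T E t x.
  move=> A /dE; rewrite /= /within/= /nbhs/= => dA.
  have cs : h + t @[h --> (0 : R)] --> t.
    by rewrite -[X in _ --> X]add0r; apply: cvgD; [exact: cvg_id|exact: cvg_cst].
  have tn : \forall r \near t, r \in `[0, T].
    have : t \in `]0, T[ by rewrite in_itv/= t0.
    by move/near_in_itvoo; apply: filterS => r; rewrite !in_itv/= => /andP[/ltW-> /ltW->].
  rewrite /dnbhs /within/= !near_simpl.
  near=> h => h0 /=.
  have : time_quotient E t x (h + t) \in A.
    have ht : h + t \in `[0, T] by near: h; exact: (cs _ tn).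
    have htt : h + t != t by rewrite -subr_eq0 addrK.
    rewrite inE; move: htt ht; near: h; exact: (cs _ dA).
  by rewrite inE /time_quotient/= addrK [_ *: 1]mulr1 /GRing.scale/= mulrC.
by apply: DeriveDef; [apply/cvg_ex; eexists; exact: H|exact/cvg_lim].
Unshelve. all: by end_near. Qed.

Lemma energy_MVT x a b : 0 <= a -> a < b -> b <= T ->
  exists2 r, r \in `]a, b[ & E b x - E a x = power T E r x * (b - a).
Proof.
move=> a0 ab bT; apply: (@MVT _ (E^~ x)) => //; last exact: energy_continuous_time.
move=> r; rewrite in_itv/= => /andP[ar rb]; apply: energy_is_derive.
by rewrite (le_lt_trans a0)//= (lt_le_trans rb).
Qed.

Lemma energy_FTC x a b : 0 <= a -> a < b -> b <= T ->
  (\int[lebesgue_measure]_(r in `[a, b]) (power T E r x)%:E = (E b x - E a x)%:E)%E.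
Proof.
move=> a0 ab bT; rewrite EFinB (continuous_FTC2 (F := E^~ x))//.
- exact: power_continuous_time.
- have [_ cEa cEb] := (continuous_within_itvP _ ab).1 (energy_continuous_time (x := x) a0 bT).
  split => // r; rewrite in_itv/= => /andP[ar rb].
  apply: (@ex_derive _ _ _ _ _ _ (power T E r x)); apply: energy_is_derive.
  by rewrite (le_lt_trans a0)//= (lt_le_trans rb).
- move=> r; rewrite in_itv/= => /andP[ar rb]; rewrite derive1E.
  apply: (@derive_val _ _ _ _ _ _ (power T E r x)); apply: energy_is_derive.
  by rewrite (le_lt_trans a0)//= (lt_le_trans rb).
Qed.

(** Since the power is bounded by [C1 * (E + C2 / C1)], the derivative of
    [expR (k * r) * (E r x + C2 / C1)] has a sign for [k = - C1] and for [k = C1]. The two estimates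
    propagate a bound forwards and backwards in time. *)
Lemma energy_gronwall (C1 C2 : R) x : 0 < C1 ->
  (forall t, t \in `[0, T] -> `|power T E t x| <= C1 * E t x + C2) ->
  forall s t, 0 <= s -> s <= t -> t <= T ->
  expR (- C1 * t) * (E t x + C2 / C1) <= expR (- C1 * s) * (E s x + C2 / C1) /\
  expR (C1 * s) * (E s x + C2 / C1) <= expR (C1 * t) * (E t x + C2 / C1).
Proof.
move=> C10 pC s t s0; rewrite le_eqVlt => /predU1P[<-//|st] tT.
have aux (k : R) : exists2 r, 0 < r < T &
    expR (k * t) * (E t x + C2 / C1) - expR (k * s) * (E s x + C2 / C1) =
    expR (k * r) * (power T E r x + k * (E r x + C2 / C1)) * (t - s).
  have ck : {within `[s, t], continuous (fun r => expR (k * r) * (E r x + C2 / C1))}.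
    apply/subspace_continuousP => r rst; apply: cvgM.
      apply: cvg_within_filter; apply: continuous_comp; last exact: continuous_expR.
      by apply: cvgM; [exact: cvg_cst|exact: cvg_id].
    apply: cvgD; last exact: cvg_cst.
    by have /subspace_continuousP := energy_continuous_time (x := x) s0 tT; apply.
  have dk r : r \in `]s, t[ -> is_derive r (1 : R) (fun r => expR (k * r) * (E r x + C2 / C1))
      (expR (k * r) * (power T E r x + k * (E r x + C2 / C1))).
    rewrite in_itv/= => /andP[sr rt].
    have d1 : is_derive r (1 : R) (E^~ x) (power T E r x).
      by apply: energy_is_derive; rewrite (le_lt_trans s0)//= (lt_le_trans rt).
    have d2 : is_derive r (1 : R) (expR \o *%R k) (k * expR (k * r)).
      apply: is_derive_eq; rewrite /GRing.scale/= !mulr1 mulrC; reflexivity.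
    have -> : expR (k * r) * (power T E r x + k * (E r x + C2 / C1)) =
        (expR \o *%R k) r *: (power T E r x + 0) +
        (E^~ x + cst (C2 / C1)) r *: (k * expR (k * r)).
      rewrite addr0 -[(_ + cst _) r]/(E r x + C2 / C1) -[(_ \o _) r]/(expR (k * r)).
      by rewrite /GRing.scale/=; ring.
    exact: is_deriveM d2 (is_deriveD d1 (is_derive_cst (C2 / C1) r 1)).
  have [r rst ->] := MVT st dk ck; exists r => //.
  by move: rst; rewrite in_itv/= => /andP[sr rt]; rewrite (le_lt_trans s0)//= (lt_le_trans rt).
have pB r : 0 < r < T -> - (C1 * (E r x + C2 / C1)) <= power T E r x <= C1 * (E r x + C2 / C1).
  move=> /andP[r0 rT]; rewrite mulrDr mulrCA divff ?gt_eqF// mulr1 -ler_norml.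
  by apply: pC; rewrite in_itv/= !ltW.
split; rewrite -subr_ge0.
  have [r /pB/andP[_ h] e] := aux (- C1); rewrite -opprB e oppr_ge0.
  rewrite mulr_le0_ge0 ?subr_ge0 ?(ltW st)// mulr_ge0_le0 ?expR_ge0//.
  by rewrite mulNr subr_le0.
have [r /pB/andP[h _] ->] := aux C1.
rewrite mulr_ge0 ?subr_ge0 ?(ltW st)// mulr_ge0 ?expR_ge0//.
by rewrite -lerBlDr sub0r.
Qed.

End TimeRegularity.

(** * The quotient space *)

Section StateSpace.
Context {R : realType} {X : metricType R}.
Variables (T : R) (E : R -> X -> R).
Local Notation time := (`[0, T]%classic : set R).
Local Notation pi := (\pi_(state_space T E))%qT.

Lemma time_val (t : time) : \val t \in `[0, T].
Proof. by have := valP t; rewrite inE. Qed.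

Lemma state_eqP (p p' : time * X) :
  state E p.1 p.2 = state E p'.1 p'.2 <-> state_rel E p p'.
Proof.
case: p p' => [t x] [t' x'] /=; rewrite /state; split.
  by move=> /eqmodP.
by move=> h; apply/eqmodP.
Qed.

Lemma state_repr (xi : state_space T E) : state E (repr xi).1 (repr xi).2 = xi.
Proof. by rewrite /state -surjective_pairing reprK. Qed.

Lemma repr_state (t : time) x : state_rel E (repr (state E t x)) (t, x).
Proof. by apply/state_eqP; rewrite state_repr. Qed.

Lemma state_rel_time (p p' : time * X) : state_rel E p p' -> p.1 = p'.1.
Proof. by move=> /asboolP[->|[]]. Qed.

Lemma path_component_endpoints (A : set X) x y :
  path_component (R := R) A x y -> A x /\ A y.
Proof.
move=> [g [_ <- <- gA]]; split; apply: gA.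
  by exists 0 => //=; rewrite in_itv/= lexx ler01.
by exists 1 => //=; rewrite in_itv/= lexx ler01.
Qed.

Lemma path_component_refl (A : set X) x : A x -> path_component (R := R) A x x.
Proof.
move=> Ax; exists (fun=> x); split => //; first by apply: continuous_subspaceT; exact: cst_continuous.
by move=> _ [s _ <-].
Qed.

Lemma state_rel_crit (p p' : time * X) : state_rel E p p' ->
  crit (E (\val p.1)) p.2 -> crit (E (\val p'.1)) p'.2.
Proof.
move=> /asboolP[->//|[e pp']] _.
by have [_] := path_component_endpoints pp'; rewrite e.
Qed.

(** For a saturated [O], membership may be tested on the canonical representative, and the preimage
    in [time * X] is [O] again. *)
Lemma state_open (O : set (time * X)) : open O ->
  (forall p p', state_rel E p p' -> O p -> O p') ->
  open [set xi : state_space T E | O (repr xi)].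
Proof.
move=> oO satO; rewrite /open/= /quotient_open.
rewrite [X in open X](_ : _ = O)//; apply/seteqP; split => -[t x] /=.
  by apply: satO; exact: repr_state.
apply: satO; have := repr_state t x; rewrite state_rel_sym; exact.
Qed.

Lemma time_cvg (I : Type) (F : set_system I) (s : I -> time) (t : time) :
  Filter F -> (\val (s i) @[i --> F] --> \val t) <-> (s @ F --> t).
Proof.
move=> FF; split => [st A|st]; last first.
  by apply: cvg_comp st _; exact: initial_continuous.
rewrite /nbhs/= => -[B [[U oU <-] /= Ut UA]].
have /st H : nbhs (\val t) U by exact: open_nbhs_nbhs.
have {}H : \forall i \near F, U (\val (s i)) by [].
by apply: filterS H => i /UA.
Qed.

Lemma state_cvg_pair (I : Type) (F : set_system I) (p : I -> time * X) (q : time * X) :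
  Filter F -> \val (p i).1 @[i --> F] --> \val q.1 -> (p i).2 @[i --> F] --> q.2 -> p @ F --> q.
Proof.
move=> FF /time_cvg p1 p2; rewrite (surjective_pairing q).
have -> : p = fun i => ((p i).1, (p i).2) by apply/funext => i; exact: surjective_pairing.
exact: (@cvg_pair _ _ _ F (nbhs q.1) (nbhs q.2)).
Qed.

(* The relation is only required of the cluster points of (p i).2: all of     *)
(* them may differ, as long as they lie in one class.                         *)
Lemma state_cvg (I : Type) (F : set_system I) (p : I -> time * X) (t : time) (z : X)
    (K : set X) : Filter F -> compact K -> (\forall i \near F, K (p i).2) ->
  \val (p i).1 @[i --> F] --> \val t ->
  (forall (G : set_system I) y, UltraFilter G -> F `<=` G ->
    (p i).2 @[i --> G] --> y -> state_rel E (t, y) (t, z)) ->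
  state E (p i).1 (p i).2 @[i --> F] --> state E t z.
Proof.
move=> FF cK FK pt pz O Oz; rewrite /= nbhs_simpl/=; apply: near_ultra => G GU FG.
have [y Ky py] := compact_ultra_cvg GU cK (FG _ FK).
have pq : p @ G --> (t, y) by apply: state_cvg_pair => //; exact: cvg_trans (cvg_app _ FG) pt.
have : \pi_(state_space T E)%qT (p i) @[i --> G] --> \pi_(state_space T E)%qT (t, y).
  by apply: cvg_comp pq _; exact: pi_continuous.
have e : state E t y = state E t z by apply/(state_eqP (t, y) (t, z)); exact: pz py.
move=> h; have : nbhs (state E t y) O by rewrite e.
move=> /h; rewrite /= !nbhs_simpl/=; apply: filterS => i; rewrite /state/=.
by rewrite -surjective_pairing.
Qed.

Hypothesis regE : regular_energy T E.
Hypothesis lcX : locally_compact [set: X].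
Variable c : R -> X -> X -> R.
Hypotheses (actE : is_action T E c) (chainE : chain_condition T c).
Hypothesis zeroE : zero_action_iff T E c.

Lemma crit_cvg (I : Type) (F : set_system I) (s : I -> R) (x : I -> X) t y :
  ProperFilter F -> t \in `[0, T] -> s @ F --> t -> (\forall i \near F, s i \in `[0, T]) ->
  x @ F --> y -> fine (slope (E (s i)) (x i)) @[i --> F] --> 0 -> crit (E t) y.
Proof.
move=> FF tT st sT xy s0; apply/(crit_fine regE) => //.
by apply: (cvg_unique _ _ s0) => //; exact: (slope_cvg regE).
Qed.

Lemma action_le_cvg (I : Type) (F : set_system I) (x y : I -> X) x0 y0 t a :
  ProperFilter F -> t \in `[0, T] -> x @ F --> x0 -> y @ F --> y0 ->
  (\forall i \near F, c t (x i) (y i) <= a) -> c t x0 y0 <= a.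
Proof.
move=> FF tT xx yy ca; rewrite leNgt; apply/negP => ac.
have [_ lsc _] := actE tT.
have [|V V0 Va] := lsc (x0, y0) a; first by rewrite lte_fin.
have xy : (x i, y i) @[i --> F] --> (x0, y0).
  exact: (@cvg_pair _ _ _ F (nbhs x0) (nbhs y0)).
have [i [/= h1 /Va]] : exists i, c t (x i) (y i) <= a /\ V (x i, y i).
  by apply: (@filter_ex _ F); apply: filterI ca _; exact: xy.
by rewrite lte_fin/= ltNge h1.
Qed.

(** The chain condition for a single link transfers zero action from time [s] to small action at
    time [t]. *)
Lemma action_chain2 (e t : R) (K : set X) : 0 < e -> t \in `[0, T] -> compact K ->
  exists2 d : R, 0 < d & forall s x y, s \in `[0, T] -> `|s - t| <= d ->
    K x -> K y -> c s x y = 0 -> c t x y <= e.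
Proof.
move=> e0 tT cK; have [d d0 dP] := chainE e0 ltr01 tT cK.
exists d => // s x y sT st Kx Ky cxy.
have := dP 2%N (fun k => if k == 1%N then x else y) (fun=> s) isT _ _.
rewrite big_nat1/= cxy add0r; apply => // i _; split => //; first by case: ifP.
by rewrite in_itv/=; move: st; rewrite ler_distl.
Qed.

(** Two points of one component have zero action at time [s i], hence action at most [e] at time
    [t]; lower semicontinuity passes this to the limits. Local compactness provides the compact set
    required by the chain condition. *)
Lemma component_closed (I : Type) (F : set_system I) (s : I -> R) (x y : I -> X) t x0 y0 :
  ProperFilter F -> t \in `[0, T] -> s @ F --> t -> (\forall i \near F, s i \in `[0, T]) ->
  x @ F --> x0 -> y @ F --> y0 ->
  (\forall i \near F, path_component (R := R) (crit (E (s i))) (x i) (y i)) ->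
  path_component (R := R) (crit (E t)) x0 y0.
Proof.
move=> FF tT st sT xx yy pxy.
have c0 (z : I -> X) z0 : z @ F --> z0 -> (\forall i \near F, crit (E (s i)) (z i)) ->
    crit (E t) z0.
  move=> zz cz; apply: (crit_cvg _ tT st sT zz); apply: cvg_near_cst.
  by near=> i; apply/(crit_fine regE); near: i.
have cx : crit (E t) x0.
  by apply: (c0 _ _ xx); apply: filterS pxy => i h; have [] := path_component_endpoints h.
have cy : crit (E t) y0.
  by apply: (c0 _ _ yy); apply: filterS pxy => i h; have [] := path_component_endpoints h.
apply/zeroE => //; apply/eqP; rewrite eq_le; have [-> _ _] := actE tT; rewrite andbT.
apply/ler_addgt0Pl => e e0; rewrite addr0.
have [U] := lcX (x := x0) Logic.I; rewrite withinET => Ux [cU _].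
have [W] := lcX (x := y0) Logic.I; rewrite withinET => Wy [cW _].
have [d d0 dP] := action_chain2 e0 tT (compactU cU cW).
apply: (action_le_cvg _ tT xx yy); near=> i.
have sTi : s i \in `[0, T] by near: i.
have pi : path_component (R := R) (crit (E (s i))) (x i) (y i) by near: i.
have [cxi cyi] := path_component_endpoints pi.
apply: (dP (s i)) => //.
- by rewrite distrC; near: i; move/cvgrPdist_le : st; apply.
- by left; near: i; exact: xx.
- by right; near: i; exact: yy.
- exact/zeroE.
Unshelve. all: by end_near. Qed.

(** An ultrafilter selects one of the two clauses of [state_rel]: equality passes to the limit, and
    the other clause does by [component_closed]. *)
Lemma state_rel_closed (I : Type) (G : set_system I) (p p' : I -> time * X)
    (q q' : time * X) : UltraFilter G -> p @ G --> q -> p' @ G --> q' ->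
  (\forall i \near G, state_rel E (p i) (p' i)) -> state_rel E q q'.
Proof.
move=> GU pq pq' rpp'.
have c2 (u : I -> time * X) (v : time * X) : u @ G --> v -> (u i).2 @[i --> G] --> v.2.
  by case: v => a b uv; apply: (cvg_comp _ _ uv); exact: cvg_snd.
have c1 (u : I -> time * X) (v : time * X) : u @ G --> v -> \val (u i).1 @[i --> G] --> \val v.1.
  by case: v => a b uv; apply/time_cvg; apply: (cvg_comp _ _ uv); exact: cvg_fst.
have vq : \val (p i).1 @[i --> G] --> \val q'.1.
  have e i : state_rel E (p i) (p' i) -> (p i).1 = (p' i).1 by exact: state_rel_time.
  apply: cvg_trans (c1 _ _ pq'); apply: near_eq_cvg.
  by apply: filterS rpp' => i /e ->.
have e1 : q.1 = q'.1.
  by apply: val_inj; apply: (cvg_unique _ (c1 _ _ pq) vq).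
have [pp|pp] := in_ultra_setVsetC [set i | p i = p' i] GU.
  apply/asboolP; left; rewrite (surjective_pairing q) (surjective_pairing q') e1; congr pair.
  apply: (metric_cvg_unique _ (c2 _ _ pq)).
  apply: cvg_trans (c2 _ _ pq'); apply: near_eq_cvg.
  by apply: filterS pp => i /= ->.
apply/asboolP; right; split => //.
apply: (component_closed (F := G) (s := fun i => \val (p i).1) _ _ (c1 _ _ pq) _
  (c2 _ _ pq) (c2 _ _ pq')).
- exact: time_val.
- by apply: nearW => i; exact: time_val.
- by move: rpp' pp; apply: filterS2 => i /asboolP[|[]].
Qed.

(* The quotient is not known to be Hausdorff. If l were not the class of q,   *)
(* the union of the class of q and of the classes of p n, n >= N, would be a  *)
(* closed saturated set avoiding l: here the graph of state_rel is closed.    *)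
Lemma state_limit_unique (p : nat -> time * X) (q : time * X) (l : state_space T E) :
  p @ \oo --> q -> state E (p n).1 (p n).2 @[n --> \oo] --> l ->
  l = state E q.1 q.2.
Proof.
move=> pq pl; apply: contrapT => lq; pose r := repr l.
have nrq : ~ state_rel E r q by move=> /state_eqP; rewrite state_repr.
have sym u v : state_rel E u v -> state_rel E v u by rewrite state_rel_sym.
have trans u v w : state_rel E u v -> state_rel E v w -> state_rel E u w.
  exact: state_rel_trans.
have cst_cvg (G : set_system (time * X)) (v : time * X) : Filter G -> (fun=> v) @ G --> v.
  by move=> FG; exact: cvg_cst.
have [N _ NP] : \forall n \near \oo, ~ state_rel E (p n) r.
  apply: near_ultra => G GU ooG.
  have [//|] := in_ultra_setVsetC [set n | ~ state_rel E (p n) r] GU.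
  move=> GC; exfalso; apply: nrq; apply: sym.
  apply: (@state_rel_closed _ G p (fun=> r)) => //.
  - exact: cvg_trans (cvg_app _ ooG) pq.
  - exact: cvg_cst.
  - by apply: filterS GC => n /= /contrapT.
pose P := [set u | state_rel E u q \/ exists2 m, (N <= m)%N & state_rel E u (p m)].
have clP : closed P.
  move=> u; rewrite closureEcvg => -[F PF [Fu PF']].
  have FP : F P by apply: PF'.
  have [H [HU FH]] := ultraFilterLemma PF.
  have Hu : (fun v => v) @ H --> u by exact: cvg_trans Fu.
  have [H1|H1] := in_ultra_setVsetC [set v | state_rel E v q] HU.
    by left; apply: (@state_rel_closed _ H (fun v => v) (fun=> q) u q HU Hu _ H1); exact: cst_cvg.
  have pick v : exists m, P v -> ~ state_rel E v q -> (N <= m)%N /\ state_rel E v (p m).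
    have [[vq|[m Nm vm]]|nP] := pselect (P v); first by exists 0%N.
      by exists m.
    by exists 0%N.
  have [mm mmP] := choice pick.
  have HP : \forall v \near H, (N <= mm v)%N /\ state_rel E v (p (mm v)).
    by move: (FH _ FP) H1; apply: filterS2 => v Pv vq; exact: mmP.
  (* Either the index is constant on a member of [H], or it tends to infinity and [p (mm v)] tends
     to [q]. *)
  have [[k Hk]|nk] := pselect (exists k, H [set v | mm v = k]).
    have [v0 [/= [Nk _] e0]] := filter_ex (filterI HP Hk).
    right; exists k; first by rewrite -e0.
    apply: (@state_rel_closed _ H (fun v => v) (fun=> p k) u (p k) HU Hu); first exact: cst_cvg.
    by move: HP Hk; apply: filterS2 => v [_ +] <-.
  left; apply: (@state_rel_closed _ H (fun v => v) (fun v => p (mm v)) u q HU Hu).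
    apply: (@cvg_comp _ _ _ mm p) pq => A [M _ MA].
    have : \forall v \near H, forall k : 'I_M, mm v <> k.
      apply: filter_forall => k.
      have [Hk|//] := in_ultra_setVsetC [set v | mm v = k] HU.
      by exfalso; apply: nk; exists k.
    apply: filterS => v vM; apply: MA => /=; rewrite leqNgt; apply/negP => vlt.
    by have := vM (Ordinal vlt).
  by apply: filterS HP => v [].
have oU : open [set xi : state_space T E | ~ P (repr xi)].
  apply: (@state_open (~` P)); first exact: closed_openC.
  move=> u v uv; apply: contra_not => -[vq|[m Nm vm]]; first by left; exact: trans uv vq.
  by right; exists m => //; exact: trans uv vm.
have /pl : nbhs l [set xi : state_space T E | ~ P (repr xi)].
  apply: open_nbhs_nbhs; split => //= -[//|[m Nm]] /sym; exact: NP.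
move=> [M _ MP].
have /= := MP (maxn M N) (leq_maxl _ _); apply; right.
exists (maxn M N); first exact: leq_maxr.
by rewrite [X in state_rel E _ X]surjective_pairing; exact: repr_state.
Qed.

End StateSpace.

(** * Discrete evolutions *)

Section Lifts.
Context {R : realType} {X : metricType R}.
Variables (T : R) (E : R -> X -> R).
Local Notation time := (`[0, T]%classic : set R).
Hypothesis regE : regular_energy T E.

Lemma energy_hat_state (t : time) x : critical_structure T E ->
  energy_hat (state E t x) = E (\val t) x.
Proof.
move=> critE; rewrite /energy_hat; have := repr_state E t x.
move=> /asboolP[->//|[/= e pp]]; rewrite e in pp *.
by have [_] := critE _ (time_val t); apply.
Qed.

Lemma energy_hat_continuous : critical_structure T E ->
  continuous (@energy_hat R X T E).
Proof.
move=> critE; apply/quotient_continuous => p.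
have e : @energy_hat R X T E \o \pi_(state_space T E)%qT = (fun p => E (\val p.1) p.2).
  apply/funext => -[t x] /=; exact: energy_hat_state.
change ((@energy_hat R X T E \o \pi_(state_space T E)%qT) x @[x --> p] -->
  (@energy_hat R X T E \o \pi_(state_space T E)%qT) p).
rewrite e; case: p => t x /=; apply: (energy_cvg regE); first exact: time_val.
- by apply/time_cvg; exact: cvg_fst.
- by apply: nearW => i; exact: time_val.
- exact: cvg_snd.
Qed.

Lemma power_hat_state (t : time) x : power_lifts T E ->
  power_hat (state E t x) = power T E (\val t) x.
Proof.
move=> [pE _]; rewrite /power_hat; have r := repr_state E t x.
have /= e := state_rel_time r; rewrite e; apply: pE.
by have := state_repr (state E t x); rewrite e.
Qed.

End Lifts.

Section Discrete.
Context {R : realType} {X : metricType R}.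
Variables (T : R) (E : R -> X -> R) (omega : R -> X -> X) (c : R -> X -> X -> R) (x0 : X).
Hypotheses (T0 : 0 < T) (regE : regular_energy T E).
Hypothesis powE : power_control T E.
Hypothesis decE : energy_nonincreasing T E omega.

Section Steps.
Variable delta : R.
Hypothesis delta0 : 0 < delta.

Local Notation M := (nsteps T delta).
Local Notation w := (iterate omega x0 delta).
Local Notation h := (discrete_evolution T omega x0 delta).

Definition step_index (t : R) : nat := minn (Num.truncn (t / delta)) M.
Local Notation k := step_index.

Lemma discrete_evolutionE t : h t = w (k t). Proof. by []. Qed.

(** The case distinction in [nsteps] makes the first inequality strict, so that the right limit at
    the last step is a genuine one and never the convention at [T]. *)
Lemma nsteps_bounds : M%:R * delta < T <= M.+1%:R * delta.
Proof.
have Td0 : 0 < T / delta by rewrite divr_gt0.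
have := truncnS_gt (T / delta).
have : (Num.truncn (T / delta))%:R <= T / delta by rewrite truncn_le ltW.
rewrite /nsteps -(ler_pdivrMr _ _ delta0) -(ltr_pdivlMr _ _ delta0).
set m := Num.truncn _; have [e|ne] := eqVneq; last first.
  by move=> h1 /ltW ->; rewrite lt_neqAle eq_sym ne h1.
case: m e => [|m] e; first by move: Td0; rewrite e ltxx.
by move=> _ _; rewrite e /= lexx andbT ltr_nat.
Qed.

Lemma step_time i : (i <= M)%N -> i%:R * delta \in `[0, T].
Proof.
move=> iM; rewrite in_itv/= mulr_ge0 ?(ltW delta0) ?ler0n//=.
have /andP[/ltW + _] := nsteps_bounds; apply: le_trans.
by rewrite ler_pM2r// ler_nat.
Qed.

Lemma step_index_le t : (k t <= M)%N. Proof. exact: geq_minr. Qed.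

Lemma step_index_ge i t : (0 < i <= M)%N -> (i <= k t)%N = (i%:R * delta <= t).
Proof.
move=> /andP[i0 iM]; rewrite leq_min iM andbT.
by case: i i0 {iM} => // i _; rewrite truncn_gt_nat ler_pdivlMr.
Qed.

Lemma step_index_homo s t : s <= t -> (k s <= k t)%N.
Proof.
move=> st; rewrite /step_index leq_min geq_minr andbT (leq_trans (geq_minl _ _))//.
by apply: le_truncn; rewrite ler_pM2r// invr_gt0.
Qed.

Lemma step_index_itv t : t \in `[0, T] -> (k t)%:R * delta <= t <= (k t).+1%:R * delta.
Proof.
rewrite in_itv/= => /andP[t0 tT]; apply/andP; split.
  have [->|k0] := posnP (k t); first by rewrite mul0r.
  by rewrite -step_index_ge// k0 step_index_le.
have [kM|Mk] := ltnP (k t) M.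
  by rewrite leNgt; apply/negP => /ltW; rewrite -step_index_ge// ltnn.
have -> : k t = M by apply/eqP; rewrite eqn_leq Mk step_index_le.
by apply: (le_trans tT); have /andP[] := nsteps_bounds.
Qed.

Lemma step_index_eq i t : (i <= M)%N -> i%:R * delta <= t ->
  ((i < M)%N -> t < i.+1%:R * delta) -> k t = i.
Proof.
move=> iM it ti; apply/eqP; rewrite eqn_leq; apply/andP; split; last first.
  by have [->//|i0] := posnP i; rewrite step_index_ge ?i0.
have [iM'|Mi] := ltnP i M; last by rewrite (leq_trans (step_index_le t)).
by rewrite leqNgt step_index_ge// -ltNge; exact: ti.
Qed.

(** For [1 <= i <= M] this is the mass of [jump_measure] at the [i]-th step time and, by
    compatibility, also the action of that step. *)
Definition jump_size (i : nat) : R :=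
  E (i%:R * delta) (w i.-1) - E (i%:R * delta) (w i).

Definition jump_sum (t : R) : R := \sum_(1 <= i < (k t).+1) jump_size i.

Lemma jump_size_ge0 i : (0 < i <= M)%N -> 0 <= jump_size i.
Proof.
case: i => // i /andP[_ iM]; rewrite /jump_size/= subr_ge0.
by apply: decE; exact: step_time.
Qed.

Lemma jump_sumB s t : s <= t ->
  jump_sum t - jump_sum s = \sum_((k s).+1 <= i < (k t).+1) jump_size i.
Proof.
move=> /step_index_homo st; rewrite /jump_sum (big_cat_nat (n := (k s).+1))//=.
by rewrite addrAC subrr add0r.
Qed.

Lemma jump_sum_homo : {homo jump_sum : s t / s <= t}.
Proof.
move=> s t st; rewrite -subr_ge0 jump_sumB// big_nat sumr_ge0// => i /andP[si it].
apply: jump_size_ge0; rewrite (leq_ltn_trans (leq0n (k s)))//=.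
by rewrite (leq_trans _ (step_index_le t)).
Qed.

Lemma jump_sum_le0 t : t <= 0 -> jump_sum t = 0.
Proof.
move=> t0; rewrite /jump_sum; suff -> : k t = 0%N by rewrite big_geq.
apply/eqP; rewrite -leqn0 leqNgt; apply/negP => k0.
have : (k t <= k t)%N by [].
rewrite step_index_ge ?k0 ?step_index_le// => /le_trans/(_ t0).
by apply/negP; rewrite -ltNge mulr_gt0// ltr0n.
Qed.

Lemma jump_sum_geT t : T <= t -> jump_sum t = jump_sum T.
Proof.
have kM s : T <= s -> k s = M.
  move=> Ts; apply: step_index_eq => //; last by rewrite ltnn.
  by rewrite (le_trans _ Ts)// ltW//; have /andP[] := nsteps_bounds.
by move=> Tt; rewrite /jump_sum !kM.
Qed.

Lemma discrete_left_energy i : (0 < i <= M)%N ->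
  energy_left T E omega x0 delta (i%:R * delta) = E (i%:R * delta) (w i.-1).
Proof.
case: i => // i /andP[_ iM]; rewrite /energy_left gt_eqF ?mulr_gt0 ?ltr0n//.
apply/cvg_lim => //.
have id : i%:R * delta < i.+1%:R * delta by rewrite ltr_pM2r// ltr_nat.
have cE : E s (w i) @[s --> (i.+1%:R * delta)^'-] --> E (i.+1%:R * delta) (w i).
  apply: (energy_cvg regE); [exact: step_time|exact: cvg_within| |exact: cvg_cst].
  near=> s; rewrite in_itv/=; apply/andP; split.
    by apply: (@le_trans _ _ (i%:R * delta)); [rewrite mulr_ge0// ltW|near: s; exact: nbhs_left_ge].
  have := step_time iM; rewrite in_itv/= => /andP[_]; apply: le_trans.
  by near: s; exact: nbhs_left_le.
apply: cvg_trans cE; apply: near_eq_cvg; near=> s.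
rewrite discrete_evolutionE (step_index_eq (i := i))//.
- exact: ltnW.
- by near: s; exact: nbhs_left_ge.
Unshelve. all: by end_near. Qed.

Lemma discrete_right_energy i : (i <= M)%N ->
  energy_right T E omega x0 delta (i%:R * delta) = E (i%:R * delta) (w i).
Proof.
move=> iM; have iT : i%:R * delta < T.
  have /andP[+ _] := nsteps_bounds; apply: le_lt_trans.
  by rewrite ler_pM2r// ler_nat.
have id : i%:R * delta < i.+1%:R * delta by rewrite ltr_pM2r// ltr_nat.
rewrite /energy_right lt_eqF//; apply/cvg_lim => //.
have cE : E s (w i) @[s --> (i%:R * delta)^'+] --> E (i%:R * delta) (w i).
  apply: (energy_cvg regE); [exact: step_time|exact: cvg_within| |exact: cvg_cst].
  near=> s; rewrite in_itv/=; apply/andP; split.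
    by apply: (@le_trans _ _ (i%:R * delta)); [rewrite mulr_ge0// ltW|near: s; exact: nbhs_right_ge].
  by near: s; exact: nbhs_right_le.
apply: cvg_trans cE; apply: near_eq_cvg; near=> s.
by rewrite discrete_evolutionE (step_index_eq (i := i)).
Unshelve. all: by end_near. Qed.

Lemma jump_measure_finite :
  exists mu : {finite_measure set R -> \bar R},
  [/\ jump_measure T E omega x0 delta = mu :> (set R -> \bar R),
      forall s t, s <= t -> mu `]s, t]%classic = (jump_sum t - jump_sum s)%:E &
      mu (~` `[0, T]) = 0%E].
Proof.
(* Beyond the last step [jump_size] need not be nonnegative; cutting it off gives a family of
   measures indexed by all of [nat]. *)
have jge0 (i : nat) : 0 <= (if (i < M)%N then jump_size i.+1 else 0).
  by case: ifPn => // iM; exact: jump_size_ge0.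
pose nu (i : nat) : {measure set R -> \bar R} :=
  mscale (NngNum (jge0 i)) (dirac (i.+1%:R * delta : R)).
have jE A : jump_measure T E omega x0 delta A = msum nu M A.
  rewrite /jump_measure /msum big_add1/= -(big_mkord xpredT (fun i => nu i A)).
  rewrite big_mkcond/= big_nat [RHS]big_nat; apply: eq_bigr => i /andP[_ iM].
  rewrite /nu/= /mscale/= iM diracE /jump_size discrete_left_energy// discrete_right_energy//.
  by case: ifPn; rewrite ?mule1 ?mule0.
have sE : jump_measure T E omega x0 delta = msum nu M :> (set R -> \bar R).
  by apply/funext => A; exact: jE.
have jB A : jump_measure T E omega x0 delta A =
    (\sum_(1 <= i < M.+1 | i%:R * delta \in A) jump_size i)%:E.
  rewrite /jump_measure sumEFin; congr EFin; rewrite big_nat_cond [RHS]big_nat_cond.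
  apply: eq_bigr => i /andP[/andP[i0 iM] _]; rewrite discrete_left_energy ?i0//.
  by rewrite discrete_right_energy.
have [mu muE] : exists mu : {finite_measure set R -> \bar R},
    mu = jump_measure T E omega x0 delta :> (set R -> \bar R).
  apply: finite_measure_of_function.
  - by rewrite jE measure0.
  - by move=> A; rewrite jE.
  - by rewrite sE; exact: measure_semi_sigma_additive.
  - by move=> A mA; rewrite jB.
exists mu; rewrite muE; split => // [s t st|].
  rewrite jB jump_sumB//; congr EFin.
  rewrite big_nat_cond [RHS](big_nat_widenl _ 1%N)// [RHS](big_nat_widen _ _ M.+1); last first.
    by rewrite ltnS step_index_le.
  rewrite [RHS]big_nat_cond; apply: eq_bigl => i.
  have [i1M|] := boolP (1 <= i < M.+1)%N => //=.
  rewrite mem_setE in_itv/= andbC [(k s < i)%N]ltnNge step_index_ge// -ltNge ltnS step_index_ge//.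
  by rewrite andbC.
rewrite jB big_nat_cond big_pred0// => i; apply/negbTE; rewrite negb_and.
have [/andP[i1 iM]|//] := boolP (1 <= i < M.+1)%N => /=.
by rewrite notin_setE/= => /(_ (step_time iM)).
Qed.

Lemma evolution_measurable (B : R) :
  (forall i, (i <= M)%N -> forall t, t \in `[0, T] -> `|power T E t (w i)| <= B) ->
  lebesgue_measure.-integrable `[0, T] (EFin \o (fun t => power T E t (h t))).
Proof.
move=> pB; apply: measurable_bounded_integrable => //.
- by apply: compact_finite_measure; exact: segment_compact.
(* On each cell the evolution is constant. The last cell is closed at [T], and the indices beyond it
   get the empty set. *)
- pose D i := if (i < M)%N then `[i%:R * delta, i.+1%:R * delta[%classic
    else if i == M then `[i%:R * delta, T]%classic else set0 : set R.
  have DE : `[0, T]%classic = \bigcup_i D i.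
    apply/seteqP; split => t.
      move=> tT; have /andP[kt tk] := step_index_itv tT.
      exists (k t) => //; rewrite /D; have [kM|Mk] := ltnP (k t) M.
        rewrite /= in_itv/= kt ltNge; apply/negP.
        by rewrite -step_index_ge// ltnn.
      by rewrite eqn_leq Mk step_index_le /= in_itv/= kt; move: tT; rewrite /= in_itv/= => /andP[].
    move=> [i _]; rewrite /D; case: ifPn => [iM|_].
      rewrite /= !in_itv/= => /andP[it ti].
      have := step_time iM; have := step_time (ltnW iM); rewrite !in_itv/=.
      by move=> /andP[/le_trans/(_ it)-> _] /andP[_ /(le_trans (ltW ti))].
    case: ifPn => // /eqP -> /=; rewrite !in_itv/= => /andP[it ->].
    by have := step_time (leqnn M); rewrite in_itv/= => /andP[/le_trans/(_ it)->].
  have DT i : D i `<=` `[0, T] by rewrite DE => t Dt; exists i.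
  have mD i : measurable (D i).
    by rewrite /D; case: ifP => // _; case: ifP.
  rewrite DE; apply/measurable_fun_bigcup => // i.
  have [iM|Mi] := leqP i M; last first.
    rewrite /D ltnNge ltnW//= gtn_eqF//; exact: measurable_fun_set0.
  apply: (@eq_measurable_fun _ _ _ _ _ (power T E ^~ (w i))).
    move=> t; rewrite inE => Dt; congr (power T E t _).
    rewrite discrete_evolutionE; congr (w _); apply/esym.
    move: Dt; rewrite /D; case: ifPn => [iM'|iM'].
      by rewrite /= in_itv/= => /andP[it ti]; exact: step_index_eq.
    case: ifPn => // /eqP e; rewrite /= in_itv/= => /andP[it _].
    by apply: step_index_eq => //; rewrite e ltnn.
  apply: (measurable_funS _ (DT i)) => //.
  apply: subspace_continuous_measurable_fun => //.
  exact: (power_continuous_time regE).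
- exists B; split; first exact: num_real.
  move=> r Br t /= tT; apply: le_trans (ltW Br).
  by rewrite discrete_evolutionE; apply: pB => //; exact: step_index_le.
Qed.

(** Between steps the state is frozen, so the energy changes by the integral of the power; each step
    lowers it by the jump size. *)
Lemma energy_identity (B : R) t :
  (forall i, (i <= M)%N -> forall t, t \in `[0, T] -> `|power T E t (w i)| <= B) ->
  t \in `[0, T] ->
  E t (h t) + jump_sum t =
  E 0 x0 + \int[lebesgue_measure]_(s in `[0, t]) power T E s (h s).
Proof.
move=> pB tT; have intP := evolution_measurable pB.
have intS (D : set R) : measurable D -> D `<=` `[0, T] ->
    lebesgue_measure.-integrable D (EFin \o (fun t => power T E t (h t))).
  by move=> mD DT; apply: integrableS intP.
(* The evolution may jump at [b], so the index is prescribed on [[a, b[] only; the endpoint is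
   negligible for the integral. *)
have piece i a b : (i <= M)%N -> 0 <= a -> a <= b -> b <= T ->
    (forall s, a <= s -> s < b -> k s = i) ->
    \int[lebesgue_measure]_(s in `[0, b]) power T E s (h s) =
    \int[lebesgue_measure]_(s in `[0, a]) power T E s (h s) + (E b (w i) - E a (w i)).
  move=> iM a0; rewrite le_eqVlt => /predU1P[<- _ _|ab bT ki].
    by rewrite subrr addr0.
  have i0b : `[0, b] `<=` `[0, T].
    by move=> s /=; rewrite !in_itv/= => /andP[-> /le_trans]; exact.
  have iab : `[a, b] `<=` `[0, T].
    by move=> s /=; rewrite !in_itv/= => /andP[/(le_trans a0)-> /le_trans]; exact.
  have intb := intS _ (measurable_itv `[0, b]) i0b.
  have intab := intS _ (measurable_itv `[a, b]) iab.
  apply/eqP; rewrite -subr_eq0 opprD addrA subr_eq0; apply/eqP.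
  rewrite (@Rintegral_itvB _ _ (BLeft 0) (BRight b) a)//; last by rewrite bnd_simp ltW.
  rewrite Rintegral_itv_obnd_cbnd; last first.
    by apply: integrableS intab => //; apply: subset_itv; rewrite bnd_simp.
  rewrite -Rintegral_itv_bndo_bndc; last first.
    by apply: integrableS intab => //; apply: subset_itv; rewrite bnd_simp.
  have intw : lebesgue_measure.-integrable `[a, b] (EFin \o power T E ^~ (w i)).
    apply: continuous_compact_integrable; first exact: segment_compact.
    exact: (power_continuous_time regE).
  transitivity (\int[lebesgue_measure]_(s in `[a, b[) power T E s (w i)).
    by apply: eq_Rintegral => s; rewrite inE/= in_itv/= => /andP[as_ sb]; rewrite discrete_evolutionE ki.
  rewrite Rintegral_itv_bndo_bndc; last first.
    by apply: integrableS intw => //; apply: subset_itv; rewrite bnd_simp.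
  by rewrite /Rintegral (energy_FTC regE)//.
have base i : (i <= M)%N ->
    E (i%:R * delta) (w i) + \sum_(1 <= j < i.+1) jump_size j =
    E 0 x0 + \int[lebesgue_measure]_(s in `[0, i%:R * delta]) power T E s (h s).
  elim: i => [_|i IH iM].
    by rewrite mul0r big_geq// addr0 set_itv1 Rintegral_set1 addr0.
  have := IH (ltnW iM); have := step_time iM; have := step_time (ltnW iM).
  rewrite !in_itv/= => /andP[i0 _] /andP[_ i1T] {}IH.
  rewrite (piece i (i%:R * delta))//; last 2 first.
    - by rewrite ler_pM2r// ler_nat.
    - by move=> s is_ si; apply: step_index_eq => //; exact: ltnW.
  - rewrite addrA -IH big_nat_recr//= {2}/jump_size/=; ring.
  - exact: ltnW.
have /andP[kt tk] := step_index_itv tT; have kM := step_index_le t.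
move: tT; rewrite in_itv/= => /andP[t0 tT].
have := step_time kM; rewrite in_itv/= => /andP[k0 _].
rewrite (piece (k t) ((k t)%:R * delta))//; last first.
  move=> s ks st; apply/eqP; rewrite eqn_leq step_index_homo ?(ltW st)//=.
  have [->//|kpos] := posnP (k t).
  by rewrite step_index_ge// kpos.
by rewrite addrA -base// discrete_evolutionE /jump_sum; ring.
Qed.

(** The steps made in []s, t]] form a chain from [h s] to [h t], whose total action is exactly the
    increment of the jump sum. *)
Lemma evolution_chain (d e C t0 s t : R) (K : set X) : compatible T E omega c ->
  (forall (n : nat) (x : nat -> X) (r : nat -> R), (2 <= n)%N ->
    (forall i, (1 <= i <= n)%N ->
      [/\ K (x i), r i \in `[t0 - d, t0 + d] & r i \in `[0, T]]) ->
    \sum_(1 <= i < n) c (r i) (x i) (x i.+1) <= C ->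
    c t0 (x 1%N) (x n) <= \sum_(1 <= i < n) c (r i) (x i) (x i.+1) + e) ->
  (forall i, (i <= M)%N -> K (w i)) ->
  t0 - d <= s -> s <= t -> t <= t0 + d -> (k s < k t)%N ->
  jump_sum t - jump_sum s <= C ->
  c t0 (h s) (h t) <= jump_sum t - jump_sum s + e.
Proof.
move=> compE chain Kw ds st td kst.
pose n := (k t - k s).+1.
pose x i := w (k s + i.-1)%N.
(* The time [r n] does not occur in the sum but must lie in the window and in [[0, T]]; hence the
   cap at [k t]. *)
pose r i := (minn (k s + i) (k t))%:R * delta.
have sumE : \sum_(1 <= i < n) c (r i) (x i) (x i.+1) = jump_sum t - jump_sum s.
  rewrite jump_sumB// -[in RHS](add1n (k s)) big_addn /n subSn 1?ltnW//.
  apply: eq_big_nat => i /andP[i1 ikst].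
  have ikt : (i + k s <= k t)%N by rewrite -ltnS in ikst *; rewrite addnC -leq_subRL// ltnW.
  have kM : (i + k s <= M)%N := leq_trans ikt (step_index_le t).
  rewrite /r /x /= [(k s + i)%N]addnC (minn_idPl ikt) /jump_size.
  case: i i1 ikst ikt kM => // i _ _ ikt kM.
  rewrite addSn in kM *; rewrite /= [(k s + i)%N]addnC -compE//.
  exact: step_time.
move=> VC; rewrite -sumE.
have -> : h s = x 1%N by rewrite /x addn0.
have -> : h t = x n by rewrite /x /n /= subnKC// ltnW.
apply: chain => //; [by rewrite /n ltnS subn_gt0|move=> i /andP[i1 iN]|by rewrite sumE].
have ikt : (k s + i.-1 <= k t)%N.
  by rewrite -leq_subRL ?(ltnW kst)// -ltnS prednK.
have rM : (minn (k s + i) (k t) <= M)%N by rewrite (leq_trans (geq_minr _ _))// step_index_le.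
split; [|rewrite in_itv/=|exact: step_time].
  by apply: Kw; exact: leq_trans ikt (step_index_le t).
have r0 : (0 < minn (k s + i) (k t) <= M)%N.
  by rewrite rM leq_min addn_gt0 i1 orbT (leq_ltn_trans _ kst).
apply/andP; split.
  apply: (le_trans ds); rewrite /r leNgt; apply/negP => /ltW.
  rewrite -step_index_ge// leqNgt leq_min kst andbT.
  by rewrite -[X in (X < _)%N]addn0 ltn_add2l i1.
by apply: le_trans td; rewrite /r -step_index_ge// geq_minr.
Qed.

(** In the energy identity at time [T], the two energies contribute [2 * B] and the work at most
    [B * T]. *)
Lemma jump_sum_bounded (B : R) : 0 <= B ->
  (forall i, (i <= M)%N -> forall t, t \in `[0, T] -> `|E t (w i)| <= B /\
    `|power T E t (w i)| <= B) ->
  forall t, jump_sum t <= 2 * B + B * T.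
Proof.
move=> B0 EB t.
have pB i : (i <= M)%N -> forall t, t \in `[0, T] -> `|power T E t (w i)| <= B.
  by move=> iM r rT; exact: (EB i iM r rT).2.
apply: (@le_trans _ _ (jump_sum T)).
  have [tT|/ltW Tt] := leP t T; first exact: jump_sum_homo.
  by rewrite jump_sum_geT.
have TT : T \in `[0, T] by rewrite in_itv/= lexx ltW.
have T00 : 0 \in `[0, T] by rewrite in_itv/= lexx ltW.
have := energy_identity pB TT.
have := Rintegral_itv_le (ltW T0) (evolution_measurable pB) (B := B).
rewrite subr0 => intB.
have {}intB : \int[lebesgue_measure]_(s in `[0, T]) power T E s (h s) <= B * T.
  apply: intB => s sT; apply: le_trans (ler_norm _) _; apply: pB => //.
  exact: step_index_le.
have [h1 _] := EB _ (step_index_le T) _ TT.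
have [h2 _] := EB 0%N (leq0n _) _ T00.
move: h1 h2; rewrite /= !ler_norml discrete_evolutionE => /andP[h1 _] /andP[_ h2] e.
move: e h1 h2 intB; set I := Rintegral _ _ _; set Ev := E T _; lra.
Qed.

End Steps.

(** The quantity [expR (- C1 * t) * (E + C2 / C1)] decreases between steps by the Gronwall estimate
    and at steps because the energy does. This bounds the energy of an iterate at its own step time;
    passing to any other time of [[0, T]] costs one more factor [g]. *)
Lemma evolution_bounded : compact_sublevels T E ->
  exists (K : set X) (B : R), [/\ compact K, 0 <= B &
    forall delta i, 0 < delta -> (i <= nsteps T delta)%N ->
      K (iterate omega x0 delta i) /\
      forall t, t \in `[0, T] -> `|E t (iterate omega x0 delta i)| <= B /\
        `|power T E t (iterate omega x0 delta i)| <= B].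
Proof.
move=> subE; have [C1 [C2 [C10 C20 pC]]] := powE.
have grw x := energy_gronwall regE C10 (fun t => pC t x).
pose kap := C2 / C1; have kap0 : 0 <= kap by rewrite divr_ge0// ltW.
(* The power control bounds an absolute value, so its right-hand side [C1 * (E + kap)] is
   nonnegative. *)
have Ek0 t x : t \in `[0, T] -> 0 <= E t x + kap.
  move=> tT; have := le_trans (normr_ge0 _) (pC t x tT) => h.
  rewrite -(pmulr_rge0 _ C10) mulrDr /kap mulrCA divff ?gt_eqF// mulr1//.
pose e0 := E 0 x0 + kap.
have T00 : 0 \in `[0, T] by rewrite in_itv/= lexx ltW.
have e00 : 0 <= e0 by exact: Ek0.
pose g := expR (C1 * T).
have g1 : 1 <= g by rewrite -expR0 ler_expR mulr_ge0// ltW.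
have bound delta i : 0 < delta -> (i <= nsteps T delta)%N -> forall t, t \in `[0, T] ->
    E t (iterate omega x0 delta i) + kap <= g * (g * e0).
  move=> delta0 iM.
  have step j : (j <= nsteps T delta)%N ->
      expR (- C1 * (j%:R * delta)) * (E (j%:R * delta) (iterate omega x0 delta j) + kap) <= e0.
    elim: j => [_|j IH jM]; first by rewrite mul0r mulr0 expR0 mul1r.
    have := step_time delta0 jM; rewrite in_itv/= => /andP[j0 jT].
    apply: le_trans (IH (ltnW jM)).
    have jj : j%:R * delta <= j.+1%:R * delta by rewrite ler_pM2r// ler_nat.
    have j00 : 0 <= j%:R * delta by rewrite mulr_ge0// ltW.
    apply: le_trans (grw (iterate omega x0 delta j) _ _ j00 jj jT).1.
    rewrite ler_pM2l ?expR_gt0// lerD2r; apply: decE; exact: step_time.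
  set x := iterate omega x0 delta i; set ti := i%:R * delta.
  have tiT : ti \in `[0, T] by exact: step_time.
  have h1 : E ti x + kap <= g * e0.
    have := step i iM; rewrite -/ti -/x mulNr expRN mulrC ler_pdivrMr ?expR_gt0// => h.
    apply: (le_trans h); rewrite mulrC ler_wpM2r// ler_expR ler_pM2l//.
    by move: tiT; rewrite in_itv/= => /andP[].
  move=> t tT; apply: (@le_trans _ _ (g * (E ti x + kap))); last first.
    by rewrite ler_wpM2l// expR_ge0.
  move: (tiT) (tT); rewrite !in_itv/= => /andP[ti0 tiT'] /andP[t0 tT'].
  have [tti|tit] := leP t ti.
    have [_ h2] := grw x _ _ t0 tti tiT'.
    have := Ek0 t x tT; have := Ek0 ti x tiT => h3 h4.
    apply: (@le_trans _ _ (expR (C1 * t) * (E t x + kap))).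
      by rewrite ler_peMl// -expR0 ler_expR mulr_ge0// ltW.
    apply: (le_trans h2); rewrite ler_wpM2r// ler_expR ler_pM2l//.
  have [h2 _] := grw x _ _ ti0 (ltW tit) tT'.
  have h3 := Ek0 ti x tiT.
  move: h2; rewrite !mulNr !expRN mulrC ler_pdivrMr ?expR_gt0// => h2.
  apply: (le_trans h2); rewrite mulrC mulrA ler_wpM2r// mulrC.
  rewrite ler_pdivrMl ?expR_gt0//.
  apply: (@le_trans _ _ g); first by rewrite ler_expR ler_pM2l.
  by rewrite ler_peMl ?expR_ge0// -expR0 ler_expR mulr_ge0// ltW.
pose B := Num.max (g * (g * e0) + kap) (C1 * (g * (g * e0))).
have gge0 : 0 <= g * (g * e0) by rewrite !mulr_ge0 ?expR_ge0.
exists [set x | (ereal_sup [set `|E t x|%:E | t in `[0%R, T]] <= B%:E)%E], B; split.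
- exact: subE.
- by rewrite le_max addr_ge0.
move=> delta i delta0 iM.
have EB t : t \in `[0, T] -> `|E t (iterate omega x0 delta i)| <= B.
  move=> tT; rewrite le_max; apply/orP; left.
  have := bound delta i delta0 iM t tT; have := Ek0 t (iterate omega x0 delta i) tT.
  by rewrite ler_norml; lra.
split.
  apply: ge_ereal_sup => _ [t tT <-]; rewrite lee_fin; exact: EB.
move=> t tT; split; first exact: EB.
apply: le_trans (pC _ _ tT) _; rewrite le_max; apply/orP; right.
apply: (@le_trans _ _ (C1 * (E t (iterate omega x0 delta i) + kap))).
  by rewrite mulrDr /kap mulrCA divff ?gt_eqF// mulr1.
by rewrite ler_pM2l//; exact: bound.
Qed.

End Discrete.

(** * Extraction of a limit *)

Section PairLimits.
Variables (I : Type) (F : set_system I) (Y Z : topologicalType).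
Variables (u : I -> Y) (v : I -> Z) (y : Y) (z : Z).
Hypothesis FF : Filter F.

Lemma pair_cvg_fst : (u i, v i) @[i --> F] --> (y, z) -> u @ F --> y.
Proof.
move=> uv A Ay; have : nbhs (y, z) [set p : Y * Z | A p.1] by exact: cvg_fst Ay.
by move=> /uv.
Qed.

Lemma pair_cvg_snd : (u i, v i) @[i --> F] --> (y, z) -> v @ F --> z.
Proof.
move=> uv A Az; have : nbhs (y, z) [set p : Y * Z | A p.2] by exact: cvg_snd Az.
by move=> /uv.
Qed.

End PairLimits.

Section Compactness.
Context {R : realType} {X : metricType R}.
Variables (T : R) (E : R -> X -> R) (omega : R -> X -> X) (c : R -> X -> X -> R) (x0 : X).
Variable delta : nat -> R.
Hypotheses (T0 : 0 < T) (regE : regular_energy T E).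
Hypothesis decE : energy_nonincreasing T E omega.
Hypothesis critW : reaches_critical T E omega.
Hypotheses (actE : is_action T E c) (compE : compatible T E omega c).
Hypotheses (chainE : chain_condition T c) (zeroE : zero_action_iff T E c).
Hypothesis crit0 : slope (E 0) x0 = 0%E.
Hypotheses (delta0 : forall n, 0 < delta n) (delta_cvg : delta n @[n --> \oo] --> 0).

Local Notation h n t := (discrete_evolution T omega x0 (delta n) t).
Local Notation V n t := (jump_sum T E omega x0 (delta n) t).

Variables (K : set X) (C : R).
Hypothesis cK : compact K.
Hypothesis wK : forall n i, (i <= nsteps T (delta n))%N -> K (iterate omega x0 (delta n) i).
Hypothesis VC : forall n t, V n t <= C.

Let hK n t : K (h n t).
Proof. by apply: wK; exact: step_index_le. Qed.

Let V_homo n : {homo (fun t => V n t) : s t / s <= t}.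
Proof. exact: jump_sum_homo. Qed.

Let V_ge0 n t : 0 <= V n t.
Proof.
have [t0|/ltW t0] := leP t 0; first by rewrite jump_sum_le0.
by have := V_homo n t0; rewrite (jump_sum_le0 _ _ _ _ (delta0 n) (lexx 0)).
Qed.

Let C0 : 0 <= C. Proof. exact: le_trans (V_ge0 0%N 0) (VC 0%N 0). Qed.

Let delta_filter (F : set_system nat) : \oo `<=` F -> delta @ F --> 0.
Proof. by move=> ooF; apply: cvg_trans delta_cvg; exact: cvg_app. Qed.

(** [h n t] is critical not at [t] but at the preceding step time, which tends to [t]; the slope is
    jointly continuous. When no step has been made, the state is [x0], critical at time 0. *)
Lemma evolution_crit (F : set_system nat) t y : ProperFilter F -> \oo `<=` F ->
  t \in `[0, T] -> h n t @[n --> F] --> y -> crit (E t) y.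
Proof.
move=> PF ooF tT hy.
pose k n := step_index T (delta n) t.
have kT n : (k n)%:R * delta n \in `[0, T].
  by apply: step_time => //; exact: step_index_le.
apply: (crit_cvg regE (F := F) (s := fun n => (k n)%:R * delta n) (x := fun n => h n t)) => //.
- have /cvgrPdist_le dl := delta_filter ooF.
  apply/cvgrPdist_le => e /dl; apply: filterS => n.
  rewrite sub0r normrN (ger0_norm (ltW (delta0 n))) => dn.
  have /andP[k1 k2] := step_index_itv T0 (delta0 n) tT.
  rewrite ger0_norm ?subr_ge0//; apply: le_trans dn.
  by move: k2; rewrite -natr1 mulrDl mul1r lerBlDl.
- exact: nearW.
- apply: cvg_near_cst; apply: nearW => n; apply/(crit_fine regE); first exact: kT.
  rewrite /crit/= discrete_evolutionE -/(k n).
  by case: (k n) (kT n) => [_|i kTi] /=; [rewrite mul0r|exact: critW].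
Qed.

(** The radius [d] is chosen before the filter, so the estimate serves both for [U] and for
    ultrafilters refining the extracted subsequence. Half of [e] pays for the chain condition, half
    for the convergence of [V]. *)
Lemma limit_action_le t0 e : t0 \in `[0, T] -> 0 < e ->
  exists2 d : R, 0 < d & forall (F : set_system nat) s t y z v v',
    ProperFilter F -> \oo `<=` F -> s \in `[0, T] -> t \in `[0, T] ->
    t0 - d <= s -> s < t -> t <= t0 + d ->
    h n s @[n --> F] --> y -> h n t @[n --> F] --> z ->
    V n s @[n --> F] --> v -> V n t @[n --> F] --> v' -> c t0 y z <= v' - v + e.
Proof.
move=> t0T e0; have e20 : 0 < e / 2 by rewrite divr_gt0.
have C10 : 0 < C + 1 by rewrite ltr_wpDl.
have [d d0 dP] := chainE e20 C10 t0T cK; exists d => //.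
move=> F s t y z v v' PF ooF sT tT ds st td hy hz Vv Vv'.
apply: (action_le_cvg actE _ t0T hy hz).
have dst : 0 < t - s by rewrite subr_gt0.
have VV : V n t - V n s @[n --> F] --> v' - v by exact: cvgB.
near=> n.
have dn : delta n < t - s.
  near: n; have /cvgrPdist_lt/(_ _ dst) := delta_filter ooF.
  by apply: filterS => n; rewrite sub0r normrN gtr0_norm.
(* A time step shorter than [t - s] forces at least one step in []s, t]], hence a chain with at
   least two points. *)
have kst : (step_index T (delta n) s < step_index T (delta n) t)%N.
  rewrite ltnNge; apply/negP => kts.
  have /andP[k1 k2] := step_index_itv T0 (delta0 n) sT.
  have /andP[k3 k4] := step_index_itv T0 (delta0 n) tT.
  have : (step_index T (delta n) t).+1%:R * delta n <= (step_index T (delta n) s).+1%:R * delta n.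
    by rewrite ler_pM2r// ler_nat.
  by move: k1 k4; rewrite -!natr1 !mulrDl !mul1r; lra.
have VCn : V n t - V n s <= C + 1.
  by have := VC n t; have := V_ge0 n s; lra.
have := evolution_chain T0 (delta0 n) compE dP (wK (n := n)) ds (ltW st) td kst VCn.
have : `|(v' - v) - (V n t - V n s)| <= e / 2.
  by near: n; move/cvgrPdist_le : VV; apply.
by rewrite ler_distl => /andP[h1 h2] h3; lra.
Unshelve. all: by end_near. Qed.

(* Ultrafilter limits hl and Vl are made limits of one subsequence on a       *)
(* countable set D containing the jumps of Vl. At a time outside D, the       *)
(* action between any two cluster points is bounded by an increment of Vl     *)
(* that tends to 0, so that they lie in the same critical component.          *)
Lemma evolution_limit : exists (phi : nat -> nat) (hl : R -> X) (Vl : R -> R),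
  [/\ {homo phi : m n / (m < n)%N}, {homo Vl : s t / s <= t},
      forall t, t <= 0 -> Vl t = 0 & forall t, T <= t -> Vl t = Vl T] /\
  [/\ forall t, K (hl t), forall t, t \in `[0, T] -> crit (E t) (hl t),
      forall t, V (phi n) t @[n --> \oo] --> Vl t,
      forall t0 e, t0 \in `[0, T] -> 0 < e -> exists2 d : R, 0 < d &
        forall s t, s \in `[0, T] -> t \in `[0, T] -> t0 - d <= s -> s < t -> t <= t0 + d ->
        c t0 (hl s) (hl t) <= Vl t - Vl s + e &
      forall (G : set_system nat) t y, UltraFilter G -> \oo `<=` G -> t \in `[0, T] ->
        h (phi n) t @[n --> G] --> y -> path_component (R := R) (crit (E t)) y (hl t)].
Proof.
have [U [UU ooU]] := ultraFilterLemma (F := \oo%classic) _.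
have /choice[hl hlP] : forall t : R, exists y : X, K y /\ h n t @[n --> U] --> y.
  move=> t; have [y Ky hy] := compact_ultra_cvg (f := fun n => h n t) UU cK (nearW _ (hK^~ t)).
  by exists y.
have pickV (t : R) : exists v : R, V n t @[n --> U] --> v.
  have VI : \forall n \near U, V n t \in `[0, C].
    by apply: nearW => n; rewrite in_itv/= V_ge0 VC.
  by have [v _ Vv] := compact_ultra_cvg UU (@segment_compact R 0 C) VI; exists v.
have [Vl VlP] := choice pickV.
have Vl_homo : {homo Vl : s t / s <= t}.
  move=> s t st; apply: ler_cvg_to (VlP s) (VlP t) _.
  by apply: nearW => n; exact: V_homo.
have Vl0 t : t <= 0 -> Vl t = 0.
  move=> t0; apply: (cvg_unique _ (VlP t)) => //; apply: cvg_near_cst.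
  by apply: nearW => n; rewrite jump_sum_le0.
have VlT t : T <= t -> Vl t = Vl T.
  move=> tT; apply: (cvg_unique _ (VlP t)) => //; apply: cvg_trans (VlP T).
  by apply: near_eq_cvg; apply: nearW => n; rewrite [RHS]jump_sum_geT.
(* The rationals are added for density: they squeeze [V] and approximate the times off [D]. *)
pose D := [set t | left_value Vl t < right_value Vl t] `|` range (ratr : rat -> R).
have cD : countable D.
  rewrite /D -bigcup2E; apply: bigcup_countable => // -[|[|n]] _ //=.
    exact: jump_countable.
  exact: card_le_trans (card_image_le _ _) (countableP _).
have /countable_injP[f finj] := cD.
have pick k : exists t, forall t', D t' -> f t' = k -> t = t'.
  have [[t [Dt ft]]|nt] := pselect (exists t, D t /\ f t = k).
    exists t => t' Dt' ft'; apply: finj; rewrite ?inE//.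
    by rewrite ft ft'.
  by exists 0 => t' Dt' ft'; exfalso; apply: nt; exists t'.
have [tk tkP] := choice pick.
have [phi hphi phi1] := diagonal_extraction (Y := (R * X)%type)
  (u := fun k n => (V n (tk k), h n (tk k)))
  (l := fun k => (Vl (tk k), hl (tk k))) _ ooU
  (fun k => cvg_pair (F := U) (G := nbhs (Vl (tk k))) (H := nbhs (hl (tk k)))
    (VlP (tk k)) (hlP (tk k)).2).
have VD t : D t -> V (phi n) t @[n --> \oo] --> Vl t.
  move=> Dt; rewrite -(tkP (f t) t Dt erefl).
  exact: pair_cvg_fst (phi1 (f t)).
have hD t : D t -> h (phi n) t @[n --> \oo] --> hl t.
  move=> Dt; rewrite -(tkP (f t) t Dt erefl).
  exact: pair_cvg_snd (phi1 (f t)).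
have DQ (q : rat) : D (ratr q) by right; exists q.
have nD t : ~ D t -> left_value Vl t = Vl t /\ right_value Vl t = Vl t.
  move=> nDt; have : ~~ (left_value Vl t < right_value Vl t).
    by apply/negP => ?; apply: nDt; left.
  rewrite -leNgt => rl; have := left_value_le Vl_homo t; have := right_value_ge Vl_homo t.
  by move=> h1 h2; split; apply/eqP; rewrite eq_le; apply/andP; split;
    rewrite // ?(le_trans h1)// (le_trans rl).
(* Off [D] the limit [Vl] is continuous, and monotonicity squeezes [V (phi n) t] between the values
   at two rationals. *)
have V_cvg t : V (phi n) t @[n --> \oo] --> Vl t.
  have [/VD//|/nD[lt rt]] := pselect (D t).
  apply/cvgrPdist_le => e e0; have e20 : 0 < e / 2 by rewrite divr_gt0.
  have [s1 s1t] := left_value_adherent Vl_homo t e20; rewrite lt => Vs1.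
  have [s2 ts2] := right_value_adherent Vl_homo t e20; rewrite rt => Vs2.
  have [q1] := rat_in_itvoo s1t; have [q2] := rat_in_itvoo ts2.
  rewrite !in_itv/= => /andP[tq2 q2s] /andP[sq1 q1t].
  have Vq1 := Vl_homo _ _ (ltW sq1); have Vq2 := Vl_homo _ _ (ltW q2s).
  near=> n.
  have h1 : `|Vl (ratr q1) - V (phi n) (ratr q1)| <= e / 2.
    by near: n; have /cvgrPdist_le := VD _ (DQ q1); apply.
  have h2 : `|Vl (ratr q2) - V (phi n) (ratr q2)| <= e / 2.
    by near: n; have /cvgrPdist_le := VD _ (DQ q2); apply.
  have h3 := V_homo (phi n) (ltW q1t); have h4 := V_homo (phi n) (ltW tq2).
  by move: h1 h2; rewrite !ler_distl => /andP[? ?] /andP[? ?]; apply/andP; split; lra.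
have hlK t : K (hl t) by have [] := hlP t.
have hlU t : h n t @[n --> U] --> hl t by have [] := hlP t.
have hl_crit t : t \in `[0, T] -> crit (E t) (hl t).
  by move=> tT; exact: (evolution_crit _ ooU tT (hlU t)).
have phioo := subseq_cvg_infty hphi.
exists phi, hl, Vl; split; split => //.
  move=> t0 e t0T e0; have [d d0 dP] := limit_action_le t0T e0; exists d => // s t sT tT ds st td.
  exact: (dP U s t).
move=> G t y GU ooG tT hy.
have Gcv (Y : topologicalType) (u : nat -> Y) (l : Y) : u n @[n --> \oo] --> l -> u n @[n --> G] --> l.
  by apply: cvg_trans; exact: cvg_app.
have cy : crit (E t) y.
  apply: (evolution_crit (F := phi @ G) _ _ tT hy).
  by apply: subset_trans phioo _ => A; exact: ooG.
have [Dt|nDt] := pselect (D t).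
  have -> : y = hl t by apply: (metric_cvg_unique _ hy); apply: Gcv; exact: hD.
  by apply: path_component_refl; exact: hl_crit.
have [lt _] := nD t nDt.
(* As a rational, 0 belongs to [D]; a time off [D] therefore has room on its left. *)
have t0 : 0 < t.
  move: (tT); rewrite in_itv/= => /andP[+ _]; rewrite le_eqVlt => /predU1P[t0|//].
  by exfalso; apply: nDt; rewrite -t0 -(rmorph0 (ratr : {rmorphism rat -> R})); exact: DQ.
have picks (m : nat) : exists s : R, [/\ D s, 0 <= s, s < t & t - m.+1%:R^-1 <= s].
  have : Num.max 0 (t - m.+1%:R^-1) < t by rewrite gt_max t0 gtrBl invr_gt0/=.
  move=> /rat_in_itvoo[q]; rewrite in_itv/= gt_max => /andP[/andP[q0 tq] qt].
  by exists (ratr q); split => //; exact: ltW.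
have [ss ssP] := choice picks.
have ssT m : ss m \in `[0, T].
  have [_ s0 st _] := ssP m; rewrite in_itv/= s0 (le_trans (ltW st))//.
  by move: tT; rewrite in_itv/= => /andP[].
have sst : ss m @[m --> \oo] --> t.
  apply: (@squeeze_cvgr _ _ _ _ (fun m => t - m.+1%:R^-1) (cst t)).
  - by apply: nearW => m; have [_ _ /ltW-> ->] := ssP m.
  - rewrite -[X in _ --> X]subr0; apply: cvgB; first exact: cvg_cst.
    exact: cvg_harmonic.
  - exact: cvg_cst.
have Vss : Vl (ss m) @[m --> \oo] --> Vl t.
  have := (cvg_at_leftP _ _ _).1 (cvg_left_value Vl_homo (t := t)) ss; rewrite lt; apply.
  by split => // m; have [] := ssP m.
have [H [HU ooH]] := ultraFilterLemma (F := \oo%classic) _.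
have [z Kz ssz] := compact_ultra_cvg (f := hl \o ss) HU cK (nearW _ (fun m => hlK (ss m))).
have Hcv (Y : topologicalType) (u : nat -> Y) (l : Y) : u n @[n --> \oo] --> l -> u n @[n --> H] --> l.
  by apply: cvg_trans; exact: cvg_app.
have cz : crit (E t) z.
  apply: (crit_cvg regE _ tT (Hcv _ _ _ sst) (nearW _ ssT) ssz).
  by apply: cvg_near_cst; apply: nearW => m; apply/(crit_fine regE) => //; exact: hl_crit.
(* Any critical point reached from the [hl (ss m)] at a cost tending to 0 lies in the component of
   [z]. Both [y] and [hl t] are such points, so [z] joins them. *)
have link y' : crit (E t) y' ->
    (forall e, 0 < e -> exists2 d : R, 0 < d & forall s, D s -> s \in `[0, T] -> s < t ->
      t - d <= s -> c t (hl s) y' <= Vl t - Vl s + e) ->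
    path_component (R := R) (crit (E t)) z y'.
  move=> cy' cP; apply/zeroE => //; apply/eqP; rewrite eq_le; have [-> _ _] := actE tT.
  rewrite andbT; apply/ler_addgt0Pl => e e0; rewrite addr0.
  have e20 : 0 < e / 2 by rewrite divr_gt0.
  have [d d0 dP] := cP _ e20.
  apply: (action_le_cvg actE (F := H) (x := hl \o ss) (y := fun=> y')) => //.
    exact: cvg_cst.
  apply: ooH; near=> m; have [Ds s0 st _] := ssP m.
  apply: (@le_trans _ _ (Vl t - Vl (ss m) + e / 2)).
    apply: dP => //; near: m; have /cvgrPdist_le/(_ _ d0) := sst.
    by apply: filterS => m; rewrite ler_distl lerBlDr -lerBlDr => /andP[]; lra.
  have : `|Vl t - Vl (ss m)| <= e / 2.
    by near: m; have /cvgrPdist_le := Vss; apply.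
  by move=> /(le_trans (ler_norm _)); lra.
apply: (@path_component_trans _ _ _ _ z).
  apply: path_component_sym; apply: link => // e e0.
  have [d d0 dP] := limit_action_le tT e0; exists d => // s Ds sT st ds.
  (* Since [s] is in [D], the evolutions at [s] have the same limit [hl s] along [G] as along
     [U]. *)
  apply: (dP (phi @ G) s t) => //.
  - by apply: subset_trans phioo _ => A; exact: ooG.
  - by rewrite lerDl ltW.
  - by apply: Gcv; exact: hD.
  - by apply: Gcv; exact: V_cvg.
  - by apply: Gcv; exact: V_cvg.
apply: link; first exact: hl_crit.
move=> e e0; have [d d0 dP] := limit_action_le tT e0; exists d => // s Ds sT st ds.
by apply: (dP U s t) => //; rewrite lerDl ltW.
Unshelve. all: by end_near. Qed.

End Compactness.

(** * The limiting curve *)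

Section LimitCurve.
Context {R : realType} {X : metricType R}.
Variables (T : R) (E : R -> X -> R) (c : R -> X -> X -> R).
Hypotheses (T0 : 0 < T) (regE : regular_energy T E).
Hypothesis lcX : locally_compact [set: X].
Hypotheses (actE : is_action T E c) (chainE : chain_condition T c).
Hypothesis zeroE : zero_action_iff T E c.

Variables (K : set X) (hl : R -> X) (Vl : R -> R).
Hypothesis cK : compact K.
Hypotheses (Vl_homo : {homo Vl : s t / s <= t}) (Vl0 : forall t, t <= 0 -> Vl t = 0).
Hypothesis VlT : forall t, T <= t -> Vl t = Vl T.
Hypotheses (hlK : forall t, K (hl t)) (hl_crit : forall t, t \in `[0, T] -> crit (E t) (hl t)).
Hypothesis action_V : forall t0 e, t0 \in `[0, T] -> 0 < e -> exists2 d : R, 0 < d &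
  forall s t, s \in `[0, T] -> t \in `[0, T] -> t0 - d <= s -> s < t -> t <= t0 + d ->
  c t0 (hl s) (hl t) <= Vl t - Vl s + e.

Local Notation time := (`[0, T]%classic : set R).

Lemma time0_proof : 0 \in `[0, T]%classic.
Proof. by rewrite inE/= in_itv/= lexx ltW. Qed.

(* Junk outside [0, T]. *)
Definition time_of (t : R) : time :=
  insubd (exist (fun x => x \in `[0, T]%classic) 0 time0_proof) t.

Lemma val_time_of t : t \in `[0, T] -> \val (time_of t) = t.
Proof. by move=> tT; apply: insubdK; rewrite inE. Qed.

Lemma time_ofK (t : time) : time_of (\val t) = t.
Proof. by apply: val_inj; rewrite val_time_of// time_val. Qed.

Definition limit_curve (t : R) : state_space T E := state E (time_of t) (hl t).

(* The limits exist along ultrafilters refining the one-sided neighbourhoods  *)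
(* of t. Along these, hl may have several limits, but they all lie in one     *)
(* critical component.                                                        *)
Definition approach (t : R) (F : set_system R) (z : X) (v : R) :=
  [/\ ProperFilter F, id @ F --> t, \forall s \near F, s \in `[0, T],
      hl @ F --> z & Vl @ F --> v].

(** The two limits are taken one after the other, with lower semicontinuity used for each. Both
    nestings occur: for two filters on the left of [t] the outer variable is the earlier one, on the
    right it is the later one. *)
Lemma approach_action t F F' z z' v v' : t \in `[0, T] ->
  approach t F z v -> approach t F' z' v' ->
  (\forall s \near F, \forall s' \near F', s < s') \/
  (\forall s' \near F', \forall s \near F, s < s') ->
  c t z z' <= v' - v.
Proof.
move=> tT [PF Ft FT hz Vv] [PF' Ft' FT' hz' Vv'] FF'.
apply/ler_addgt0Pl => e e0; have e30 : 0 < e / 3 by rewrite divr_gt0.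
have [d d0 dP] := action_V tT e30.
have dF (G : set_system R) : Filter G -> id @ G --> t -> \forall s \near G, t - d <= s <= t + d.
  by move=> FG /cvgrPdist_le/(_ _ d0); apply: filterS => s; rewrite distrC ler_distl.
have vF : \forall s \near F, v - e / 3 <= Vl s.
  by have /cvgrPdist_le/(_ _ e30) := Vv; apply: filterS => s; rewrite distrC ler_distl => /andP[].
have vF' : \forall s \near F', Vl s <= v' + e / 3.
  by have /cvgrPdist_le/(_ _ e30) := Vv'; apply: filterS => s; rewrite distrC ler_distl => /andP[].
have dF1 : \forall s \near F, t - d <= s <= t + d by exact: dF.
have dF1' : \forall s \near F', t - d <= s <= t + d by exact: dF.
case: FF' => FF'.
- apply: (action_le_cvg actE (F := F) (x := hl) (y := fun=> z')) => //; first exact: cvg_cst.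
  near=> s; apply: (action_le_cvg actE (F := F') (x := fun=> hl s) (y := hl)) => //.
    exact: cvg_cst.
  have sT : s \in `[0, T] by near: s.
  have Vs : v - e / 3 <= Vl s by near: s.
  have /andP[ds _] : t - d <= s <= t + d by near: s.
  have FFs : \forall s' \near F', s < s' by near: s.
  near=> s'.
  have s'T : s' \in `[0, T] by near: s'.
  have Vs' : Vl s' <= v' + e / 3 by near: s'.
  have /andP[_ ds'] : t - d <= s' <= t + d by near: s'.
  have ss' : s < s' by near: s'.
  by apply: le_trans (dP s s' sT s'T ds ss' ds') _; lra.
- apply: (action_le_cvg actE (F := F') (x := fun=> z) (y := hl)) => //; first exact: cvg_cst.
  near=> s'; apply: (action_le_cvg actE (F := F) (x := hl) (y := fun=> hl s')) => //.
    exact: cvg_cst.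
  have s'T : s' \in `[0, T] by near: s'.
  have Vs' : Vl s' <= v' + e / 3 by near: s'.
  have /andP[_ ds'] : t - d <= s' <= t + d by near: s'.
  have FFs : \forall s \near F, s < s' by near: s'.
  near=> s.
  have sT : s \in `[0, T] by near: s.
  have Vs : v - e / 3 <= Vl s by near: s.
  have /andP[ds _] : t - d <= s <= t + d by near: s.
  have ss' : s < s' by near: s.
  by apply: le_trans (dP s s' sT s'T ds ss' ds') _; lra.
Unshelve. all: by end_near. Qed.

Lemma approach_crit t F z v : t \in `[0, T] -> approach t F z v -> crit (E t) z.
Proof.
move=> tT [PF Ft FT hz _]; apply: (crit_cvg regE (F := F) (s := id) (x := hl)) => //.
by apply: cvg_near_cst; apply: filterS FT => s sT; apply/(crit_fine regE) => //; exact: hl_crit.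
Qed.

(** The principal filter puts the value at [t] on the same footing as the one-sided limits. *)
Lemma approach_cst t : t \in `[0, T] -> approach t (principal_filter t) (hl t) (Vl t).
Proof.
move=> tT; split.
- by apply: ultra_proper; exact: principal_filter_ultra.
- by move=> A /nbhs_singleton At; exact/principal_filterP.
- exact/principal_filterP.
- by move=> A /nbhs_singleton At; exact/principal_filterP.
- by move=> A /nbhs_singleton At; exact/principal_filterP.
Qed.

(** Equal limits of [Vl] force the action between the limits of [hl] to vanish. *)
Lemma approach_path t F F' z z' v : t \in `[0, T] ->
  approach t F z v -> approach t F' z' v ->
  (\forall s \near F, \forall s' \near F', s < s') \/
  (\forall s' \near F', \forall s \near F, s < s') ->
  path_component (R := R) (crit (E t)) z z'.
Proof.
move=> tT a a' o; apply/zeroE => //; [exact: approach_crit a|exact: approach_crit a'|].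
apply/eqP; rewrite eq_le; have [-> _ _] := actE tT; rewrite andbT.
by have := approach_action tT a a' o; rewrite subrr.
Qed.

Lemma approach_left (G : set_system R) t y : t \in `[0, T] -> 0 < t -> ProperFilter G ->
  t^'- `<=` G -> hl @ G --> y ->
  approach t G y (left_value Vl t) /\ \forall s \near G, s < t.
Proof.
move=> tT t0 PG tG hy; split; last by apply: tG; exact: nbhs_left_lt.
split => //.
- by move=> A At; apply: tG; exact: cvg_within At.
- apply: tG; near=> s; rewrite in_itv/=; apply/andP; split.
    by near: s; exact: nbhs_left_ge.
  by move: tT; rewrite in_itv/= => /andP[_]; apply: le_trans; near: s; exact: nbhs_left_le.
- by apply: cvg_trans (cvg_app _ tG) _; exact: cvg_left_value.
Unshelve. all: by end_near. Qed.

Lemma approach_right (G : set_system R) t y : t \in `[0, T] -> t < T -> ProperFilter G ->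
  t^'+ `<=` G -> hl @ G --> y ->
  approach t G y (right_value Vl t) /\ \forall s \near G, t < s.
Proof.
move=> tT t0 PG tG hy; split; last by apply: tG; exact: nbhs_right_gt.
split => //.
- by move=> A At; apply: tG; exact: cvg_within At.
- apply: tG; near=> s; rewrite in_itv/=; apply/andP; split.
    by move: tT; rewrite in_itv/= => /andP[+ _] => /le_trans; apply; near: s; exact: nbhs_right_ge.
  by near: s; exact: nbhs_right_le.
- by apply: cvg_trans (cvg_app _ tG) _; exact: cvg_right_value.
Unshelve. all: by end_near. Qed.

Lemma limit_curve_cvg (D : set_system R) t z : Filter D -> t \in `[0, T] ->
  id @ D --> t -> (\forall s \near D, s \in `[0, T]) ->
  (forall (G : set_system R) y, UltraFilter G -> D `<=` G -> hl @ G --> y ->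
    path_component (R := R) (crit (E t)) y z) ->
  limit_curve @ D --> state E (time_of t) z.
Proof.
move=> FD tT Dt DT Dz.
apply: (@state_cvg _ _ T E _ D (fun s => (time_of s, hl s)) (time_of t) z K) => //.
- exact: nearW.
- rewrite /= val_time_of//; apply: cvg_trans Dt; apply: near_eq_cvg.
  by apply: filterS DT => s sT; rewrite val_time_of.
- by move=> G y GU DG Gy; apply/asboolP; right; split=> //=; rewrite val_time_of//; exact: Dz Gy.
Qed.

(** An ultrafilter on the given side provides [z], and by [approach_path] every limit point of [hl]
    on that side lies in the component of [z]. Uniqueness needs its own argument because the
    quotient is not known to be Hausdorff. *)
Lemma side_limit t (P : set R) v : t \in `[0, T] ->
  ProperFilter (within P (nbhs t)) ->
  (\forall s \near within P (nbhs t), s \in `[0, T]) ->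
  Vl s @[s --> within P (nbhs t)] --> v ->
  (\forall s \near within P (nbhs t), \forall s' \near within P (nbhs t), s < s') \/
  (\forall s' \near within P (nbhs t), \forall s \near within P (nbhs t), s < s') ->
  exists z (F : set_system R), [/\ approach t F z v, within P (nbhs t) `<=` F &
    unique (fun l => limit_curve s @[s --> within P (nbhs t)] --> l)
      (state E (time_of t) z)].
Proof.
set D := within P (nbhs t) => tT PD DT DV Dord.
have [U [UU DU]] := ultraFilterLemma PD.
have [z Kz hz] := compact_ultra_cvg UU cK (nearW _ hlK).
have Dt : id @ D --> t by exact: cvg_within.
have appr (G : set_system R) y : ProperFilter G -> D `<=` G -> hl @ G --> y -> approach t G y v.
  move=> PG DG hy; split => //.
  - exact: cvg_trans (cvg_app _ DG) Dt.
  - exact: DG.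
  - exact: cvg_trans (cvg_app _ DG) DV.
have PU : ProperFilter U by exact: ultra_proper.
have aU := appr U z PU DU hz.
exists z, U; split => //; split.
  apply: (limit_curve_cvg _ tT Dt DT) => G y GU DG hy.
  apply: (approach_path tT (appr G y (@ultra_proper _ _ GU) DG hy) aU).
  by case: Dord => h; [left|right];
    [apply: DG; apply: filterS h => s|apply: DU; apply: filterS h => s]; [exact: DU|exact: DG].
move=> l Dl.
(* [state_limit_unique] works with a sequence of times along which the representatives converge in
   [X]; it is drawn from the ultrafilter [U]. *)
have pick (m : nat) : exists s : R, [/\ P s, s \in `[0, T], `|t - s| <= m.+1%:R^-1 &
    mdist z (hl s) <= m.+1%:R^-1].
  have e0 : 0 < m.+1%:R^-1 :> R by rewrite invr_gt0.
  have h1 : \forall s \near U, P s by apply: DU; exact: withinT.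
  have h2 : \forall s \near U, s \in `[0, T] by exact: DU.
  have h3 : \forall s \near U, `|t - s| <= m.+1%:R^-1.
    by apply: DU; have /cvgrPdist_le := Dt; apply.
  have h4 : \forall s \near U, mdist z (hl s) <= m.+1%:R^-1.
    have : nbhs z [set y | mdist z y <= m.+1%:R^-1].
      apply: filterS (nbhsx_ballx z _ e0) => y; rewrite /= ballEmdist; exact: ltW.
    by move=> /hz.
  have [s [[ps sT] [st hs]]] := filter_ex (filterI (filterI h1 h2) (filterI h3 h4)).
  by exists s.
have [ss ssP] := choice pick.
have sst : ss m @[m --> \oo] --> t.
  apply/cvgrPdist_le => e e0; have /cvgrPdist_le/(_ _ e0) := @cvg_harmonic R.
  apply: filterS => m; rewrite sub0r normrN ger0_norm ?harmonic_ge0//.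
  by have [_ _ + _] := ssP m; exact: le_trans.
have ssz : hl (ss m) @[m --> \oo] --> z.
  apply/metricType_numDomainType.cvgrPdist_le => e e0.
  have /cvgrPdist_le/(_ _ e0) := @cvg_harmonic R.
  apply: filterS => m; rewrite sub0r normrN ger0_norm ?harmonic_ge0//.
  by have [_ _ _] := ssP m; exact: le_trans.
have ssD : ss @ \oo --> D.
  move=> A DA; have {}DA : nbhs t [set s | P s -> A s] by [].
  have := sst _ DA; rewrite /= !nbhs_simpl/=; apply: filterS => m; apply.
  by have [] := ssP m.
apply/esym; apply: (@state_limit_unique _ _ _ _ regE lcX c actE chainE zeroE
  (fun m => (time_of (ss m), hl (ss m))) (time_of t, z)).
  apply: state_cvg_pair => //=; rewrite val_time_of//; apply: cvg_trans sst.
  by apply: near_eq_cvg; apply: nearW => m; rewrite val_time_of//; have [] := ssP m.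
exact: (cvg_comp _ _ ssD Dl).
Qed.

(** The order clauses let [limit_jump] separate the filters of the two sides even at an endpoint,
    where the convention makes one of them principal. *)
Lemma left_approach t : t \in `[0, T] -> exists z (F : set_system R),
  [/\ approach t F z (left_value Vl t), \forall s \near F, s <= t,
      0 < t -> \forall s \near F, s < t &
      unique (left_limit limit_curve t) (state E (time_of t) z)].
Proof.
move=> tT; rewrite /left_limit; have [t0|t0] := eqVneq t 0.
  have -> : left_value Vl t = Vl t.
    have := left_value_ge Vl_homo (ltrN10 R); have := left_value_le Vl_homo 0.
    by rewrite t0 (Vl0 (lexx 0)) (Vl0 (lerN10 R)) => h1 h2; apply/eqP; rewrite eq_le h1.
  exists (hl t), (principal_filter t); split; [exact: approach_cst|exact/principal_filterP| |].
  - by rewrite t0 ltxx.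
  - by split.
have {}t0 : 0 < t by move: tT; rewrite in_itv/= lt_def t0 => /andP[].
have [|||z [F [aF DF uF]]] := side_limit (P := [set s | s < t]) tT _ _
  (cvg_left_value Vl_homo (t := t)) _.
- exact: at_left_proper_filter.
- near=> s; rewrite in_itv/=; apply/andP; split.
    by near: s; exact: nbhs_left_ge.
  by move: tT; rewrite in_itv/= => /andP[_]; apply: le_trans; near: s; exact: nbhs_left_le.
- left; near=> s; apply: nbhs_left_gt; near: s; exact: nbhs_left_lt.
exists z, F; split => //.
  by apply: DF; exact: nbhs_left_le.
by move=> _; apply: DF; exact: nbhs_left_lt.
Unshelve. all: by end_near. Qed.

Lemma right_approach t : t \in `[0, T] -> exists z (F : set_system R),
  [/\ approach t F z (right_value Vl t), \forall s \near F, t <= s,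
      t < T -> \forall s \near F, t < s &
      unique (right_limit T limit_curve t) (state E (time_of t) z)].
Proof.
move=> tT; rewrite /right_limit; have [t0|t0] := eqVneq t T.
  have -> : right_value Vl t = Vl t.
    apply/eqP; rewrite t0 eq_le right_value_ge// andbT.
    have TT1 : T < T + 1 by rewrite ltrDl.
    by rewrite -(VlT (ltW TT1)) right_value_le.
  exists (hl t), (principal_filter t); split; [exact: approach_cst|exact/principal_filterP| |].
  - by rewrite t0 ltxx.
  - by split.
have {}t0 : t < T by move: tT; rewrite in_itv/= lt_neqAle t0 => /andP[].
have [|||z [F [aF DF uF]]] := side_limit (P := [set s | t < s]) tT _ _
  (cvg_right_value Vl_homo (t := t)) _.
- exact: at_right_proper_filter.
- near=> s; rewrite in_itv/=; apply/andP; split.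
    by move: tT; rewrite in_itv/= => /andP[+ _] => /le_trans; apply; near: s; exact: nbhs_right_ge.
  by near: s; exact: nbhs_right_le.
- right; near=> s; apply: nbhs_right_lt; near: s; exact: nbhs_right_gt.
exists z, F; split => //.
  by apply: DF; exact: nbhs_right_ge.
by move=> _; apply: DF; exact: nbhs_right_gt.
Unshelve. all: by end_near. Qed.

(* The chain condition for the four points x, x', y', y, all at time t. *)
Lemma action_component t x y x' y' : t \in `[0, T] ->
  path_component (R := R) (crit (E t)) x x' -> path_component (R := R) (crit (E t)) y y' ->
  c t x y <= c t x' y'.
Proof.
move=> tT xx' yy'; have [cx cx'] := path_component_endpoints xx'.
have [cy cy'] := path_component_endpoints yy'.
have cxx' : c t x x' = 0 by apply/zeroE.
have cy'y : c t y' y = 0 by apply/zeroE => //; exact: path_component_sym.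
apply/ler_addgt0Pl => e e0; have [c0 _ _] := actE tT.
pose f := nth x [:: x; x; x'; y'; y].
have C0 : 0 < c t x' y' + 1 by rewrite ltr_wpDl.
have cK4 : compact [set x; x'; y'; y].
  by apply/compactU/compact_set1; apply/compactU/compact_set1; apply/compactU; exact: compact_set1.
have [d d0 dP] := chainE e0 C0 tT cK4.
have sumE : \sum_(1 <= i < 4) c t (f i) (f i.+1) = c t x' y'.
  by rewrite big_ltn// big_ltn// big_nat1 /f/= cxx' cy'y add0r addr0.
have fK i : (1 <= i <= 4)%N ->
    [/\ [set x; x'; y'; y] (f i), t \in `[t - d, t + d] & t \in `[0, T]].
  move=> /andP[i0 i4]; split=> //; last by rewrite in_itv/= lerBlDr lerDl ltW.
  by move: i0 i4; case: i => [//|[|[|[|[|//]]]]] _ _; rewrite /f/=;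
    [do 3 left|do 2 left; right|left; right|right].
by have := dP 4%N f (fun=> t) isT fK; rewrite sumE lerDl ler01 addrC => /(_ isT).
Qed.

Lemma action_hat_state (t : time) x y : crit (E (\val t)) x -> crit (E (\val t)) y ->
  action_hat c (\val t) (state E t x) (state E t y) = c (\val t) x y.
Proof.
have h z : crit (E (\val t)) z ->
    path_component (R := R) (crit (E (\val t))) (repr (state E t z)).2 z.
  move=> cz; have /asboolP[->|[/= e pp]] := repr_state E t z.
    exact: path_component_refl.
  by rewrite e in pp.
move=> cx cy; apply/eqP; rewrite eq_le !action_component ?time_val//; by
  [exact: h|exact: path_component_sym (h _ _)].
Qed.

(** * Energy balance and jumps of the limiting curve *)

Variables (x0 : X) (B : R).
Hypothesis intP : lebesgue_measure.-integrable `[0, T] (EFin \o (fun s => power T E s (hl s))).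
Hypothesis powB : forall s, s \in `[0, T] -> `|power T E s (hl s)| <= B.

Definition work t := \int[lebesgue_measure]_(s in `[0, t]) power T E s (hl s).

Hypothesis energyI : forall t, t \in `[0, T] -> E t (hl t) + Vl t = E 0 x0 + work t.

Lemma integrable_power (s t : R) : 0 <= s -> t <= T ->
  lebesgue_measure.-integrable `[s, t] (EFin \o (fun s => power T E s (hl s))).
Proof.
move=> s0 tT; apply: integrableS intP => // r /=; rewrite !in_itv/= => /andP[sr rt].
by rewrite (le_trans s0) ?(le_trans rt).
Qed.

Lemma workB s t : 0 <= s -> s <= t -> t <= T ->
  work t - work s = \int[lebesgue_measure]_(r in `[s, t]) power T E r (hl r).
Proof.
move=> s0 st tT; have i0t := integrable_power (lexx 0) tT.
rewrite /work (@Rintegral_itvB _ _ (BLeft 0) (BRight t) s)//.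
rewrite Rintegral_itv_obnd_cbnd//.
apply: integrableS (integrable_power s0 tT) => //.
by apply: subset_itv; rewrite bnd_simp.
Qed.

Lemma work_lipschitz s t : s \in `[0, T] -> t \in `[0, T] -> `|work t - work s| <= B * `|t - s|.
Proof.
wlog st : s t / s <= t.
  by move=> h; have [/h//|/ltW/h{}h sT tT] := leP s t; rewrite distrC (distrC t) h.
rewrite !in_itv/= => /andP[s0 _] /andP[_ tT]; rewrite workB// [`|t - s|]ger0_norm ?subr_ge0//.
have intst := integrable_power s0 tT.
apply: le_trans (le_normr_Rintegral _ intst) _; first exact: measurable_itv.
apply: Rintegral_itv_le => //; first exact: integrable_abse intst.
by move=> r; rewrite in_itv/= => /andP[sr rt]; apply: powB;
  rewrite in_itv/= (le_trans s0)// (le_trans rt).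
Qed.

(** The energy identity at the times of [F] passes to the limit, the work being Lipschitz in
    time. *)
Lemma approach_energy t F z v : t \in `[0, T] -> approach t F z v ->
  E t z = E 0 x0 + work t - v.
Proof.
move=> tT [PF Ft FT hz Vv].
have h1 : E s (hl s) @[s --> F] --> E t z by exact: (energy_cvg regE).
apply: (cvg_unique _ h1) => //.
apply: (@cvg_trans _ (E 0 x0 + work s - Vl s @[s --> F])).
  apply: near_eq_cvg; apply: filterS FT => s sT; have := energyI sT; rewrite -energyI//.
  by rewrite addrK.
apply: cvgB => //; apply: cvgD; first exact: cvg_cst.
have B0 : 0 < `|B| + 1 by rewrite ltr_wpDl.
apply/cvgrPdist_le => e e0; near=> s.
have sT : s \in `[0, T] by near: s.
have st : `|t - s| <= e / (`|B| + 1).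
  by near: s; have /cvgrPdist_le := Ft; apply; rewrite divr_gt0.
apply: le_trans (work_lipschitz sT tT) _.
apply: (@le_trans _ _ ((`|B| + 1) * `|t - s|)).
  by rewrite ler_wpM2r// (le_trans (ler_norm _))// lerDl.
by rewrite mulrC -ler_pdivlMr.
Unshelve. all: by end_near. Qed.

Lemma limit_jump t l l' : t \in `[0, T] ->
  unique (left_limit limit_curve t) l -> unique (right_limit T limit_curve t) l' ->
  action_hat c t l l' = right_value Vl t - left_value Vl t.
Proof.
move=> tT [ll _] [rl _].
have [z [F [aF Ft Fst [_ ul]]]] := left_approach tT.
have [z' [F' [aF' Ft' Fst' [_ ul']]]] := right_approach tT.
have [PF _ _ _ _] := aF; have [PF' _ _ _ _] := aF'.
rewrite -(ul _ ll) -(ul' _ rl) -{1}(val_time_of tT) action_hat_state; last 2 first.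
- by rewrite val_time_of//; exact: approach_crit aF.
- by rewrite val_time_of//; exact: approach_crit aF'.
rewrite val_time_of//; apply/eqP; rewrite eq_le; apply/andP; split.
  apply: (approach_action tT aF aF'); left.
  (* One side is always strict: the left one when [0 < t], the right one at [t = 0]. *)
  have [t0|t0] := ltP 0 t.
    move: (Fst t0); apply: filterS => s st; move: Ft'; apply: filterS => s'; exact: lt_le_trans.
  have tT' : t < T by exact: le_lt_trans T0.
  move: Ft; apply: filterS => s st; move: (Fst' tT'); apply: filterS => s'; exact: le_lt_trans.
have [_ _ /(_ z z')] := actE tT.
by rewrite (approach_energy tT aF) (approach_energy tT aF'); apply: le_trans; lra.
Qed.

(** An ultrafilter near [t] lives on the left of [t], on its right, or at [t] itself; off the jumps
    [Vl] tends to [Vl t] in each case. *)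
Lemma limit_curve_continuous t : t \in `[0, T] -> left_value Vl t = right_value Vl t ->
  limit_curve s @[s --> within `[0, T] (nbhs t)] --> limit_curve t.
Proof.
move=> tT lr.
have lV : left_value Vl t = Vl t.
  by apply/eqP; rewrite eq_le left_value_le//= lr right_value_ge.
have rV : right_value Vl t = Vl t by rewrite -lr.
have DT : \forall s \near within `[0, T] (nbhs t), s \in `[0, T] by exact: withinT.
apply: (limit_curve_cvg _ tT _ DT); first exact: cvg_within.
move=> G y GU DG hy.
have GN (P A : set R) : G P -> within P (nbhs t) A -> G A.
  move=> GP wA; have {}wA : nbhs t [set s | P s -> A s] by [].
  have {wA}: G [set s | P s -> A s] by apply: DG; exact: cvg_within wA.
  by move: GP; apply: filterS2 => s Ps; exact.
have GT : \forall s \near G, s \in `[0, T] by exact: DG.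
have ac := approach_cst tT.
have [Gl|Gr] := in_ultra_setVsetC [set s | s < t] GU.
  have [s [/= st]] := filter_ex (filterI Gl GT); rewrite in_itv/= => /andP[s0 _].
  have [] := approach_left tT (le_lt_trans s0 st) _ (GN _ ^~ Gl) hy.
  rewrite lV => aG Gt; apply: (approach_path tT aG ac); left.
  by apply: filterS Gt => r rt; exact/principal_filterP.
have [{}Gr|Gl] := in_ultra_setVsetC [set s | t < s] GU.
  have [s [/= st]] := filter_ex (filterI Gr GT); rewrite in_itv/= => /andP[_ sT].
  have [] := approach_right tT (lt_le_trans st sT) _ (GN _ ^~ Gr) hy.
  rewrite rV => aG Gt; apply: path_component_sym; apply: (approach_path tT ac aG); left.
  by apply/principal_filterP.
have -> : y = hl t.
  apply: (metric_cvg_unique _ hy); apply: cvg_near_cst.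
  move: Gr Gl; apply: filterS2 => s /= /negP st /negP ts.
  by congr hl; apply/eqP; rewrite eq_le !leNgt st ts.
by apply: path_component_refl; exact: hl_crit.
Qed.

Lemma work_right_le t p : 0 <= t -> t < T -> power T E t (hl t) <= p ->
  (\forall s \near t^'+, power T E s (hl s) <= p) ->
  \forall s \near t^'+, work s - work t <= p * (s - t).
Proof.
move=> t0 tT pt pP.
have {}pP : nbhs t [set s | t < s -> power T E s (hl s) <= p] by [].
have [d /= d0 dP] := (nbhs_ballP _ _).1 pP.
near=> s.
have ts : t < s by near: s; exact: nbhs_right_gt.
have sT : s <= T by near: s; exact: nbhs_right_le.
have std : s < t + d by near: s; apply: nbhs_right_lt; rewrite ltrDl.
rewrite workB ?(ltW ts)//.
apply: Rintegral_itv_le; [exact: ltW|exact: integrable_power|].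
move=> r; rewrite in_itv/= le_eqVlt => /andP[/predU1P[<-//|tr] rs].
by apply: dP => //; rewrite /ball/= ltr_distlC; apply/andP; split; lra.
Unshelve. all: by end_near. Qed.

(** * Vanishing of the right derivative off the jumps *)

Hypotheses (ineqE : critical_inequality T E) (lipE : slope_lipschitz_in_time T E).
Hypothesis powE : power_lifts T E.

(* By the energy identity the increment of Vl is the work minus the energy    *)
(* increment. The work is power * (s - t) up to o(s - t); the energy          *)
(* increment is at least that, because the critical inequality at time t      *)
(* bounds E t (hl s) - E t (hl t) below by o(1) * slope (E t) (hl s), and     *)
(* this slope is O(s - t) since hl s is critical at time s.                   *)
Lemma right_derivative_eq0 t e : 0 <= t -> t < T -> left_value Vl t = right_value Vl t ->
  0 < e -> \forall s \near t^'+, Vl s - Vl t <= e * (s - t).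
Proof.
move=> t0 tT lr e0; have e30 : 0 < e / 3 by rewrite divr_gt0.
have tI : t \in `[0, T] by rewrite in_itv/= t0 ltW.
have rV : right_value Vl t = Vl t.
  by apply/eqP; rewrite eq_le right_value_ge// -lr left_value_le.
(* [hl] may have several limits from the right, but all lie in the component of [hl t], where the
   power takes a single value. *)
have lim_right (G : set_system R) : UltraFilter G -> t^'+ `<=` G ->
    exists y, [/\ approach t G y (Vl t), \forall s \near G, t < s,
      crit (E t) y & power T E t y = power T E t (hl t)].
  move=> GU tG; have [y Ky hy] := compact_ultra_cvg GU cK (nearW _ hlK).
  have [] := approach_right tI tT _ tG hy; rewrite rV => aG Gt.
  exists y; split => //; first exact: approach_crit aG.
  have pp : path_component (R := R) (crit (E t)) (hl t) y.
    apply: (approach_path tI (approach_cst tI) aG); left.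
    exact/principal_filterP.
  have := powE.1 (time_of t) y (hl t); rewrite val_time_of//; apply; apply/esym.
  apply: (@state_eqP _ _ T E (time_of t, hl t) (time_of t, y)).2.
  by apply/asboolP; right; split; rewrite //= val_time_of.
have workP : \forall s \near t^'+, work s - work t <= (power T E t (hl t) + e / 3) * (s - t).
  apply: work_right_le => //; first by rewrite lerDl ltW.
  apply: near_ultra => G GU tG; have [y [[PG Gt GT hy _] _ _ py]] := lim_right G GU tG.
  have /cvgrPdist_le/(_ _ e30) : power T E s (hl s) @[s --> G] --> power T E t y.
    exact: (power_cvg regE).
  by apply: filterS => s; rewrite py distrC ler_distl => /andP[].
have mvt (s : R) : exists r : R, t < s -> s <= T ->
    t < r /\ r < s /\ E s (hl s) - E t (hl s) = power T E r (hl s) * (s - t).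
  have [ts|st] := ltP t s; last by exists 0.
  have [sT|Ts] := leP s T; last by exists 0.
  have [r + rE] := energy_MVT regE (hl s) t0 ts sT.
  by rewrite in_itv/= => /andP[tr rs]; exists r.
have [r rP] := choice mvt.
(* The increment is split at [E t (hl s)]: the mean value theorem in time and the critical
   inequality in space cost [e / 3] each; the remaining third is spent in [workP]. *)
have incrP : \forall s \near t^'+, (power T E t (hl t) - e / 3 - e / 3) * (s - t) <=
    E s (hl s) - E t (hl t).
  apply: near_ultra => G GU tG; have [y [aG Gt cy py]] := lim_right G GU tG.
  have [PG Gid GT hy _] := aG.
  have [U [eps [Uy eps0 eps00 epscvg Uineq]]] := ineqE tI cy.
  have [W [k [Wy lip]]] := lipE y.
  (* The critical inequality is applied at [y], the limit of [hl s] along [G], which may differ from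
     [hl t] but has the same energy. *)
  have Ety : E t y = E t (hl t).
    by rewrite (approach_energy tI aG) (approach_energy tI (approach_cst tI)).
  have k0 : 0 < `|k| + 1 by rewrite ltr_wpDl.
  have epsP : \forall s \near G, eps (mdist y (hl s)) <= e / 3 / (`|k| + 1).
    have ek0 : 0 < e / 3 / (`|k| + 1) by rewrite divr_gt0.
    have h1 : nbhs (0 : R) [set u | 0 < u -> eps u <= e / 3 / (`|k| + 1)].
      have /cvgrPdist_le/(_ _ ek0) H := epscvg.
      have {}H : nbhs (0 : R) [set u | 0 < u -> `|0 - eps u| <= e / 3 / (`|k| + 1)] by [].
      apply: filterS H => u h u0.
      by have := h u0; rewrite sub0r normrN; exact: le_trans (ler_norm _).
    have [d /= d0 dP] := (nbhs_ballP _ _).1 h1.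
    have /metricType_numDomainType.cvgrPdist_lt/(_ _ d0) := hy.
    apply: filterS => s sd; have := mdist_ge0 y (hl s).
    rewrite le_eqVlt => /predU1P[<-|m0]; first by rewrite eps00 ltW.
    by apply: dP => //; rewrite /ball/= sub0r normrN gtr0_norm.
  have rT : \forall s \near G, r s \in `[0, T].
    move: GT Gt; apply: filterS2 => s; rewrite in_itv/= => /andP[_ sT] ts.
    have [tr [rs _]] := rP _ ts sT.
    by rewrite in_itv/= (le_trans t0 (ltW tr)) (le_trans (ltW rs)).
  have rt : r s @[s --> G] --> t.
    apply/cvgrPdist_le => e' e'0; have /cvgrPdist_le/(_ _ e'0) := Gid.
    move: GT Gt; apply: filterS3 => s; rewrite in_itv/= => /andP[_ sT] ts.
    have [tr [rs _]] := rP _ ts sT.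
    by rewrite !ler_distl => /andP[h1 h2]; apply/andP; split; lra.
  have powP : \forall s \near G, power T E t (hl t) - e / 3 <= power T E (r s) (hl s).
    have /cvgrPdist_le/(_ _ e30) : power T E (r s) (hl s) @[s --> G] --> power T E t y.
      exact: (power_cvg regE).
    by apply: filterS => s; rewrite py distrC ler_distl => /andP[].
  have UG : \forall s \near G, U (hl s) by exact: hy.
  have WG : \forall s \near G, W (hl s) by exact: hy.
  near=> s.
  have ts : t < s by near: s.
  have sT : s \in `[0, T] by near: s.
  have [_ [_ rE]] : t < r s /\ r s < s /\ E s (hl s) - E t (hl s) = power T E (r s) (hl s) * (s - t).
    by apply: rP => //; move: sT; rewrite in_itv/= => /andP[].
  have st0 : 0 < s - t by rewrite subr_gt0.
  have h1 : (power T E t (hl t) - e / 3) * (s - t) <= E s (hl s) - E t (hl s).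
    by rewrite rE ler_pM2r//; near: s.
  have h2 : - (e / 3) * (s - t) <= E t (hl s) - E t (hl t).
    rewrite -Ety; have Us : U (hl s) by near: s.
    apply: le_trans (Uineq _ Us).
    rewrite !mulNr lerN2.
    have Ws : W (hl s) by near: s.
    have slope0 : fine (slope (E s) (hl s)) = 0 by apply/(crit_fine regE) => //; exact: hl_crit.
    have := lip (hl s) t s Ws tI sT; rewrite slope0 subr0 distrC (gtr0_norm st0) => sl.
    have es : eps (mdist y (hl s)) <= e / 3 / (`|k| + 1) by near: s.
    have sl' : fine (slope (E t) (hl s)) <= (`|k| + 1) * (s - t).
      apply: (le_trans (ler_norm _)); apply: (le_trans sl); rewrite ler_pM2r//.
      by rewrite (le_trans (ler_norm _))// lerDl.
    have ep : 0 <= eps (mdist y (hl s)) by apply: eps0; exact: mdist_ge0.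
    apply: le_trans (ler_wpM2l ep sl') _.
    rewrite mulrA ler_pM2r//; apply: le_trans (ler_wpM2r (ltW k0) es) _.
    by rewrite divfK// gt_eqF.
  by move: h1 h2; rewrite !mulrBl mulNr; lra.
near=> s.
have ts : t < s by near: s; exact: nbhs_right_gt.
have sT : s \in `[0, T].
  rewrite in_itv/= (le_trans t0 (ltW ts))/=; near: s; exact: nbhs_right_le.
have h1 : work s - work t <= (power T E t (hl t) + e / 3) * (s - t) by near: s.
have h2 : (power T E t (hl t) - e / 3 - e / 3) * (s - t) <= E s (hl s) - E t (hl t) by near: s.
have h3 := energyI sT; have h4 := energyI tI.
by move: h1 h2; rewrite !mulrBl mulrDl; lra.
Unshelve. all: by end_near. Qed.

Lemma slope_hat_limit_curve t : t \in `[0, T] -> slope_hat t (limit_curve t) = 0%E.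
Proof.
move=> tT; have := repr_state E (time_of t) (hl t); rewrite state_rel_sym => /state_rel_crit.
rewrite /= val_time_of// => /(_ (hl_crit tT)).
rewrite /crit/= /slope_hat /limit_curve.
have /= -> := state_rel_time (repr_state E (time_of t) (hl t)).
by rewrite val_time_of.
Qed.

Hypothesis critE : critical_structure T E.

Lemma limit_balance s t l l' : s \in `[0, T] -> t \in `[0, T] -> s <= t ->
  unique (left_limit limit_curve s) l -> unique (right_limit T limit_curve t) l' ->
  ((energy_hat l' - energy_hat l)%:E =
    \int[lebesgue_measure]_(r in `[s, t]) (power_hat (limit_curve r))%:E
      - (right_value Vl t - left_value Vl s)%:E)%E.
Proof.
move=> sT tT st [ll _] [rl _].
have [z [F [aF _ _ [_ ul]]]] := left_approach sT.
have [z' [F' [aF' _ _ [_ ul']]]] := right_approach tT.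
rewrite -(ul _ ll) -(ul' _ rl) !(energy_hat_state _ _ critE) !val_time_of//.
rewrite (approach_energy sT aF) (approach_energy tT aF').
move: (sT) (tT); rewrite !in_itv/= => /andP[s0 sT'] /andP[t0 tT'].
have -> : (\int[lebesgue_measure]_(r in `[s, t]) (power_hat (limit_curve r))%:E =
    \int[lebesgue_measure]_(r in `[s, t]) (power T E r (hl r))%:E)%E.
  apply: eq_integral => r; rewrite inE/= in_itv/= => /andP[sr rt].
  have rT : r \in `[0, T] by rewrite in_itv/= (le_trans s0)// (le_trans rt).
  by rewrite /limit_curve (power_hat_state _ _ powE) val_time_of.
have ist := integrable_power s0 tT'.
rewrite -[X in _ = (X + _)%E]fineK; last exact: integrable_fin_num.
rewrite -[fine _]/(Rintegral _ _ _) -workB// -EFinB; congr EFin; lra.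
Qed.

End LimitCurve.

(** * Passage to the limit in the energy identity, and conclusion *)

Lemma limit_energy_identity (R : realType) (X : metricType R) (T : R) (E : R -> X -> R)
    (omega : R -> X -> X) (x0 : X) (delta : nat -> R) (hl : R -> X) (Vl : R -> R)
    (K : set X) (B : R) :
  0 < T -> regular_energy T E -> critical_structure T E -> power_lifts T E ->
  (forall n, 0 < delta n) -> compact K ->
  (forall n i, (i <= nsteps T (delta n))%N -> K (iterate omega x0 (delta n) i)) ->
  (forall n i, (i <= nsteps T (delta n))%N -> forall t, t \in `[0, T] ->
    `|power T E t (iterate omega x0 (delta n) i)| <= B) ->
  (forall t, jump_sum T E omega x0 (delta n) t @[n --> \oo] --> Vl t) ->
  (forall (G : set_system nat) t y, UltraFilter G -> \oo `<=` G -> t \in `[0, T] ->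
    discrete_evolution T omega x0 (delta n) t @[n --> G] --> y ->
    path_component (R := R) (crit (E t)) y (hl t)) ->
  [/\ forall t : `[0, T]%classic,
        state E t (discrete_evolution T omega x0 (delta n) (\val t)) @[n --> \oo] -->
        state E t (hl (\val t)),
      lebesgue_measure.-integrable `[0, T] (EFin \o (fun s => power T E s (hl s))),
      forall s, s \in `[0, T] -> `|power T E s (hl s)| <= B &
      forall t, t \in `[0, T] -> E t (hl t) + Vl t = E 0 x0 + work T E hl t].
Proof.
move=> T0 regE critE powE delta0 cK wK pB V_cvg lim.
have state_h (t : `[0, T]%classic) :
    state E t (discrete_evolution T omega x0 (delta n) (\val t)) @[n --> \oo] -->
    state E t (hl (\val t)).
  apply: (@state_cvg _ _ T E _ \oo
    (fun n => (t, discrete_evolution T omega x0 (delta n) (\val t))) t (hl (\val t)) K) => //.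
  - by apply: nearW => n; apply: wK; exact: step_index_le.
  - exact: cvg_cst.
  - move=> G y GU ooG hy; apply/asboolP; right; split=> //=.
    by apply: lim hy => //; exact: time_val.
(* The evolutions themselves may fail to converge in [X]; their powers converge because the power is
   continuous on the quotient. *)
have power_h (s : R) : s \in `[0, T] ->
    power T E s (discrete_evolution T omega x0 (delta n) s) @[n --> \oo] --> power T E s (hl s).
  move=> sT; have := cvg_comp _ _ (state_h (time_of T0 s)) (powE.2 _).
  rewrite (power_hat_state _ _ powE) val_time_of//; apply: cvg_trans.
  by apply: near_eq_cvg; apply: nearW => n /=; rewrite (power_hat_state _ _ powE) val_time_of.
have cE : continuous (@energy_hat R X T E) by exact: energy_hat_continuous.
have energy_h (s : R) : s \in `[0, T] ->
    E s (discrete_evolution T omega x0 (delta n) s) @[n --> \oo] --> E s (hl s).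
  move=> sT; have := cvg_comp _ _ (state_h (time_of T0 s)) (cE _).
  rewrite (energy_hat_state _ _ critE) val_time_of//; apply: cvg_trans.
  by apply: near_eq_cvg; apply: nearW => n /=; rewrite (energy_hat_state _ _ critE) val_time_of.
have hB n (s : R) : s \in `[0, T] ->
    `|power T E s (discrete_evolution T omega x0 (delta n) s)| <= B.
  by apply: pB; exact: step_index_le.
have [intP workP] := bounded_convergence_itv (B := B)
  (fun n => evolution_measurable T0 regE (delta0 n) (@pB n)) hB power_h.
split => // [s sT|t tT].
  have BB : (fun _ : nat => B) @ \oo --> B by exact: cvg_cst.
  apply: ler_cvg_to (cvg_norm (power_h s sT)) BB _.
  by apply: nearW => n; exact: hB.
have lhs : E t (discrete_evolution T omega x0 (delta n) t) +
    jump_sum T E omega x0 (delta n) t @[n --> \oo] --> E t (hl t) + Vl t.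
  by apply: cvgD; [exact: energy_h|exact: V_cvg].
apply: (cvg_unique _ lhs) => //.
apply: (@cvg_trans _ (E 0 x0 + \int[lebesgue_measure]_(s in `[0, t])
  power T E s (discrete_evolution T omega x0 (delta n) s) @[n --> \oo])).
  apply: near_eq_cvg; apply: nearW => n /=.
  by rewrite -(energy_identity T0 regE (delta0 n) (@pB n) tT).
by apply: cvgD; [exact: cvg_cst|exact: workP].
Qed.

Theorem theorem1 (R : realType) (X : metricType R) (T : R) (E : R -> X -> R)
    (omega : R -> X -> X) (c : R -> X -> X -> R) (x0 : X) (delta : nat -> R) :
  0 < T ->
  locally_compact [set: X] ->
  regular_energy T E ->
  power_control T E ->
  compact_sublevels T E ->
  critical_structure T E ->
  critical_inequality T E ->
  slope_lipschitz_in_time T E ->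
  path_space (X := X) ->
  slope_lipschitz_in_space T E ->
  power_lifts T E ->
  energy_nonincreasing T E omega ->
  reaches_critical T E omega ->
  is_action T E c ->
  compatible T E omega c ->
  chain_condition T c ->
  zero_action_iff T E c ->
  slope (E 0) x0 = 0%E ->
  (forall n, 0 < delta n) ->
  delta n @[n --> \oo] --> 0 ->
  exists phi : nat -> nat, {homo phi : m n / (m < n)%N} /\
  exists (eta etam etap : R -> state_space T E)
    (mu : {finite_measure set (measurableTypeR R) -> \bar R}),
    (* (i) *)
    (forall t : `[0, T]%classic,
      state E t (discrete_evolution T omega x0 (delta (phi n)) (\val t))
        @[n --> \oo] --> eta (\val t)) /\
    (* (ii) *)
    [/\ mu (~` `[0, T]) = 0%E,
        weak_star_cvg T
          (fun n => jump_measure T E omega x0 (delta (phi n))) mu,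
        countable (atomic_support mu) &
        mu (~` atomic_support mu) = 0%E] /\
    (* (iii), with the conventions on etam 0 and etap T *)
    (forall t, t \in `[0, T] ->
      unique (left_limit eta t) (etam t) /\
      unique (right_limit T eta t) (etap t)) /\
    (* (iv) *)
    (forall s t, 0 <= s -> s < t -> t <= T ->
      ((energy_hat (etap t) - energy_hat (etam s))%R%:E =
        \int[lebesgue_measure]_(tau in `[s, t]) (power_hat (eta tau))%:E
          - mu `[s, t]%classic)%E) /\
    (* (v) *)
    (forall t, t \in `[0, T] -> slope_hat t (eta t) = 0%E) /\
    (* (vi) *)
    (forall t, t \in `[0, T] -> ~ atomic_support mu t ->
      eta s @[s --> within `[0, T] (nbhs t)] --> eta t) /\
    (forall t, atomic_support mu t ->
      (energy_hat (etam t) - energy_hat (etap t))%:E = mu [set t] /\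
      mu [set t] = (action_hat c t (etam t) (etap t))%:E).
Proof.
move=> T0 lcX regE powC subE critE ineqE lipE _ _ powE decE critW actE compE chainE zeroE
  crit0 delta0 delta_cvg.
have [K [B [cK B0 KB]]] := evolution_bounded x0 T0 regE powC decE subE.
have VC n t : jump_sum T E omega x0 (delta n) t <= 2 * B + B * T.
  by apply: (jump_sum_bounded T0 regE decE (delta0 n) B0) => i iM; exact: (KB _ _ (delta0 n) iM).2.
have [phi [hl [Vl [[phi_homo Vl_homo Vl0 VlT] [hlK hl_crit V_cvg action_V lim]]]]] :=
  evolution_limit T0 regE decE critW actE compE chainE zeroE crit0 delta0 delta_cvg cK
    (fun n i iM => (KB _ i (delta0 n) iM).1) VC.
have [state_h intP powB energyI] := limit_energy_identity T0 regE critE powE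
  (fun n => delta0 (phi n)) cK (fun n i iM => (KB _ i (delta0 (phi n)) iM).1)
  (fun n i iM t tT => ((KB _ i (delta0 (phi n)) iM).2 t tT).2) V_cvg lim.
have [mu [muE mu1 mu0]] := monotone_measure (ltW T0) Vl_homo Vl0 VlT.
have [nu nuE] := finite_measureR mu.
have [mu_ mu_P] := choice (fun n => jump_measure_finite x0 T0 regE decE (delta0 (phi n))).
have nu_itv s t : s <= t -> nu `]s, t]%classic = (right_value Vl t - right_value Vl s)%:E.
  by rewrite nuE; exact: muE.
have nu1 t : nu [set t] = (right_value Vl t - left_value Vl t)%:E by rewrite nuE mu1.
have nu0 : nu (~` `[0, T]) = 0%E by rewrite nuE mu0.
have nuJ : atomic_support mu = atomic_support nu by rewrite nuE.
have nJ t : ~ atomic_support nu t -> left_value Vl t = right_value Vl t.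
  rewrite /atomic_support/= nu1 lte_fin subr_gt0 => /negP; rewrite -leNgt => rl.
  apply/eqP; rewrite eq_le rl andbT.
  exact: le_trans (left_value_le Vl_homo t) (right_value_ge Vl_homo t).
have /choice[etam etamP] : forall t : R, exists l : state_space T E, t \in `[0, T] ->
    unique (left_limit (limit_curve E T0 hl) t) l.
  move=> t.
  have [tT|tT] := boolP (t \in `[0, T]); last by exists (limit_curve E T0 hl t).
  have [z [F [_ _ _ uz]]] :=
    left_approach T0 regE lcX actE chainE zeroE cK Vl_homo Vl0 hlK hl_crit action_V tT.
  by exists (state E (time_of T0 t) z).
have /choice[etap etapP] : forall t : R, exists l : state_space T E, t \in `[0, T] ->
    unique (right_limit T (limit_curve E T0 hl) t) l.
  move=> t.
  have [tT|tT] := boolP (t \in `[0, T]); last by exists (limit_curve E T0 hl t).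
  have [z [F [_ _ _ uz]]] :=
    right_approach T0 regE lcX actE chainE zeroE cK Vl_homo VlT hlK hl_crit action_V tT.
  by exists (state E (time_of T0 t) z).
have balance s t : s \in `[0, T] -> t \in `[0, T] -> s <= t ->
    ((energy_hat (etap t) - energy_hat (etam s))%R%:E =
      \int[lebesgue_measure]_(r in `[s, t]) (power_hat (limit_curve E T0 hl r))%:E
        - (right_value Vl t - left_value Vl s)%:E)%E.
  move=> sT tT st; exact: (limit_balance regE lcX actE chainE zeroE cK Vl_homo Vl0 VlT hlK
    hl_crit action_V intP powB energyI powE critE sT tT st (etamP s sT) (etapP t tT)).
have JT t : atomic_support nu t -> t \in `[0, T].
  rewrite /atomic_support/=; apply: contraTT => tT; rewrite -leNgt -nu0.
  apply: le_measure; rewrite ?inE//; first exact: measurableC.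
  by move=> _ -> /=; exact/negP.
exists phi; split => //; exists (limit_curve E T0 hl), etam, etap, mu.
split; first by move=> t; rewrite /limit_curve time_ofK.
split.
  rewrite nuJ; split => //.
  - have -> : (fun n => jump_measure T E omega x0 (delta (phi n))) = (fun n => mu_ n : set R -> \bar R).
      by apply/funext => n; have [-> _ _] := mu_P n.
    rewrite -nuE; apply: (weak_star_cvg_cdf (ltW T0) _ _ Vl_homo nu_itv nu1 nu0 V_cvg).
      by move=> n s t st; have [_ + _] := mu_P n; apply.
    by move=> n; have [] := mu_P n.
  - exact: countable_atoms Vl_homo nu1.
  - rewrite -nuE; apply: (purely_atomic (ltW T0) Vl_homo nu_itv nu1 nu0) => t e t0 tT tJ e0.
    exact: (right_derivative_eq0 T0 regE actE zeroE cK Vl_homo hlK hl_crit action_V intP powB energyI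
      ineqE lipE powE t0 tT (nJ t tJ) e0).
split; first by move=> t tT; split; [exact: etamP|exact: etapP].
split.
  move=> s t s0 st tT; rewrite balance ?(ltW st)//; last 2 first.
  - by rewrite in_itv/= s0 (le_trans (ltW st)).
  - by rewrite in_itv/= tT (le_trans s0 (ltW st)).
  (* The atom at [s] is what turns the right value at [s] into the left value occurring in
     [balance]. *)
  have nuU : nu `[s, t]%classic = (nu [set s] + nu `]s, t]%classic)%E.
    rewrite -(setU1itv false) ?bnd_simp ?(ltW st)//; apply: measureU => //.
    by apply/seteqP; split=> // x [] /= ->; rewrite in_itv/= ltxx.
  rewrite -nuE nuU nu1 nu_itv ?(ltW st)// -EFinD; congr (_ - _%:E)%E; ring.
split; first by move=> t tT; exact: slope_hat_limit_curve.
rewrite nuJ -nuE; split => [t tT /nJ lr|t /JT tT].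
  exact: (limit_curve_continuous regE actE zeroE cK Vl_homo hlK hl_crit action_V tT lr).
rewrite nu1 (limit_jump regE lcX actE chainE zeroE cK Vl_homo Vl0 VlT hlK hl_crit action_V
  intP powB energyI tT (etamP t tT) (etapP t tT)); split => //.
(* On the degenerate interval [[t, t]] the integral vanishes and the balance is the energy drop at
   [t]. *)
have := balance t t tT tT (lexx t); rewrite set_itv1 integral_set1 add0e -EFinN => -[e].
by congr EFin; rewrite -opprB e opprK.
Qed.
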